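(* Let $A$ be analytic in $\mathbb{D}$, and suppose that $|A(z)|^p (1-|z|^2)^{2p-1}\, dm(z)$ is a Carleson measure for some $0<p<\infty$. Then the zero-sequence of each non-trivial solution $f$ (that is, $f\not\equiv 0$) of the linear differential equation $f''+Af=0$ in $\mathbb{D}$ is uniformly separated.
   Context: $\mathbb{D}$ is the open unit disc of $\mathbb{C}$ and $dm(z)$ is the element of Lebesgue area measure. A finite positive measure $\mu$ in $\mathbb{D}$ is called a Carleson measure if there exists a constant $0<M<\infty$ such that $\int_{\mathbb{D}} |g(z)|\, d\mu(z) \leq M \big( \sup_{0<r<1} \frac{1}{2\pi}\int_0^{2\pi} |g(re^{i\theta})|\, d\theta\big)$ for every analytic function $g$ in $\mathbb{D}$. For $z,w\in\mathbb{D}$, $\varrho(z,w)=|z-w|/|1-\overline{z}w|$ is the pseudo-hyperbolic distance. A (finite or infinite) sequence $\{z_n\}$ in $\mathbb{D}$ is called uniformly separated if $\inf_{k} \prod_{n\neq k} \varrho(z_n,z_k)>0$, where $n,k$ range over the index set of the sequence. The zero-sequence of $f$ is the sequence of zeros of $f$ in $\mathbb{D}$. *)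

(* Defs.v *)
(* The real field is an arbitrary [R : realType]; the complex field is [R[i]]. *)
From HB Require Import structures.
From mathcomp Require Import all_boot all_order all_algebra.
From mathcomp Require Import complex.
From mathcomp Require Import all_classical all_reals all_analysis.

Set Implicit Arguments.
Unset Strict Implicit.
Unset Printing Implicit Defensive.

Import Order.TTheory GRing.Theory Num.Theory.
Import numFieldNormedType.Exports.

Local Open Scope classical_set_scope.
Local Open Scope ring_scope.
Local Open Scope complex_scope.

(* The norm of [R[i]] is [R[i]]-valued; this is the modulus as an element
   of [R]. *)
Notation cmod := Normc.normc.

Section Disc.
Variable R : realType.
Implicit Types (f g A : R[i] -> R[i]) (w z : R[i]).

Definition unit_disc : set R[i] := [set z | cmod z < 1].

(* Functions are total on [R[i]], but only their values in the open set
   [unit_disc] matter.  [R[i]^o] is [R[i]] as a normed space over itself, so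
   these are complex derivatives. *)
Definition analytic_in_disc f : Prop :=
  forall z, unit_disc z -> derivable (f : R[i]^o -> R[i]^o) z 1.

Definition cderiv (n : nat) f : R[i] -> R[i] := @derive1n R[i] R[i]^o n f.

Definition solution A f : Prop :=
  analytic_in_disc f /\
  forall z, unit_disc z -> cderiv 2 f z + A z * f z = 0.

Definition nontrivial_in_disc f : Prop :=
  exists2 z, unit_disc z & f z != 0.

(* Measures live on the plane [R * R], identified with [R[i]]. *)
Definition plane := (measurableTypeR R * measurableTypeR R)%type.

Definition toC (x : plane) : R[i] := x.1 +i* x.2.

Definition area : set plane -> \bar R :=
  (@lebesgue_measure R \x @lebesgue_measure R)%E.

Definition plane_disc : set plane := toC @^-1` unit_disc.

(* [mu] is the measure [h dm] in the disc, extended by zero to the plane. *)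
Definition has_density_in_disc (mu : set plane -> \bar R) (h : R[i] -> R)
    : Prop :=
  forall S : set plane, measurable S ->
    (mu S = \int[area]_(x in S `&` plane_disc) (h (toC x))%:E)%E.

Definition circle_mean g (r : R) : \bar R :=
  (((2 * pi)^-1)%:E *
   \int[@lebesgue_measure R]_(t in `[0%R, (2 * pi)%R])
     (cmod (g ((r * cos t) +i* (r * sin t))))%:E)%E.

Definition hardy1_norm g : \bar R :=
  ereal_sup [set circle_mean g r | r in `]0%R, 1%R[].

Definition carleson_measure (mu : {finite_measure set plane -> \bar R})
    : Prop :=
  exists2 M : R, 0 < M &
    forall g, analytic_in_disc g ->
      (\int[mu]_(x in plane_disc) (cmod (g (toC x)))%:E
         <= M%:E * hardy1_norm g)%E.

Definition pseudohyp z w : R := cmod (z - w) / cmod (1 - z^* * w).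

(* The index set of a finite or infinite sequence. *)
Definition index_set (N : set nat) : Prop := N = setT \/ exists k, N = `I_k.

(* The infinite product is the limit of the partial products, which form a
   nonincreasing sequence of nonnegative reals when the [z n] are in the
   disc. *)
Definition uniformly_separated (N : set nat) (z : nat -> R[i]) : Prop :=
  (0 < ereal_inf
     [set (limn (fun m => \prod_(n < m | ((n : nat) \in N) && (n != k :> nat))
                            pseudohyp (z n) (z k)))%:E | k in N])%E.

Definition zero_of_order (m : nat) f w : Prop :=
  (forall k, (k < m)%N -> cderiv k f w = 0) /\ cderiv m f w != 0.

(* [z], indexed by [N], lists the zeros of [f] in the disc, each one repeated
   according to its multiplicity; order [0] means that [f w != 0]. *)
Definition zero_sequence f (N : set nat) (z : nat -> R[i]) : Prop :=
  [/\ index_set N,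
      forall n, N n -> unit_disc (z n) &
      forall w, unit_disc w ->
        exists2 m, zero_of_order m f w & ([set n | N n /\ z n = w] #= `I_m)%card].

End Disc.

(* Main.v *)
Require Import Defs.
From HB Require Import structures.
From mathcomp Require Import all_boot all_order all_algebra.
From mathcomp Require Import complex ring lra.
From mathcomp Require Import all_classical all_reals all_analysis.
From mathcomp Require Import measurable_realfun.
Import Order.TTheory GRing.Theory Num.Theory.
Import numFieldNormedType.Exports.

(** Let E(z, w) = 1 + 2 |z - w|^2 / ((1 - |z|^2) (1 - |w|^2)), the hyperbolic
cosine of the hyperbolic distance of z and w ([hcosh]).  Since
rho^2 = (E - 1) / (E + 1), the product of the rho(z_n, z_k) over n is bounded
below as soon as E(z_n, z_k) >= 1 + eta for all n <> k, with a fixed eta > 0,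
and the sums of 1 / E(z_n, z_k) over n are bounded uniformly in k
([pseudohyp_ge]).

Call a point w bad when |A(w)| (1 - |w|^2)^2 >= 1.  Two facts concern these
points.

The Carleson condition makes bad points rare.  For the functions
g_a(w) = (1 - |a|^2) / (1 - a^* w)^2 the Hardy norm is at most 1, because on
circles they are dominated by Poisson kernels ([test_hardy]).  The measure of a
small neighbourhood of w is at least a multiple of
(|A(w)| (1 - |w|)^2)^p (1 - |w|) ([mass_lower]), and there |g_a| is at least a
multiple of 1 / ((1 - |w|) E(a, w)).  Taking a = w bounds |A(w)| (1 - |w|^2)^2
on the disc ([coefficient_bound]).  Summing over a separated family of points
b_i, each within a bounded distance of a bad point, bounds the sum of the
1 / E(a, b_i) ([packing_sum]).

The differential equation forces bad points between zeros.  A conformal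
parametrisation of the geodesic through two zeros turns the equation into
F'' + a F = 0 on an interval, where |a(x)| equals |A| (1 - |w|^2)^2 divided by
(1 - x^2)^2.  The function sqrt(1 - x^2) solves this equation for
a = 1 / (1 - x^2)^2 and has no zero in (0, 1), so a Sturm comparison shows that
the geodesic segment between two zeros contains a bad point
([bad_point_between]).  Comparing instead with sqrt(k^2 - x^2) for a small k,
the bound on A shows that distinct zeros satisfy E >= 1 + eta
([zeros_separated]).

The zeros themselves may be far from all bad points, so the packing bound is
applied to other points.  Fix a = z_k.  On the segment from a to z_n choose a
point b_n that is close to a bad point and such that no bad point is near the
rest of the segment, from b_n to z_n, unless b_n = z_n ([stop_exists]).  As b_n
lies between a and z_n, 1 / E(a, z_n) <= 1 / E(a, b_n) ([seg_le]).  The b_n are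
separated: there is a bad point on the segment from z_n to z_m, and if b_n and
b_m were close, thin triangles would place it near the part beyond b_n or the
part beyond b_m ([stops_separated]).  Hence [packing_sum] applies to the b_n.

The complex analysis behind these steps, namely the second derivative of f and
a Lipschitz estimate for A, follows from the Cauchy formula on circles.  It is
obtained by contracting a circle to a point: the pull-back of the form
g(w) dw / (w - a) to a rectangle has integral zero along its boundary, by
bisection as in Goursat's lemma ([form2_shrink], [cauchy_formula]). *)

Set Implicit Arguments.
Unset Strict Implicit.
Unset Printing Implicit Defensive.
Local Open Scope classical_set_scope.
Local Open Scope ring_scope.
Local Open Scope complex_scope.
Local Notation Re := complex.Re.
Local Notation Im := complex.Im.

(** * The hyperbolic plane in the disc *)

Section Modulus.
Variable R : realType.
Implicit Types z w : R[i].

Lemma cmod_sqr z : cmod z ^+ 2 = Re z ^+ 2 + Im z ^+ 2.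
Proof. by case: z => a b /=; rewrite sqr_sqrtr // addr_ge0 ?sqr_ge0. Qed.

Lemma cmod_ge0 z : 0 <= cmod z.
Proof. by case: z => a b /=; exact: sqrtr_ge0. Qed.

Lemma cmodM z w : cmod (z * w) = cmod z * cmod w.
Proof. exact: Normc.normcM. Qed.

Lemma cmodD z w : cmod (z + w) <= cmod z + cmod w.
Proof. exact: le_normcD. Qed.

Lemma cmodN z : cmod (- z) = cmod z.
Proof. exact: normcN. Qed.

Lemma cmodB z w : cmod (z - w) = cmod (w - z).
Proof. by rewrite -cmodN opprB. Qed.

Lemma cmodV z : cmod (z^-1) = (cmod z)^-1.
Proof. exact: Normc.normcV. Qed.

Lemma cmodX z n : cmod (z ^+ n) = cmod z ^+ n.
Proof.
elim: n => [|n IH]; first by rewrite !expr0 Normc.normc1.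
by rewrite !exprS cmodM IH.
Qed.

Lemma cmodJ z : cmod z^* = cmod z.
Proof. by case: z => a b /=; rewrite sqrrN. Qed.

Lemma cmod_real (x : R) : cmod x%:C = `|x|.
Proof. by rewrite /= expr0n /= addr0 sqrtr_sqr. Qed.

Lemma cmod_eq0 z : (cmod z == 0) = (z == 0).
Proof.
apply/eqP/eqP => [|->]; first exact: Normc.eq0_normc.
by rewrite /= expr0n /= addr0 sqrtr0.
Qed.

Lemma cmod_gt0 z : (0 < cmod z) = (z != 0).
Proof. by rewrite lt_def cmod_ge0 andbT cmod_eq0. Qed.

Lemma Re_le_cmod z : `|Re z| <= cmod z.
Proof.
by rewrite -(ler_pXn2r (n := 2)) ?nnegrE ?cmod_ge0 // cmod_sqr real_normK ?num_real // lerDl sqr_ge0.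
Qed.

Lemma Im_le_cmod z : `|Im z| <= cmod z.
Proof.
by rewrite -(ler_pXn2r (n := 2)) ?nnegrE ?cmod_ge0 // cmod_sqr real_normK ?num_real // lerDr sqr_ge0.
Qed.

Lemma cmod_le_ReIm z : cmod z <= `|Re z| + `|Im z|.
Proof.
rewrite -(ler_pXn2r (n := 2)) ?nnegrE ?cmod_ge0 ?addr_ge0 // cmod_sqr sqrrD.
by rewrite !real_normK ?num_real // lerD2r lerDl mulrn_wge0 // mulr_ge0.
Qed.

Lemma cReM z w : Re (z * w) = Re z * Re w - Im z * Im w.
Proof. by case: z; case: w. Qed.
Lemma cImM z w : Im (z * w) = Re z * Im w + Im z * Re w.
Proof. by case: z => a b; case: w => c d. Qed.
Lemma cReD z w : Re (z + w) = Re z + Re w.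
Proof. by case: z; case: w. Qed.
Lemma cImD z w : Im (z + w) = Im z + Im w.
Proof. by case: z; case: w. Qed.
Lemma cReN z : Re (- z) = - Re z.
Proof. by case: z. Qed.
Lemma cImN z : Im (- z) = - Im z.
Proof. by case: z. Qed.
Lemma cReJ z : Re z^* = Re z.
Proof. by case: z. Qed.
Lemma cImJ z : Im z^* = - Im z.
Proof. by case: z. Qed.

End Modulus.

Section HyperbolicPlane.
Variable R : realType.
Implicit Types a b p q x y z w v : R[i].
Local Notation D := (@unit_disc R).

Definition defect z : R := 1 - cmod z ^+ 2.

Lemma defect_gt0 z : D z -> 0 < defect z.
Proof.
move=> /= hz; rewrite subr_gt0 expr_lt1 //; exact: cmod_ge0.
Qed.

(** The hyperbolic cosine of the hyperbolic distance, for curvature -1. *)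
Definition hcosh z w : R := 1 + 2 * cmod (z - w) ^+ 2 / (defect z * defect w).

Lemma hcoshC z w : hcosh z w = hcosh w z.
Proof. by rewrite /hcosh cmodB (mulrC (defect z)). Qed.

Lemma hcosh_ge1 z w : D z -> D w -> 1 <= hcosh z w.
Proof.
move=> hz hw; rewrite lerDl; apply: divr_ge0; apply: mulr_ge0; rewrite ?sqr_ge0 ?ltW ?defect_gt0 //.
Qed.

Lemma hcosh_gt0 z w : D z -> D w -> 0 < hcosh z w.
Proof. by move=> hz hw; apply: lt_le_trans (hcosh_ge1 hz hw). Qed.

Lemma hcoshxx z : hcosh z z = 1.
Proof. by rewrite /hcosh subrr Normc.normc0 expr0n /= mulr0 mul0r addr0. Qed.

Lemma cmod_one_sub_sqr z w :
  cmod (1 - z^* * w) ^+ 2 = cmod (z - w) ^+ 2 + defect z * defect w.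
Proof.
by rewrite /defect !cmod_sqr; case: z => a b; case: w => c d /=; ring.
Qed.

Lemma one_sub_neq0 z w : D z -> D w -> 1 - z^* * w != 0.
Proof.
move=> hz hw; rewrite -cmod_eq0 -sqrf_eq0 cmod_one_sub_sqr gt_eqF //.
by rewrite ltr_wpDl ?sqr_ge0 // mulr_gt0 // defect_gt0.
Qed.

Lemma hcosh_succ z w : D z -> D w ->
  hcosh z w + 1 = 2 * cmod (1 - z^* * w) ^+ 2 / (defect z * defect w).
Proof.
move=> hz hw; rewrite cmod_one_sub_sqr /hcosh.
have := defect_gt0 hz; have := defect_gt0 hw => h1 h2; field.
by rewrite !gt_eqF.
Qed.

(** A weak form of cosh (s + t) <= 2 cosh s cosh t. The triangle inequality is
replaced by the modulus of the identity
(1 - |y|^2) (1 - x^* z) = (1 - x^* y) (1 - y^* z) - (x - y)^* (z - y). *)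
Lemma hcosh_triangle x y z : D x -> D y -> D z ->
  hcosh x z <= 3 * hcosh x y * hcosh y z.
Proof.
move=> hx hy hz.
have [[dx dy] dz] := (defect_gt0 hx, defect_gt0 hy, defect_gt0 hz).
have key : defect y * cmod (1 - x^* * z) <=
    cmod (1 - x^* * y) * cmod (1 - y^* * z) + cmod (x - y) * cmod (y - z).
  have -> : defect y * cmod (1 - x^* * z) =
      cmod ((1 - x^* * y) * (1 - y^* * z) - (x - y)^* * (z - y)).
    rewrite -[defect y]ger0_norm ?ltW // -cmod_real -cmodM; congr cmod.
    rewrite /defect cmod_sqr; apply/eqP; rewrite eq_complex.
    case: x {hx dx} => x1 x2; case: y {hy dy} => y1 y2.
    case: z {hz dz} => z1 z2 /=; apply/andP; split; apply/eqP; ring.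
  by apply: (le_trans (cmodD _ _)); rewrite cmodN !cmodM cmodJ (cmodB z).
have : hcosh x z + 1 <= (hcosh x y + 1) * (hcosh y z + 1) +
    (hcosh x y - 1) * (hcosh y z - 1).
  have e1 : hcosh x y - 1 = 2 * cmod (x - y) ^+ 2 / (defect x * defect y).
    by rewrite /hcosh addrAC subrr add0r.
  have e2 : hcosh y z - 1 = 2 * cmod (y - z) ^+ 2 / (defect y * defect z).
    by rewrite /hcosh addrAC subrr add0r.
  rewrite !hcosh_succ // e1 e2.
  set m := cmod _ in key *; set b := cmod (1 - x^* * y) in key *.
  set c := cmod (1 - y^* * z) in key *.
  set u := cmod (x - y) in key *; set v := cmod (y - z) in key *.
  have m0 : 0 <= m by exact: cmod_ge0.
  have -> : 2 * b ^+ 2 / (defect x * defect y) *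
     (2 * c ^+ 2 / (defect y * defect z)) +
     2 * u ^+ 2 / (defect x * defect y) *
     (2 * v ^+ 2 / (defect y * defect z)) =
     2 * (2 * (b * c) ^+ 2 + 2 * (u * v) ^+ 2) / defect y ^+ 2
       / (defect x * defect z).
    by field; rewrite !gt_eqF.
  rewrite ler_pM2r ?invr_gt0 ?mulr_gt0 // ler_pdivlMr ?exprn_gt0 //.
  have h1 : 0 <= defect y * m by rewrite mulr_ge0 // ltW.
  have h2 : 0 <= b * c + u * v by rewrite addr_ge0 // mulr_ge0 // cmod_ge0.
  have le1 : (defect y * m) ^+ 2 <= (b * c + u * v) ^+ 2 by rewrite ler_pXn2r.
  have := sqr_ge0 (b * c - u * v); rewrite exprMn in le1; lra.
have h1 := hcosh_ge1 hx hy; have h2 := hcosh_ge1 hy hz; nra.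
Qed.

(** The hyperbolic segment from p to q. In the hyperboloid model a point of the
disc is a unit vector and [hcosh] is the Lorentz product up to sign, so the
segment consists of the unit vectors s p + t q with s, t >= 0. Pairing with
every v expresses this without vectors. *)
Definition seg p q y := D y /\ exists s t : R, [/\ 0 <= s, 0 <= t &
  forall v, D v -> hcosh y v = s * hcosh p v + t * hcosh q v].

Lemma segC p q y : seg p q y -> seg q p y.
Proof.
by case=> hy [s [t [hs ht h]]]; split => //; exists t, s; split => // v hv; rewrite addrC h.
Qed.

Lemma seg_left p q : D p -> seg p q p.
Proof.
by move=> hp; split => //; exists 1, 0; split => // v _; rewrite mul1r mul0r addr0.
Qed.

Lemma seg_right p q : D q -> seg p q q.
Proof. by move=> hq; apply/segC/seg_left. Qed.

(** The Lorentz norm of a point is one. *)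
Lemma seg_norm p q y s t : D p -> D q -> D y ->
  (forall v, D v -> hcosh y v = s * hcosh p v + t * hcosh q v) ->
  s ^+ 2 + t ^+ 2 + 2 * s * t * hcosh p q = 1.
Proof.
move=> hp hq hy h; have := h y hy.
rewrite hcoshxx (hcoshC p) (hcoshC q) !h // !hcoshxx (hcoshC q p) => e.
rewrite [RHS]e; ring.
Qed.

(** The vector s p + t q has hyperboloid coordinates n (time) and k (space). It is
a unit vector, so stereographic projection sends it to the point k / (1 + n) of
the disc. *)
Lemma seg_exists p q s t : D p -> D q -> 0 <= s -> 0 <= t ->
  s ^+ 2 + t ^+ 2 + 2 * s * t * hcosh p q = 1 ->
  exists2 y, D y & forall v, D v -> hcosh y v = s * hcosh p v + t * hcosh q v.
Proof.
move=> hp hq hs ht hst.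
have [dp dq] := (defect_gt0 hp, defect_gt0 hq).
pose n := s * (1 + cmod p ^+ 2) / defect p + t * (1 + cmod q ^+ 2) / defect q.
pose k : R[i] := (2 * s / defect p)%:C * p + (2 * t / defect q)%:C * q.
have nk : n ^+ 2 - cmod k ^+ 2 = 1.
  rewrite -hst /n /k /hcosh; move: dp dq; rewrite /defect !cmod_sqr.
  case: p {hp hst n k} => p1 p2; case: q {hq} => q1 q2 /= dp dq; field.
  by rewrite !gt_eqF.
have n0 : 0 <= n.
  by apply: addr_ge0; apply: divr_ge0; rewrite ?(ltW dp) ?(ltW dq) // mulr_ge0 // addr_ge0 // sqr_ge0.
have n1 : 0 < 1 + n by rewrite ltr_pwDl.
pose y := ((1 + n)^-1)%:C * k.
have cy : cmod y ^+ 2 = (n - 1) / (n + 1).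
  rewrite cmodM exprMn cmod_real ger0_norm ?invr_ge0 ?ltW //.
  have -> : cmod k ^+ 2 = n ^+ 2 - 1 by rewrite -nk; ring.
  by field; rewrite !gt_eqF // addrC.
have dy : defect y = 2 / (1 + n).
  by rewrite /defect cy; field; rewrite !gt_eqF // addrC.
have hy : D y.
  rewrite /unit_disc /= -(expr_lt1 (n := 2)) ?cmod_ge0 //.
  by rewrite -subr_gt0 -/(defect y) dy divr_gt0.
exists y => // v hv; have dv := defect_gt0 hv.
have -> : hcosh y v = (n * (1 + cmod v ^+ 2) - 2 * Re (k * v^*)) / defect v.
  have -> : hcosh y v = ((1 + cmod y ^+ 2) * (1 + cmod v ^+ 2)
      - 4 * Re (y * v^*)) / (defect y * defect v).
    have dy' := defect_gt0 hy.
    rewrite /hcosh; move: dy' dv; rewrite /defect !cmod_sqr.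
    case: (y) => y1 y2; case: v {hv} => v1 v2 /= dy' dv; field.
    by rewrite !gt_eqF.
  rewrite cy dy.
  have -> : Re (y * v^*) = Re (k * v^*) / (1 + n).
    rewrite /y; case: (k) => k1 k2; case: (v) => v1 v2 /=.
    by field; rewrite gt_eqF.
  by field; rewrite !gt_eqF // addrC.
rewrite /n /k /hcosh; move: dp dq dv; rewrite /defect !cmod_sqr.
case: (p) => p1 p2; case: (q) => q1 q2; case: (v) => v1 v2 /= dp' dq' dv'; field.
by rewrite !gt_eqF.
Qed.

End HyperbolicPlane.

(** * Thin triangles and stops *)

Section Triangles.
Variable R : realType.
Implicit Types a b p q x y z w v : R[i].
Local Notation D := (@unit_disc R).

(** With y = s p + t q, the norm equation gives
E(p, y)^2 - 1 = t^2 (E(p, q)^2 - 1), and t <= 1. *)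
Lemma seg_le p q y : D p -> D q -> seg p q y -> hcosh p y <= hcosh p q.
Proof.
move=> hp hq [hy [s [t [hs ht h]]]].
have e := seg_norm hp hq hy h.
have E1 := hcosh_ge1 hp hq.
have Hpy := hcosh_gt0 hp hy; have Hpq := hcosh_gt0 hp hq.
rewrite -(ler_pXn2r (n := 2)) ?nnegrE ?(ltW Hpy) ?(ltW Hpq) //.
rewrite (hcoshC p y) h // hcoshxx (hcoshC q p).
have -> : (s * 1 + t * hcosh p q) ^+ 2 = 1 + t ^+ 2 * (hcosh p q ^+ 2 - 1).
  rewrite -[X in _ = X + _]e; ring.
have m0 : 0 <= s * t * hcosh p q by rewrite !mulr_ge0 // ltW // hcosh_gt0.
have t1 : t ^+ 2 <= 1.
  have := sqr_ge0 s. lra.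
have : 0 <= hcosh p q ^+ 2 - 1 by rewrite subr_ge0 expr_ge1 // ltW // hcosh_gt0.
move: (hcosh p q ^+ 2) => X hX; nra.
Qed.

(** The nonnegative root s of the norm equation of s v + t x. *)
Lemma seg_coef (a t : R) : 0 <= t -> t <= 1 ->
  exists2 s, 0 <= s & s ^+ 2 + t ^+ 2 + 2 * s * t * a = 1.
Proof.
move=> t0 t1.
have h : 0 <= 1 - t ^+ 2 by rewrite subr_ge0 expr_le1.
pose r := Num.sqrt ((t * a) ^+ 2 + (1 - t ^+ 2)).
have er : r ^+ 2 = (t * a) ^+ 2 + (1 - t ^+ 2).
  by rewrite sqr_sqrtr // addr_ge0 // sqr_ge0.
exists (r - t * a).
  rewrite subr_ge0 (le_trans (ler_norm _)) // -sqrtr_sqr ler_wsqrtr //.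
  by rewrite lerDl.
have -> : (r - t * a) ^+ 2 + t ^+ 2 + 2 * (r - t * a) * t * a =
  r ^+ 2 + t ^+ 2 - (t * a) ^+ 2 by ring.
rewrite er; ring.
Qed.

(** Let w = al x + be x' and c = E(x, x'). If be c <= 1 or al c <= 1, then w is
close to x or to x'. Otherwise compare be E(v, x') with al E(v, x); say the
former is smaller. The point s v + t x with t be c = 1 is then close to w: in
the expansion of its product with w the term t be c is 1, al t is at most 1, and
the two terms with s are at most 1 / 4 by the norm equations of w and of
s v + t x. *)
Lemma thin_triangle v x x' w : D v -> D x -> D x' -> seg x x' w ->
  exists2 y, seg v x y \/ seg v x' y & hcosh w y <= 3.
Proof.
(* The case 1 < be c of the comparison; exchanging x and x' gives the other. *)
have half v' y y' (al be : R) w' : D v' -> D y -> D y' -> D w' ->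
    0 <= al -> 0 <= be ->
    (forall u, D u -> hcosh w' u = al * hcosh y u + be * hcosh y' u) ->
    1 < be * hcosh y y' -> be * hcosh v' y' <= al * hcosh v' y ->
    exists2 u, seg v' y u & hcosh w' u <= 3.
  move=> hv hy hy' hw al0 be0 h hbc hle.
  have e := seg_norm hy hy' hw h.
  set c := hcosh y y' in e hbc; set a := hcosh v' y in hle.
  set a' := hcosh v' y' in hle.
  have c1 : 1 <= c by exact: hcosh_ge1.
  have a1 : 1 <= a by exact: hcosh_ge1.
  have bc0 : 0 < be * c by apply: lt_trans hbc.
  pose t := (be * c)^-1.
  have t0 : 0 < t by rewrite invr_gt0.
  have t1 : t <= 1 by rewrite invf_le1 // ltW.
  have [s s0 st] := seg_coef a (ltW t0) t1.
  have [u hu eu] := seg_exists hv hy s0 (ltW t0) st.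
  exists u; first by split => //; exists s, t; split => //; exact: ltW.
  rewrite h // (hcoshC y) (hcoshC y') !eu // hcoshxx -/a -/a' -/c.
  have tb : t * be * c = 1 by rewrite /t -mulrA mulVf // gt_eqF.
  have sta : 2 * s * t * a <= 1 by have := sqr_ge0 s; have := sqr_ge0 t; lra.
  have ab : 2 * al * be * c <= 1 by have := sqr_ge0 al; have := sqr_ge0 be; lra.
  have al1 : al <= 1.
    rewrite -(expr_le1 (n := 2)) //; have := sqr_ge0 be.
    have : 0 <= al * be * c by rewrite !mulr_ge0 // (le_trans _ c1).
    lra.
  have sa : 2 * (s * a) <= be * c.
    have -> : 2 * (s * a) = (2 * s * t * a) * (be * c).
      by rewrite -[LHS]mulr1 -tb; ring.
    by rewrite ler_piMl // ltW.
  have t4 : 4 * (al * (s * a)) <= 1.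
    apply: le_trans ab.
    have : al * (2 * (s * a)) <= al * (be * c) by rewrite ler_wpM2l.
    lra.
  have t5 : be * (s * a') <= s * (al * a) by rewrite mulrCA ler_wpM2l.
  have t6 : al * t <= 1 by rewrite mulr_ile1 // ltW.
  have -> : al * (s * a + t * 1) + be * (s * a' + t * c) =
    al * (s * a) + al * t + be * (s * a') + t * be * c by ring.
  rewrite tb; lra.
move=> hv hx hx' [hw [al [be [al0 be0 h]]]].
have e := seg_norm hx hx' hw h.
have c1 := hcosh_ge1 hx hx'.
have mixed : 0 <= 2 * al * be * hcosh x x' by rewrite !mulr_ge0 // (le_trans _ c1).
have al1 : al <= 1.
  by rewrite -(expr_le1 (n := 2)) //; have := sqr_ge0 be; lra.
have be1 : be <= 1.
  by rewrite -(expr_le1 (n := 2)) //; have := sqr_ge0 al; lra.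
have [hbc|hbc] := leP (be * hcosh x x') 1.
  exists x; first by left; exact: seg_right.
  by rewrite h // hcoshxx (hcoshC x'); lra.
have [hac|hac] := leP (al * hcosh x x') 1.
  exists x'; first by right; exact: seg_right.
  by rewrite h // hcoshxx; lra.
have [hle|/ltW hle] := leP (be * hcosh v x') (al * hcosh v x).
  have [u hu hwu] := half _ _ _ _ _ _ hv hx hx' hw al0 be0 h hbc hle.
  by exists u => //; left.
have h' u : D u -> hcosh w u = be * hcosh x' u + al * hcosh x u.
  by move=> hu; rewrite h // addrC.
rewrite hcoshC in hac.
have [u hu hwu] := half _ _ _ _ _ _ hv hx' hx hw be0 al0 h' hac hle.
by exists u => //; right.
Qed.

(** The threshold is 162 = 3 * 27 * 2: a bad point is moved across two thin
triangles, which costs 27 = 3 * 3 * 3, and then by one step of size 2. *)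
Definition far_from (B : set R[i]) b z :=
  forall y, seg b z y -> forall w, B w -> 162 < hcosh w y.

(** Suppose E(b, b') <= 2. In the triangle b, z, z' the bad point w is close to
[b, z] or to [b, z']. In the second case the triangle b', b, z' puts it close to
[b', z'] or to the short segment [b, b']. Each possibility contradicts that no
bad point is near the rest of a segment. When one stop is an endpoint a single
triangle is enough. *)
Lemma stops_separated (B : set R[i]) z z' b b' w : (forall u, B u -> D u) ->
  D z -> D z' -> D b -> D b' ->
  b = z \/ far_from B b z -> b' = z' \/ far_from B b' z' ->
  B w -> seg z z' w -> hcosh b b' <= 2 -> b = z /\ b' = z'.
Proof.
move=> BD.
have one z1 z1' b1 w1 : D z1 -> D z1' -> D b1 -> far_from B b1 z1 ->
    B w1 -> seg z1 z1' w1 -> hcosh b1 z1' <= 2 -> False.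
  move=> hz hz' hb far Bw sw hbb.
  have hw := BD _ Bw.
  have [y [sy|sy] hy] := thin_triangle hb hz hz' sw.
    have := far _ sy _ Bw; lra.
  have Dy : D y by case: sy.
  have h1 := seg_le hb hz' sy.
  have h2 := hcosh_triangle hw Dy hb.
  have := far _ (seg_left _ hb) _ Bw.
  have := hcosh_ge1 hb Dy; have := hcosh_ge1 hw Dy.
  rewrite (hcoshC y) in h2; nra.
move=> hz hz' hb hb' [ebz|far]; move=> [ebz'|far'] Bw sw hbb //.
- by case: (one _ _ _ _ hz' hz hb' far' Bw (segC sw)); rewrite -ebz hcoshC.
- by case: (one _ _ _ _ hz hz' hb far Bw sw); rewrite -ebz'.
exfalso; have hw := BD _ Bw.
have [y [sy|sy] hy] := thin_triangle hb hz hz' sw.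
  have := far _ sy _ Bw; lra.
have Dy : D y by case: sy.
have [u su hu] := thin_triangle hb' hb hz' sy.
have Du : D u by case: su => [[]|[]].
have hwu : hcosh w u <= 27.
  have := hcosh_triangle hw Dy Du.
  have := hcosh_ge1 hw Dy; have := hcosh_ge1 Dy Du; nra.
case: su => su; last by have := far' _ su _ Bw; lra.
have h1 : hcosh u b' <= 2.
  by rewrite hcoshC; apply: le_trans (seg_le hb' hb su) _; rewrite hcoshC.
have h2 := far' _ (seg_left _ hb') _ Bw.
have h3 := hcosh_triangle hw Du hb'.
have h4 := hcosh_ge1 hb' Du; have h5 := hcosh_ge1 hw Du.
have h6 : hcosh w u * hcosh u b' <= 27 * 2.
  by apply: ler_pM => //; apply: ltW; apply: hcosh_gt0.
lra.
Qed.

Section Stop.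
Variables a z : R[i].
Hypotheses (ha : D a) (hz : D z).

(** The point of [a, z] proportional to the vector (1 - t) a + t z, whose norm is n. *)
Definition param (t : R) y := D y /\ exists2 n, 0 < n &
  n ^+ 2 = (1 - t) ^+ 2 + t ^+ 2 + 2 * (1 - t) * t * hcosh a z /\
  forall v, D v -> n * hcosh y v = (1 - t) * hcosh a v + t * hcosh z v.

Lemma param_seg t y : 0 <= t <= 1 -> param t y -> seg a z y.
Proof.
case/andP => t0 t1 [hy [n n0 [_ h]]]; split => //.
exists ((1 - t) / n), (t / n); split.
- by rewrite divr_ge0 ?subr_ge0 // ltW.
- by rewrite divr_ge0 // ltW.
move=> v hv; apply: (mulfI (lt0r_neq0 n0)); rewrite h //.
by field; rewrite gt_eqF.
Qed.

(** Reads off the parameter of a point of [b, z] for b on [a, z]: like b and z, it is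
a combination of a and z. *)
Lemma coef_param (p q : R) y : 0 <= p -> 0 <= q -> D y ->
  (forall v, D v -> hcosh y v = p * hcosh a v + q * hcosh z v) ->
  0 < p + q /\ param (q / (p + q)) y.
Proof.
move=> p0 q0 hy h; have e := seg_norm ha hz hy h.
have pq : 0 < p + q.
  rewrite lt_def addr_ge0 // andbT; apply/eqP => pq.
  have p00 : p = 0 by lra.
  have q00 : q = 0 by lra.
  by move: e; rewrite p00 q00 => /eqP; rewrite expr0n /= !(mulr0, mul0r, addr0) eq_sym oner_eq0.
split => //; split => //; exists (p + q)^-1; rewrite ?invr_gt0 //; split.
  have -> : (p + q)^-1 ^+ 2 = (p ^+ 2 + q ^+ 2 + 2 * p * q * hcosh a z) * (p + q)^-1 ^+ 2.
    by rewrite e mul1r.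
  by field; rewrite gt_eqF.
by move=> v hv; rewrite h //; field; rewrite gt_eqF.
Qed.

Lemma param_exists t : 0 <= t <= 1 -> exists y, param t y.
Proof.
case/andP => t0 t1; have E1 := hcosh_ge1 ha hz.
set m := (1 - t) ^+ 2 + t ^+ 2 + 2 * (1 - t) * t * hcosh a z.
have m1 : 1 <= m.
  have -> : m = 1 + 2 * ((1 - t) * t * (hcosh a z - 1)) by rewrite /m; ring.
  by rewrite lerDl !mulr_ge0 // subr_ge0.
pose n := Num.sqrt m.
have n0 : 0 < n by rewrite sqrtr_gt0 (lt_le_trans _ m1).
have en : n ^+ 2 = m by rewrite sqr_sqrtr // (le_trans _ m1).
have h1 : 0 <= (1 - t) / n by rewrite divr_ge0 ?subr_ge0 // ltW.
have h2 : 0 <= t / n by rewrite divr_ge0 // ltW.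
have [|y hy ey] := seg_exists ha hz h1 h2.
  have -> : ((1 - t) / n) ^+ 2 + (t / n) ^+ 2 + 2 * ((1 - t) / n) * (t / n) * hcosh a z
    = m / n ^+ 2 by rewrite /m; field; rewrite gt_eqF.
  by rewrite en divff // gt_eqF // (lt_le_trans _ m1).
exists y; split => //; exists n => //; split => // v hv.
by rewrite ey //; field; rewrite gt_eqF.
Qed.

Lemma param1 : param 1 z.
Proof.
split => //; exists 1 => //; split; first by ring.
by move=> v _; ring.
Qed.

(** n n' E(y, y') is the product of two vectors (1 - t) a + t z, and it exceeds the
squared norm of either of them by at most |t - t'| (2 + 2 E(a, z)). *)
Lemma param_close t t' y y' : 0 <= t <= 1 -> 0 <= t' <= 1 ->
  `|t - t'| * (2 + 2 * hcosh a z) <= 1 -> param t y -> param t' y' ->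
  hcosh y y' <= 2.
Proof.
have E1 := hcosh_ge1 ha hz; set E := hcosh a z in E1 *.
move=> /andP[t0 t1] /andP[u0 u1] htu [hy [n n0 [en h]]] [hy' [n' n0' [en' h']]].
have e : n * n' * hcosh y y' =
   (1 - t) * (1 - t') + t * t' + ((1 - t) * t' + t * (1 - t')) * E.
  have -> : n * n' * hcosh y y' = n' * (n * hcosh y y') by ring.
  rewrite h // mulrDr !(mulrCA n') (hcoshC a) (hcoshC z) !h' //.
  by rewrite !hcoshxx (hcoshC z a) -/E; ring.
have m1 u : 0 <= u -> u <= 1 -> 1 <= (1 - u) ^+ 2 + u ^+ 2 + 2 * (1 - u) * u * E.
  move=> hu0 hu1.
  have -> : (1 - u) ^+ 2 + u ^+ 2 + 2 * (1 - u) * u * E =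
     1 + 2 * ((1 - u) * u * (E - 1)) by ring.
  by rewrite lerDl !mulr_ge0 // subr_ge0.
have bnd u u' : 0 <= u -> u <= 1 -> 0 <= u' -> u' <= 1 ->
   `|u - u'| * (2 + 2 * E) <= 1 ->
   (1 - u) * (1 - u') + u * u' + ((1 - u) * u' + u * (1 - u')) * E <=
   2 * ((1 - u) ^+ 2 + u ^+ 2 + 2 * (1 - u) * u * E).
  move=> hu0 hu1 hu0' hu1' hd; have := m1 u hu0 hu1.
  suff : (1 - u) * (1 - u') + u * u' + ((1 - u) * u' + u * (1 - u')) * E <=
     (1 - u) ^+ 2 + u ^+ 2 + 2 * (1 - u) * u * E + 1 by lra.
  rewrite -lerBlDl; apply: le_trans hd.
  have -> : (1 - u) * (1 - u') + u * u' + ((1 - u) * u' + u * (1 - u')) * E -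
    ((1 - u) ^+ 2 + u ^+ 2 + 2 * (1 - u) * u * E) =
    (u - u') * ((1 - 2 * u) * (1 - E)) by ring.
  apply: (le_trans (ler_norm _)); rewrite normrM ler_wpM2l // normrM.
  have l1 : `|1 - 2 * u| <= 1 by rewrite ler_norml; apply/andP; split; lra.
  have l2 : `|1 - E| <= 2 + 2 * E by rewrite ler_norml; apply/andP; split; lra.
  by apply: le_trans l2; rewrite ler_piMl.
have b1 := bnd _ _ t0 t1 u0 u1 htu.
have b2 : n * n' * hcosh y y' <= 2 * n' ^+ 2.
  rewrite e en'; have := bnd _ _ u0 u1 t0 t1; rewrite distrC => /(_ htu).
  by apply: le_trans; rewrite le_eqVlt; apply/orP; left; apply/eqP; ring.
rewrite -e -en in b1.
have h1 : n' * hcosh y y' <= 2 * n.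
  by rewrite -(ler_pM2l n0) mulrA (le_trans b1) // expr2; lra.
have h2 : n * hcosh y y' <= 2 * n'.
  by rewrite -(ler_pM2l n0') mulrA (mulrC n') (le_trans b2) // expr2; lra.
rewrite -(ler_pM2l (addr_gt0 n0 n0')); lra.
Qed.

(** The stop b is taken just before the supremum of the parameters at which a bad
point lies within 972 = 3 * 162 * 2. A bad point within 162 of a later point y
would also lie within 972 of the points slightly beyond y, hence beyond that
supremum. *)
Lemma stop_exists (B : set R[i]) : (forall u, B u -> D u) ->
  (exists2 w, B w & seg a z w) ->
  exists b, [/\ seg a z b, exists2 w, B w & hcosh b w <= 972 &
    b = z \/ far_from B b z].
Proof.
move=> BD [w0 Bw0 sw0]; have E1 := hcosh_ge1 ha hz.
pose S : set R := [set t : R | 0 <= t <= 1 /\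
  exists2 y, param t y & exists2 w, B w & hcosh y w <= 972].
have Sne : (exists t, S t).
  case: sw0 => hw0 [p' [q' [p0 q0 h]]].
  have [pq hp] := coef_param p0 q0 hw0 h.
  exists (q' / (p' + q')); split.
    by rewrite divr_ge0 ?(ltW pq) //= ler_pdivrMr // mul1r lerDr.
  by exists w0 => //; exists w0 => //; rewrite hcoshxx; lra.
have hS : has_sup S.
  by split => //; exists 1 => t [/andP[]].
have [S1|nS1] := pselect (S 1).
  exists z; split; [exact: seg_right| |by left].
  case: S1 => _ [y [hy [n n0 [en h]]] [w Bw hw]]; exists w => //.
  have n1 : n = 1.
    have : n ^+ 2 = 1 by rewrite en; ring.
    by move/eqP; rewrite sqrp_eq1 ?ltW // => /eqP.
  have := h w (BD _ Bw); rewrite n1 subrr mul0r add0r !mul1r => <-; lra.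
pose dl := (2 + 2 * hcosh a z)^-1.
have dl0 : 0 < dl by rewrite invr_gt0; lra.
have hdl2 : 0 < dl / 2 by rewrite divr_gt0.
have [t0 [/andP[t00 t01] [b pb [w Bw hbw]]] ht0] := sup_adherent hdl2 hS.
exists b; split; [by apply: (param_seg _ pb); rewrite t00|by exists w|right].
move=> y [hy [s [t [s0 t0' h]]]] w' Bw'; rewrite ltNge; apply/negP => hwy.
have hw' := BD _ Bw'.
have [hb [n n0 [en hn]]] := pb.
pose p : R := s * (1 - t0) / n; pose q : R := s * t0 / n + t.
have p0 : 0 <= p by rewrite divr_ge0 ?mulr_ge0 ?subr_ge0 // ltW.
have q0 : 0 <= q by rewrite addr_ge0 // divr_ge0 ?mulr_ge0 // ltW.
have hpq v : D v -> hcosh y v = p * hcosh a v + q * hcosh z v.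
  move=> hv; rewrite h // /p /q.
  have -> : hcosh b v = ((1 - t0) * hcosh a v + t0 * hcosh z v) / n.
    by rewrite -hn // mulrC mulKf // gt_eqF.
  by ring.
have [pq py] := coef_param p0 q0 hy hpq.
set t1 := q / (p + q) in py.
have t11 : t1 <= 1 by rewrite ler_pdivrMr // mul1r lerDr.
have t10 : 0 <= t1 by rewrite divr_ge0 // ltW.
have t01' : t0 <= t1.
  rewrite ler_pdivlMr // /p /q.
  have -> : t0 * (s * (1 - t0) / n + (s * t0 / n + t)) = s * t0 / n + t0 * t by ring.
  by rewrite lerD2l ler_piMl.
have next t2 y2 : t1 <= t2 -> t2 <= 1 -> t2 - t1 <= dl -> param t2 y2 -> S t2.
  move=> h12 h21 hd py2; have hy2 : D y2 by case: py2.
  split; first by rewrite h21 (le_trans t10).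
  exists y2 => //; exists w' => //.
  have close : hcosh y y2 <= 2.
    apply: (param_close _ _ _ py py2); first by rewrite t10.
      by rewrite h21 (le_trans t10).
    rewrite distrC ger0_norm ?subr_ge0 // -ler_pdivlMr ?mul1r //; lra.
  rewrite hcoshC.
  have := hcosh_triangle hw' hy hy2.
  have := hcosh_ge1 hw' hy; have := hcosh_ge1 hy hy2; nra.
have [hlt|hge] := leP (t1 + dl) 1.
  have t2b : 0 <= t1 + dl <= 1 by rewrite hlt addr_ge0 // ltW.
  have [y2 py2] := param_exists t2b.
  have St2 : S (t1 + dl).
    by apply: (next _ y2) => //; [rewrite lerDl ltW|rewrite addrAC subrr add0r].
  have := sup_upper_bound hS St2; lra.
apply: nS1; apply: (next _ z) => //; [lra|exact: param1].
Qed.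

End Stop.
End Triangles.

(** * Derivatives through slope functions *)

Section EpsilonDelta.
Variable K : numFieldType.

Lemma is_derive_eps (f : K -> K) (x d : K) :
  is_derive (x : K^o) (1 : K^o) (f : K^o -> K^o) d <->
  forall e : K, 0 < e -> exists2 dl : K, 0 < dl & forall y, `|y - x| < dl ->
    `|f y - f x - d * (y - x)| <= e * `|y - x|.
Proof.
split.
  move=> [df fd] e e0.
  have cv : (fun h : K^o => h^-1 *: ((f : K^o -> K^o) (h *: (1 : K^o) + x) - f x)) @ 0^' --> (d : K^o).
    by rewrite -fd; exact: df.
  have /cvgrPdist_le/(_ e e0) := cv.
  rewrite nearE /dnbhs /within /= => /nbhs_ballP [dl /= dl0 hdl].
  exists dl => // y hy; have [->|nyx] := eqVneq y x.
    by rewrite !subrr mulr0 subr0 normr0 mulr0.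
  have hne : y - x != 0 by rewrite subr_eq0.
  have := hdl (y - x); rewrite /ball /= sub0r normrN => /(_ hy hne).
  rewrite /GRing.scale /= mulr1 subrK => h.
  have -> : f y - f x - d * (y - x) = - (d - (y - x)^-1 * (f y - f x)) * (y - x).
    by rewrite mulNr mulrBl mulrAC mulVf // mul1r opprB.
  by rewrite normrM normrN ler_wpM2r.
move=> H.
have cv : (fun h : K^o => h^-1 *: ((f : K^o -> K^o) (h *: (1 : K^o) + x) - f x)) @ 0^' --> (d : K^o).
  apply/cvgrPdist_le => e e0; have [dl dl0 hdl] := H e e0.
  rewrite nearE /dnbhs /within /=; apply/nbhs_ballP; exists dl => // h /=.
  rewrite /ball /= sub0r normrN => hh hne.
  have := hdl (h + x); rewrite addrK => /(_ hh).
  rewrite /GRing.scale /= mulr1 => hb.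
  have -> : d - h^-1 * (f (h + x) - f x) = - (h^-1 * (f (h + x) - f x - d * h)).
    by rewrite [in RHS]mulrBr (mulrCA _ d) mulVf // mulr1 opprB.
  rewrite normrN normrM normfV mulrC ler_pdivrMr ?normr_gt0 //.
split; first by apply/cvg_ex; exists d.
by apply/cvg_lim => //; exact: norm_hausdorff.
Qed.

End EpsilonDelta.

Section Hasd.
Variable R : realType.
Implicit Types (T : Type) (z w : R[i]).

(** Continuity of f at x, where the distance of points of T is read off through i.
For i the identity of R[i] this is continuity on the complex plane, for i the
embedding of R it is continuity of a path, so that one calculus serves both. *)
Definition contat T (i : T -> R[i]) (f : T -> R[i]) x :=
  forall e : R, 0 < e -> exists2 dl, 0 < dl &
    forall y, cmod (i y - i x) < dl -> cmod (f y - f x) < e.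

(** The derivative in the form of Caratheodory: the difference of f is a continuous
slope q times the difference of i. Product and chain rules are then algebraic
identities. It is the complex derivative for i the identity of R[i], and the
velocity of a path for i the embedding of R. *)
Definition hasd T (i : T -> R[i]) (f : T -> R[i]) x d :=
  exists q, [/\ contat i q x, q x = d &
    forall y, f y - f x = q y * (i y - i x)].

Section Rules.
Variables (T : Type) (i : T -> R[i]).
Implicit Types (f g : T -> R[i]) (x : T).

Lemma contat_cst c x : contat i (fun=> c) x.
Proof. by move=> e e0; exists 1 => // y _; rewrite subrr Normc.normc0. Qed.

Lemma contat_id x : contat i i x.
Proof. by move=> e e0; exists e. Qed.

Lemma contatD f g x : contat i f x -> contat i g x ->
  contat i (fun y => f y + g y) x.
Proof.
move=> hf hg e e0; have e2 : 0 < e / 2 by rewrite divr_gt0.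
have [d1 d10 h1] := hf _ e2; have [d2 d20 h2] := hg _ e2.
exists (Num.min d1 d2); rewrite ?lt_min ?d10 // => y; rewrite lt_min => /andP[].
move=> /h1 y1 /h2 y2; rewrite opprD addrACA (le_lt_trans (cmodD _ _)) //; lra.
Qed.

Lemma contatN f x : contat i f x -> contat i (fun y => - f y) x.
Proof.
move=> hf e e0; have [d d0 h] := hf _ e0; exists d => // y /h.
by rewrite -opprD cmodN.
Qed.

Lemma contatB f g x : contat i f x -> contat i g x ->
  contat i (fun y => f y - g y) x.
Proof. by move=> hf hg; apply: contatD => //; exact: contatN. Qed.

Lemma contatM f g x : contat i f x -> contat i g x ->
  contat i (fun y => f y * g y) x.
Proof.
move=> hf hg e e0.
set M := 1 + cmod (f x) + cmod (g x).
have M1 : 1 <= M by rewrite /M -addrA lerDl addr_ge0 ?cmod_ge0.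
have M0 : 0 < M by apply: lt_le_trans M1.
set e' := Num.min 1 (e / (2 * M)).
have e'0 : 0 < e' by rewrite lt_min ltr01 divr_gt0 // mulr_gt0.
have e'1 : e' <= 1 by rewrite ge_min lexx.
have e'2 : e' * (2 * M) <= e.
  by rewrite -ler_pdivlMr ?mulr_gt0 // ge_min lexx orbT.
have [d1 d10 h1] := hf _ e'0; have [d2 d20 h2] := hg _ e'0.
exists (Num.min d1 d2); rewrite ?lt_min ?d10 // => y; rewrite lt_min => /andP[].
move=> /h1 y1 /h2 y2.
have -> : f y * g y - f x * g x =
  (f y - f x) * (g y - g x) + ((f y - f x) * g x + f x * (g y - g x)) by ring.
apply: le_lt_trans (cmodD _ _) _; apply: le_lt_trans (lerD (lexx _) (cmodD _ _)) _.
rewrite !cmodM; move: y1 y2 e'2; rewrite /M.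
have := cmod_ge0 (f y - f x); have := cmod_ge0 (g y - g x).
have := cmod_ge0 (f x); have := cmod_ge0 (g x).
move: (cmod _) => u; move: (cmod _) => v; move: (cmod _) => a; move: (cmod _) => b.
move=> u0 v0 a0 b0 h3 h4 h5.
have k1 : b * a < e' * 1 by apply: ltr_pM => //; lra.
have k2 : b * u <= e' * u by rewrite ler_wpM2r // ltW.
have k3 : v * a <= v * e' by rewrite ler_wpM2l // ltW.
have k4 : 0 <= e' * (u + v) by rewrite mulr_ge0 ?addr_ge0 // ltW.
lra.
Qed.

Lemma contatV f x : f x != 0 -> contat i f x -> contat i (fun y => (f y)^-1) x.
Proof.
move=> fx0 hf e e0.
have m0 : 0 < cmod (f x) by rewrite cmod_gt0.
set m := cmod (f x) in m0.
set e' := Num.min (m / 2) (e * (m * m) / 4).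
have e'0 : 0 < e' by rewrite lt_min divr_gt0 //= divr_gt0 // mulr_gt0 // mulr_gt0.
have e'1 : e' <= m / 2 by rewrite ge_min lexx.
have e'2 : e' <= e * (m * m) / 4 by rewrite ge_min lexx orbT.
have [d d0 h] := hf _ e'0; exists d => // y /h hy.
have my : m / 2 < cmod (f y).
  have : m <= cmod (f y) + cmod (f x - f y).
    have {1}-> : m = cmod (f y + (f x - f y)) by rewrite addrCA subrr addr0.
    exact: cmodD.
  rewrite cmodB; lra.
have fy0 : f y != 0 by rewrite -cmod_gt0; lra.
have -> : (f y)^-1 - (f x)^-1 = (f x - f y) / (f y * f x).
  by field; rewrite fx0.
rewrite cmodM cmodV cmodM cmodB ltr_pdivrMr ?mulr_gt0 ?cmod_gt0 //.
apply: lt_le_trans hy _; apply: le_trans e'2 _; rewrite -/m.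
have : e * (m * (m / 2)) <= e * (m * cmod (f y)).
  by rewrite !ler_wpM2l ?(ltW my) ?(ltW m0) ?(ltW e0).
have : 0 <= e * (m * m) by rewrite !mulr_ge0 ?(ltW m0) ?(ltW e0).
lra.
Qed.

Lemma contat_comp f (h : R[i] -> R[i]) x :
  contat i f x -> contat id h (f x) -> contat i (fun y => h (f y)) x.
Proof.
move=> hf hh e e0; have [d d0 h1] := hh _ e0; have [d' d'0 h2] := hf _ d0.
by exists d' => // y /h2 /h1.
Qed.

Lemma hasd_contat f x d : hasd i f x d -> contat i f x.
Proof.
case=> q [cq _ hq].
have : contat i (fun y => f x + q y * (i y - i x)) x.
  apply: contatD; first exact: contat_cst.
  by apply: contatM => //; apply: contatB; [exact: contat_id|exact: contat_cst].
move=> h e e0; have [dl dl0 hd] := h e e0; exists dl => // y /hd.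
by rewrite -!hq subrr addr0 addrCA subrr addr0.
Qed.

Lemma hasd_cst c x : hasd i (fun=> c) x 0.
Proof.
exists (fun=> 0); split => //; first exact: contat_cst.
by move=> y; rewrite subrr mul0r.
Qed.

Lemma hasd_id x : hasd i i x 1.
Proof.
exists (fun=> 1); split => //; first exact: contat_cst.
by move=> y; rewrite mul1r.
Qed.

Lemma hasdD f g x d d' : hasd i f x d -> hasd i g x d' ->
  hasd i (fun y => f y + g y) x (d + d').
Proof.
move=> [q [cq <- hq]] [q' [cq' <- hq']].
exists (fun y => q y + q' y); split => //; first exact: contatD.
by move=> y; rewrite opprD addrACA hq hq' mulrDl.
Qed.

Lemma hasdM f g x d d' : hasd i f x d -> hasd i g x d' ->
  hasd i (fun y => f y * g y) x (d * g x + f x * d').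
Proof.
move=> hf hg; have cf := hasd_contat hf.
case: hf => [q [cq <- hq]]; case: hg => [q' [cq' <- hq']].
exists (fun y => q y * g x + f y * q' y); split => //.
  apply: contatD; apply: contatM => //; exact: contat_cst.
move=> y; have e1 : f y = f x + q y * (i y - i x) by rewrite -hq addrCA subrr addr0.
have e2 : g y = g x + q' y * (i y - i x) by rewrite -hq' addrCA subrr addr0.
by rewrite e2 !mulrDr mulrDl (mulrC (f y) (g x)) {1}e1; ring.
Qed.

Lemma hasdZ c f x d : hasd i f x d -> hasd i (fun y => c * f y) x (c * d).
Proof.
by move=> hf; have := hasdM (hasd_cst c x) hf; rewrite mul0r add0r.
Qed.

Lemma hasdN f x d : hasd i f x d -> hasd i (fun y => - f y) x (- d).
Proof.
case=> q [cq <- hq]; exists (fun y => - q y); split => //; first exact: contatN.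
by move=> y; rewrite -opprD hq mulNr.
Qed.

Lemma hasdB f g x d d' : hasd i f x d -> hasd i g x d' ->
  hasd i (fun y => f y - g y) x (d - d').
Proof. by move=> hf hg; apply: hasdD => //; exact: hasdN. Qed.

Lemma hasdV f x d : f x != 0 -> hasd i f x d ->
  hasd i (fun y => (f y)^-1) x (- d / f x ^+ 2).
Proof.
move=> fx0 hf; have cf := hasd_contat hf; case: hf => [q [cq <- hq]].
(* Where f y = 0 the slope of the inverse is the exact difference quotient. *)
pose r y := if f y == 0 then - (f x)^-1 / (i y - i x)
            else - q y / (f y * f x).
exists r; split.
- have m0 : 0 < cmod (f x) by rewrite cmod_gt0.
  have ne : exists2 dl, 0 < dl & forall y, cmod (i y - i x) < dl -> f y != 0.
    have [dl dl0 h] := cf _ m0; exists dl => // y /h; apply: contraTneq => ->.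
    by rewrite sub0r cmodN ltxx.
  case: ne => d1 d10 hd1.
  have : contat i (fun y => - q y / (f y * f x)) x.
    apply: contatM; first exact: contatN.
    apply: contatV; first by rewrite mulf_neq0.
    by apply: contatM => //; exact: contat_cst.
  move=> h e e0; have [d2 d20 hd2] := h e e0.
  exists (Num.min d1 d2); rewrite ?lt_min ?d10 // => y; rewrite lt_min => /andP[].
  move=> /hd1 /negbTE fy0 /hd2; by rewrite /r fy0 (negbTE fx0).
- by rewrite /r (negbTE fx0) expr2.
move=> y; rewrite /r; have [fy0|fy0] := eqVneq (f y) 0.
  have hne : i y - i x != 0.
    apply/eqP => h; have := hq y; rewrite h mulr0 fy0 sub0r => /eqP.
    by rewrite oppr_eq0 (negbTE fx0).
  by rewrite fy0 invr0 sub0r divfK.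
have e1 : q y * (i y - i x) = f y - f x by rewrite -hq.
have -> : - q y / (f y * f x) * (i y - i x) =
   - (q y * (i y - i x)) / (f y * f x) by ring.
by rewrite e1; field; rewrite fx0.
Qed.

Lemma hasd_comp f (h : R[i] -> R[i]) x d d' :
  hasd i f x d -> hasd id h (f x) d' ->
  hasd i (fun y => h (f y)) x (d' * d).
Proof.
move=> hf; have cf := hasd_contat hf; case: hf => [q [cq <- hq]].
case=> [q' [cq' <- hq']].
exists (fun y => q' (f y) * q y); split => //.
  apply: contatM => //; exact: contat_comp cf cq'.
by move=> y; rewrite hq' /= hq mulrA.
Qed.

Lemma hasd_ext f g x d : (forall y, f y = g y) -> hasd i f x d -> hasd i g x d.
Proof.
move=> fg [q [cq h hq]]; exists q; split => // y; by rewrite -!fg.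
Qed.

Lemma hasd_eq f x d d' : d = d' -> hasd i f x d -> hasd i f x d'.
Proof. by move=> ->. Qed.

Lemma hasdP f x d : (forall y, i y = i x -> f y = f x) ->
  (forall e : R, 0 < e -> exists2 dl, 0 < dl & forall y, cmod (i y - i x) < dl ->
    cmod (f y - f x - d * (i y - i x)) <= e * cmod (i y - i x)) ->
  hasd i f x d.
Proof.
move=> inj H.
exists (fun y => if i y - i x == 0 then d else (f y - f x) / (i y - i x)); split.
- move=> e e0; have e2 : 0 < e / 2 by rewrite divr_gt0.
  have [dl dl0 hd] := H _ e2; exists dl => // y /hd; rewrite subrr eqxx.
  have [->|hne] := eqVneq (i y - i x) 0; first by rewrite subrr Normc.normc0.
  move=> h; have -> : (f y - f x) / (i y - i x) - d =
     (f y - f x - d * (i y - i x)) / (i y - i x) by field.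
  by rewrite cmodM cmodV ltr_pdivrMr ?cmod_gt0 // (le_lt_trans h) // ltr_pM2r ?cmod_gt0 //; lra.
- by rewrite subrr eqxx.
- move=> y; have [e|hne] := eqVneq (i y - i x) 0; last by rewrite divfK.
  rewrite e mulr0 (inj y) ?subrr //; by apply/eqP; rewrite -subr_eq0 e.
Qed.

Lemma hasd_eps f x d : hasd i f x d ->
  forall e : R, 0 < e -> exists2 dl, 0 < dl & forall y, cmod (i y - i x) < dl ->
    cmod (f y - f x - d * (i y - i x)) <= e * cmod (i y - i x).
Proof.
move=> [q [cq <- hq]] e e0; have [dl dl0 h] := cq e e0; exists dl => // y /h hy.
by rewrite hq -mulrBl cmodM ler_wpM2r ?cmod_ge0 // ltW.
Qed.

End Rules.

End Hasd.

(** * Integrals along paths *)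

Section Paths.
Variable R : realType.
Local Notation ofR := (fun t : R => t%:C).
Local Notation pd := (hasd ofR).
Local Notation cd := (hasd (@id R[i])).
Local Notation pcont phi := (forall x : R, contat ofR phi x).
Implicit Types (phi psi : R -> R[i]) (a b x y t : R).

Lemma ofRB x y : x%:C - y%:C = (x - y)%:C.
Proof. by rewrite rmorphB. Qed.

Lemma pd_derive psi x d : pd psi x d ->
  is_derive (x : R^o) (1 : R^o) ((fun t => Re (psi t)) : R^o -> R^o) (Re d) /\
  is_derive (x : R^o) (1 : R^o) ((fun t => Im (psi t)) : R^o -> R^o) (Im d).
Proof.
move=> hpsi; have H := hasd_eps hpsi; split; apply/is_derive_eps => e /H [dl dl0 h];
  exists dl => // y; rewrite -cmod_real -ofRB => /h; apply: le_trans.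
  have -> : Re (psi y) - Re (psi x) - Re d * (y - x) =
      Re (psi y - psi x - d * (y%:C - x%:C)).
    rewrite ofRB !(cReD, cReN, cReM) /=. rewrite mulr0 subr0 //.
  exact: Re_le_cmod.
have -> : Im (psi y) - Im (psi x) - Im d * (y - x) =
    Im (psi y - psi x - d * (y%:C - x%:C)).
  by rewrite ofRB !(cImD, cImN, cImM) /= mulr0 add0r.
exact: Im_le_cmod.
Qed.

Lemma pd_real (u : R -> R) x d :
  is_derive (x : R^o) (1 : R^o) (u : R^o -> R^o) d ->
  pd (fun t => (u t)%:C) x d%:C.
Proof.
move=> /is_derive_eps H; apply: hasdP => [y /complexI ->//|e /H [dl dl0 h]].
exists dl => // y; rewrite ofRB cmod_real => /h.
by rewrite !ofRB -rmorphM ofRB cmod_real.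
Qed.

Lemma pd_of_derive psi x d :
  is_derive (x : R^o) (1 : R^o) ((fun t => Re (psi t)) : R^o -> R^o) (Re d) ->
  is_derive (x : R^o) (1 : R^o) ((fun t => Im (psi t)) : R^o -> R^o) (Im d) ->
  pd psi x d.
Proof.
move=> /pd_real h1 /pd_real h2.
have := hasdD h1 (hasdZ 'i%C h2); rewrite -complexE.
by apply: hasd_ext => y; rewrite -complexE.
Qed.

Lemma contat_continuous psi : pcont psi ->
  continuous ((fun t => Re (psi t)) : R -> R) /\
  continuous ((fun t => Im (psi t)) : R -> R).
Proof.
move=> H; split => x; apply/cvgrPdist_lt => e e0; have [dl dl0 h] := H x e e0;
  apply/nbhs_ballP; exists dl => // y /=; rewrite /ball /= distrC -cmod_real -ofRB => /h;
  rewrite cmodB; apply: le_lt_trans.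
  by rewrite -cReN -cReD; exact: Re_le_cmod.
by rewrite -cImN -cImD; exact: Im_le_cmod.
Qed.

Lemma real_const (u : R -> R) a b : a <= b ->
  (forall x, a <= x <= b -> is_derive (x : R^o) (1 : R^o) (u : R^o -> R^o) 0) ->
  u b = u a.
Proof.
move=> ab H.
have [x _ /eqP] : exists2 c, c \in `[a, b]%R & u b - u a = (fun=> 0) c * (b - a).
  apply: MVT_segment => //.
    by move=> x; rewrite in_itv /= => /andP[h1 h2]; apply: H; rewrite !ltW.
  apply: derivable_within_continuous => x; rewrite in_itv /= => h.
  by have [] := H x h.
by rewrite mul0r subr_eq0 => /eqP.
Qed.

Lemma real_mvt_le (u du : R -> R) a b M : a <= b ->
  (forall x, a <= x <= b -> is_derive (x : R^o) (1 : R^o) (u : R^o -> R^o) (du x)) ->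
  (forall x, a <= x <= b -> `|du x| <= M) ->
  `|u b - u a| <= M * (b - a).
Proof.
move=> ab H HM.
have [x hx ->] : exists2 c, c \in `[a, b]%R & u b - u a = du c * (b - a).
  apply: MVT_segment => //.
    by move=> x; rewrite in_itv /= => /andP[h1 h2]; apply: H; rewrite !ltW.
  apply: derivable_within_continuous => x; rewrite in_itv /= => h.
  by have [] := H x h.
rewrite normrM (ger0_norm (_ : 0 <= b - a)) ?subr_ge0 // ler_wpM2r ?subr_ge0 //.
by apply: HM; rewrite in_itv in hx.
Qed.

Lemma eq_reim (z w : R[i]) : Re z = Re w -> Im z = Im w -> z = w.
Proof. by case: z => ? ?; case: w => ? ? /= -> ->. Qed.

Lemma pd_const psi a b : a <= b -> (forall x, a <= x <= b -> pd psi x 0) ->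
  psi b = psi a.
Proof.
move=> ab H; apply: eq_reim.
  apply: (real_const (u := fun t => Re (psi t)) ab) => x /H hx.
  by have [h _] := pd_derive hx; exact: h.
apply: (real_const (u := fun t => Im (psi t)) ab) => x /H hx.
by have [_ h] := pd_derive hx; exact: h.
Qed.

(** The mean value theorem is applied to the real and imaginary parts separately,
whence the factor 2. *)
Lemma pd_lip psi dpsi a b M : a <= b ->
  (forall x, a <= x <= b -> pd psi x (dpsi x)) ->
  (forall x, a <= x <= b -> cmod (dpsi x) <= M) ->
  cmod (psi b - psi a) <= 2 * M * (b - a).
Proof.
move=> ab H HM; apply: (le_trans (cmod_le_ReIm _)).
have h1 : `|Re (psi b - psi a)| <= M * (b - a).
  rewrite cReD cReN; apply: (real_mvt_le (u := fun t => Re (psi t))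
    (du := fun t => Re (dpsi t)) ab) => x h.
    by have [h1 _] := pd_derive (H x h); exact: h1.
  exact: le_trans (Re_le_cmod _) (HM _ h).
have h2 : `|Im (psi b - psi a)| <= M * (b - a).
  rewrite cImD cImN; apply: (real_mvt_le (u := fun t => Im (psi t))
    (du := fun t => Im (dpsi t)) ab) => x h.
    by have [_ h2] := pd_derive (H x h); exact: h2.
  exact: le_trans (Im_le_cmod _) (HM _ h).
by rewrite -mulrA mulr_natl mulr2n; exact: lerD.
Qed.

(** The base point is -1 in order that the primitive be differentiable at 0 too. *)
Definition prim (u : R -> R) x : R := \int[lebesgue_measure]_(t in `[(-1)%R, x]) u t.

Lemma prim_derive (u : R -> R) x : continuous u -> -1 < x ->
  is_derive (x : R^o) (1 : R^o) (prim u : R^o -> R^o) (u x).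
Proof.
move=> cu hx.
have [|||dF F'] := @continuous_FTC1_closed R u (-1) x (x + 1) _ _ hx.
- by rewrite ltrDl.
- apply: continuous_compact_integrable; first exact: segment_compact.
  exact: continuous_subspaceT.
- exact: cu.
by rewrite -F' derive1E; apply/derivableP.
Qed.

Definition cprim phi x : R[i] := prim (fun t => Re (phi t)) x +i* prim (fun t => Im (phi t)) x.

Lemma cprim_pd phi x : pcont phi -> -1 < x -> pd (cprim phi) x (phi x).
Proof.
move=> /contat_continuous[c1 c2] hx.
by apply: pd_of_derive; apply: prim_derive.
Qed.

Definition cint phi a b := cprim phi b - cprim phi a.

Lemma cint_FTC phi psi a b : 0 <= a -> a <= b -> pcont phi ->
  (forall x, a <= x <= b -> pd psi x (phi x)) -> cint phi a b = psi b - psi a.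
Proof.
move=> a0 ab cphi H.
have : cprim phi b - psi b = cprim phi a - psi a.
  apply: (pd_const (psi := fun x => cprim phi x - psi x) ab) => x /[dup] hx /H h.
  rewrite -(subrr (phi x)); apply: hasdB h; apply: cprim_pd => //.
  case/andP: hx => hx _; apply: lt_le_trans hx.
  by apply: lt_le_trans a0; rewrite oppr_lt0.
move=> h; rewrite /cint; have -> : cprim phi b = psi b + (cprim phi b - psi b).
  by rewrite addrCA subrr addr0.
by rewrite h; ring.
Qed.

Lemma cintZ c phi a b : 0 <= a -> a <= b -> pcont phi ->
  cint (fun x => c * phi x) a b = c * cint phi a b.
Proof.
move=> a0 ab c1; have gt x : a <= x -> -1 < x.
  by move=> hx; rewrite (lt_le_trans _ (le_trans a0 hx)) // oppr_lt0.
rewrite (@cint_FTC _ (fun x => c * cprim phi x)) //.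
- by rewrite /cint; ring.
- by move=> x; apply: contatM => //; exact: contat_cst.
- by move=> x /andP[hx _]; apply: hasdZ; apply: cprim_pd => //; exact: gt.
Qed.

Lemma cintB phi psi a b : 0 <= a -> a <= b -> pcont phi -> pcont psi ->
  cint (fun x => phi x - psi x) a b = cint phi a b - cint psi a b.
Proof.
move=> a0 ab c1 c2; have gt x : a <= x -> -1 < x.
  by move=> hx; rewrite (lt_le_trans _ (le_trans a0 hx)) // oppr_lt0.
rewrite (@cint_FTC _ (fun x => cprim phi x - cprim psi x)) //.
- by rewrite /cint; ring.
- by move=> x; apply: contatB.
- by move=> x /andP[hx _]; apply: hasdB; apply: cprim_pd => //; exact: gt.
Qed.

Lemma cint_le phi M a b : 0 <= a -> a <= b -> pcont phi ->
  (forall x, a <= x <= b -> cmod (phi x) <= M) ->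
  cmod (cint phi a b) <= 2 * M * (b - a).
Proof.
move=> a0 ab c1 HM; apply: (pd_lip ab _ HM) => x /andP[hx _].
apply: cprim_pd => //.
by rewrite (lt_le_trans _ (le_trans a0 hx)) // oppr_lt0.
Qed.

Lemma cint_ext phi psi a b : (forall x, phi x = psi x) ->
  cint phi a b = cint psi a b.
Proof. by move=> h; congr cint; apply/funext. Qed.

Lemma Re_cint phi a b : Re (cint phi a b) =
  prim (fun t => Re (phi t)) b - prim (fun t => Re (phi t)) a.
Proof. by []. Qed.

End Paths.

(** * Bisection of a square *)

Section Subdivision.
Variable R : realType.
Variable Phi : R -> R -> R -> R[i].
Hypothesis split4 : forall x y l, Phi x y (l + l) =
  Phi x y l + Phi (x + l) y l + Phi x (y + l) l + Phi (x + l) (y + l) l.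
Hypothesis local : forall p q, 0 <= p <= 1 -> 0 <= q <= 1 ->
  forall e : R, 0 < e -> exists2 dl, 0 < dl & forall x y l,
    0 <= x -> x <= p <= x + l -> x + l <= 1 ->
    0 <= y -> y <= q <= y + l -> y + l <= 1 -> 0 < l < dl ->
    cmod (Phi x y l) <= e * l ^+ 2.

(** The bisection of Goursat, for an additive function Phi of squares with lower left
corner (x, y) and side l. If Phi does not vanish on the unit square, one of the
four quarters carries at least a quarter of its size, and so on; the squares
shrink to a point near which Phi is too small for this. *)
Lemma subdivision : Phi 0 0 1 = 0.
Proof.
apply/eqP; rewrite -cmod_eq0; apply/negPn/negP => hne.
have m0 : 0 < cmod (Phi 0 0 1) by rewrite lt_def hne cmod_ge0.
set m := cmod (Phi 0 0 1) in m0 {hne}.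
pose l n : R := 2 ^- n.
have l0 n : 0 < l n by rewrite invr_gt0 exprn_gt0.
have lS n : l n = l n.+1 + l n.+1.
  by rewrite /l exprS invfM; field; rewrite expf_neq0.
pose big n (v : R * R) := m * l n ^+ 2 <= cmod (Phi v.1 v.2 (l n)).
pose corner n (v : R * R) (b : bool * bool) : R * R :=
  (v.1 + b.1%:R * l n.+1, v.2 + b.2%:R * l n.+1).
have step n v : exists b, big n v -> big n.+1 (corner n v b).
  apply: contrapT => /forallNP H.
  have [hb hlt] : big n v /\ forall b, cmod (Phi (corner n v b).1 (corner n v b).2 (l n.+1))
      < m * l n.+1 ^+ 2.
    split; first by apply: contrapT => hb; apply: (H (true, true)).
    by move=> b; rewrite ltNge; apply/negP => hb; apply: (H b).
  move: hb; rewrite /big lS split4.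
  have := hlt (false, false); have := hlt (true, false).
  have := hlt (false, true); have := hlt (true, true).
  rewrite /corner /= !mul0r !mul1r !addr0 => h1 h2 h3 h4.
  have -> : m * (l n.+1 + l n.+1) ^+ 2 = 4 * (m * l n.+1 ^+ 2) by ring.
  move=> h; have := le_trans h (cmodD _ _).
  have := cmodD (Phi v.1 v.2 (l n.+1) + Phi (v.1 + l n.+1) v.2 (l n.+1))
     (Phi v.1 (v.2 + l n.+1) (l n.+1)).
  have := cmodD (Phi v.1 v.2 (l n.+1)) (Phi (v.1 + l n.+1) v.2 (l n.+1)).
  lra.
(* The nested squares, by a choice of quarter at each stage. *)
pose next n v := corner n v (sval (cid (step n v))).
pose s := fix s n := if n is n'.+1 then next n' (s n') else (0, 0).
have sbig n : big n (s n).
  elim: n => [|n IH]; last by rewrite /=; exact: (svalP (cid (step n (s n)))).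
  by rewrite /big /= /l expr0 invr1 expr1n mulr1.
have s1 n : (s n).1 <= (s n.+1).1 /\ (s n.+1).1 + l n.+1 <= (s n).1 + l n.
  rewrite /= /next /corner /=; case: (sval (cid (step n (s n)))) => -[] b /=; rewrite ?mul1r ?mul0r ?addr0;
    have := l0 n.+1; have := lS n; split; lra.
have s2 n : (s n).2 <= (s n.+1).2 /\ (s n.+1).2 + l n.+1 <= (s n).2 + l n.
  rewrite /= /next /corner /=; case: (sval (cid (step n (s n)))) => b -[] /=; rewrite ?mul1r ?mul0r ?addr0;
    have := l0 n.+1; have := lS n; split; lra.
have nested (u : nat -> R) : u 0 = 0 ->
   (forall n, u n <= u n.+1 /\ u n.+1 + l n.+1 <= u n + l n) ->
   exists2 p, 0 <= p <= 1 & forall n, [/\ 0 <= u n, u n <= p <= u n + l n & u n + l n <= 1].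
  move=> u0 H.
  have up n k : u n <= u (n + k)%N.
    elim: k => [|k IH]; first by rewrite addn0.
    by rewrite addnS; have [h _] := H (n + k)%N; exact: le_trans h.
  have dn n k : u (n + k)%N + l (n + k)%N <= u n + l n.
    elim: k => [|k IH]; first by rewrite addn0.
    by rewrite addnS; have [_ h] := H (n + k)%N; exact: le_trans h IH.
  have le_ub n k : u k <= u n + l n.
    apply: le_trans (up k n) _; rewrite addnC.
    apply: le_trans (dn n k); rewrite lerDl; exact: ltW.
  have hs : has_sup (range u).
    by split; [exists (u 0), 0|exists (u 0 + l 0) => _ [k _ <-]].
  have hub n : u n <= sup (range u).
    by apply: sup_upper_bound => //; exists n.
  have hlb n : sup (range u) <= u n + l n.
    by apply: ge_sup; [exists (u 0), 0|move=> _ [k _ <-]].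
  have e0 : u 0 + l 0 = 1 by rewrite u0 add0r /l expr0 invr1.
  exists (sup (range u)).
    by rewrite -{1}u0 hub /= -e0.
  move=> n; split; last by have := dn 0 n; rewrite e0.
    by have := up 0 n; rewrite u0.
  by rewrite hub hlb.
have [p hp Hp] := nested (fun n => (s n).1) erefl s1.
have [q hq Hq] := nested (fun n => (s n).2) erefl s2.
have m2 : 0 < m / 2 by rewrite divr_gt0.
have [dl dl0 hdl] := local hp hq m2.
have [n hn] : exists n, l n < dl.
  have h : 0 <= dl^-1 by rewrite invr_ge0 ltW.
  exists (Num.bound dl^-1); rewrite /l -[ltRHS]invrK ltf_pV2 ?posrE ?exprn_gt0 ?invr_gt0 //.
  apply: lt_le_trans (archi_boundP h) _.
  by rewrite -natrX ler_nat ltnW // ltn_expl.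
have [h1 h2 h3] := Hp n; have [h4 h5 h6] := Hq n.
have := hdl _ _ _ h1 h2 h3 h4 h5 h6; rewrite l0 hn => /(_ isT).
have := sbig n; rewrite /big => h7 h8; have := le_trans h7 h8.
have : 0 < m * l n ^+ 2 by rewrite mulr_gt0 // exprn_gt0.
lra.
Qed.

End Subdivision.

(** * Contracting a circle to a point *)

Section Circle.
Variable R : realType.
Local Notation ofR := (fun t : R => t%:C).
Local Notation pd := (hasd ofR).
Local Notation cd := (hasd (@id R[i])).
Local Notation pcont phi := (forall x : R, contat ofR phi x).

Definition cis (t : R) : R[i] := cos t +i* sin t.

Lemma cmod_cis t : cmod (cis t) = 1.
Proof.
by apply/eqP; rewrite -sqrp_eq1 ?cmod_ge0 // cmod_sqr /= cos2Dsin2.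
Qed.

Lemma cis0 : cis 0 = 1.
Proof. by rewrite /cis cos0 sin0. Qed.

Lemma cis2pi : cis (2 * pi) = 1.
Proof. by rewrite /cis mulr_natl cos2pi sin2pi. Qed.

Lemma cis_pd t : pd cis t ('i%C * cis t).
Proof.
apply: pd_of_derive; rewrite /cis /= ?mul0r ?mul1r ?sub0r ?add0r.
- exact: is_derive_cos.
- exact: is_derive_sin.
Qed.

Variables (c : R[i]) (r : R).

Definition circ t := c + r%:C * cis t.

Lemma circ_pd t : pd circ t ('i%C * (circ t - c)).
Proof.
have := hasdD (hasd_cst ofR c t) (hasdZ r%:C (cis_pd t)).
by apply: hasd_eq; rewrite /circ addrAC subrr !add0r mulrCA.
Qed.

Lemma circ_cont : pcont circ.
Proof. by move=> x; exact: hasd_contat (circ_pd x). Qed.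

Lemma circ0 : circ (2 * pi) = circ 0.
Proof. by rewrite /circ cis0 cis2pi. Qed.

Hypothesis r0 : 0 < r.

Lemma circ_dist t : cmod (circ t - c) = r.
Proof.
by rewrite /circ addrAC subrr add0r cmodM cmod_cis mulr1 cmod_real gtr0_norm.
Qed.

Lemma circ_lip s t : cmod (circ s - circ t) <= 2 * r * `|s - t|.
Proof.
have [st|/ltW st] := leP t s.
  rewrite (ger0_norm (_ : 0 <= s - t)) ?subr_ge0 //.
  apply: (pd_lip (dpsi := fun t => 'i%C * (circ t - c))) => // x _.
    exact: circ_pd.
  by rewrite cmodM circ_dist /= expr0n expr1n /= add0r sqrtr1 mul1r.
rewrite cmodB distrC.
rewrite (ger0_norm (_ : 0 <= t - s)) ?subr_ge0 //.
apply: (pd_lip (dpsi := fun t => 'i%C * (circ t - c))) => // x _.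
  exact: circ_pd.
by rewrite cmodM circ_dist /= expr0n expr1n /= add0r sqrtr1 mul1r.
Qed.

Section Homotopy.
Variables (g : R[i] -> R[i]) (a : R[i]).
Hypothesis hg : forall w, cmod (w - c) <= r -> exists d, cd g w d.
Hypothesis ha : cmod (a - c) < r.

Lemma circ_far t : r - cmod (a - c) <= cmod (circ t - a).
Proof.
have e : circ t - c = (circ t - a) + (a - c) by rewrite addrA subrK.
by rewrite -(circ_dist t) e lerBlDr; exact: cmodD.
Qed.

Lemma circ_near t : cmod (circ t - a) <= 2 * r.
Proof.
have -> : circ t - a = (circ t - c) + (c - a) by rewrite addrA subrK.
apply: le_trans (cmodD _ _) _; rewrite circ_dist (cmodB c a).
have h := ha; lra.
Qed.

Lemma circ_neq t : circ t - a != 0.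
Proof. by rewrite -cmod_gt0; have h := ha; have := circ_far t; lra. Qed.

(** The radial factor of the homotopy, 1 at s = 0 and tending to 0 at infinity. *)
Definition shrink (s : R) : R[i] := (1 + s%:C ^+ 2)^-1.

Lemma shrinkE s : shrink s = ((1 + s ^+ 2)^-1)%:C.
Proof. by rewrite /shrink -rmorphXn -(rmorph1 (real_complex R)) -rmorphD -fmorphV. Qed.

Lemma shrink_den s : 0 < 1 + s ^+ 2 :> R.
Proof. by rewrite ltr_pwDl // sqr_ge0. Qed.

Lemma cmod_shrink s : cmod (shrink s) = (1 + s ^+ 2)^-1.
Proof. by rewrite shrinkE cmod_real gtr0_norm // invr_gt0 shrink_den. Qed.

Lemma shrink_le1 s : cmod (shrink s) <= 1.
Proof.
by rewrite cmod_shrink invf_le1 ?shrink_den // lerDl sqr_ge0.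
Qed.

(** The logarithmic derivative of the radial factor. *)
Definition lam (s : R) : R[i] := - (2 * s%:C) * shrink s.

Lemma shrink_neq s : 1 + s%:C ^+ 2 != 0 :> R[i].
Proof.
rewrite -rmorphXn -(rmorph1 (real_complex R)) -rmorphD fmorph_eq0.
by rewrite gt_eqF // shrink_den.
Qed.

Lemma shrink_pd s : pd shrink s (lam s * shrink s).
Proof.
have h : pd (fun s : R => 1 + s%:C ^+ 2) s (0 + (1 * s%:C + s%:C * 1)).
  apply: hasdD; first exact: hasd_cst.
  have h := hasdM (hasd_id ofR s) (hasd_id ofR s).
  by apply: hasd_ext h => y; rewrite expr2.
have := hasdV (f := fun s : R => 1 + s%:C ^+ 2) (shrink_neq s) h; apply: hasd_eq.
by rewrite /lam /shrink add0r; field; exact: shrink_neq.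
Qed.

Lemma shrink_cont : pcont shrink.
Proof. by move=> x; exact: hasd_contat (shrink_pd x). Qed.

Lemma lam_cont : pcont lam.
Proof.
move=> x; apply: contatM; last exact: shrink_cont.
apply: contatN; apply: contatM; [exact: contat_cst|exact: contat_id].
Qed.

Lemma lam_le s : 0 <= s -> cmod (lam s) <= 2 * s.
Proof.
move=> s0; rewrite cmodM cmodN cmodM cmod_real ger0_norm //.
have -> : cmod (2 : R[i]) = 2.
  by rewrite -(rmorph_nat (real_complex R)) cmod_real normr_nat.
by rewrite ler_piMr ?shrink_le1 // mulr_ge0.
Qed.

Lemma shrink_lip S s t : 0 <= s <= S -> 0 <= t <= S ->
  cmod (shrink s - shrink t) <= 4 * S * `|s - t|.
Proof.
wlog st : s t / t <= s.
  move=> H hs ht; have [/H|/ltW/H] := leP t s; first exact.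
  by rewrite cmodB distrC; apply.
move=> /andP[s0 sS] /andP[t0 tS].
rewrite (ger0_norm (_ : 0 <= s - t)) ?subr_ge0 //.
have -> : 4 * S * (s - t) = 2 * (2 * S) * (s - t) by ring.
apply: (pd_lip (dpsi := fun s => lam s * shrink s)) => // x.
  by move=> _; exact: shrink_pd.
move=> /andP[h1 h2]; rewrite cmodM.
have x0 : 0 <= x by exact: le_trans h1.
apply: le_trans (_ : cmod (lam x) <= _).
  by rewrite ler_piMr ?cmod_ge0 ?shrink_le1.
by apply: le_trans (lam_le x0) _; rewrite ler_pM2l // (le_trans h2).
Qed.

(** Shrinks the circle towards a; its values stay in the closed disc by convexity. *)
Definition homot s t := a + shrink s * (circ t - a).

Lemma hom_in s t : cmod (homot s t - c) <= r.
Proof.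
have -> : homot s t - c = (1 - shrink s) * (a - c) + shrink s * (circ t - c).
  by rewrite /homot; ring.
apply: le_trans (cmodD _ _) _; rewrite !cmodM circ_dist.
have -> : cmod (1 - shrink s) = 1 - cmod (shrink s).
  rewrite cmod_shrink shrinkE -(rmorph1 (real_complex R)) -rmorphB cmod_real ger0_norm //.
  by rewrite subr_ge0 invf_le1 ?shrink_den // lerDl sqr_ge0.
have h := ha; have := shrink_le1 s; have := cmod_ge0 (shrink s); nra.
Qed.

(** The logarithmic derivative of circ - a, and of homot - a in the angular parameter. *)
Definition kap t : R[i] := 'i%C * (circ t - c) / (circ t - a).

Lemma kap_cont : pcont kap.
Proof.
move=> x; apply: contatM.
  apply: contatM; first exact: contat_cst.
  by apply: contatB; [exact: circ_cont|exact: contat_cst].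
apply: contatV; first exact: circ_neq.
by apply: contatB; [exact: circ_cont|exact: contat_cst].
Qed.

Lemma kap_le t : cmod (kap t) <= r / (r - cmod (a - c)).
Proof.
rewrite !cmodM cmodV circ_dist /= expr0n expr1n /= add0r sqrtr1 mul1r.
rewrite ler_pM2l // lef_pV2 ?posrE ?cmod_gt0 ?circ_neq ?subr_gt0 //.
exact: circ_far.
Qed.

Lemma hom_pd1 s t : pd (homot ^~ t) s ((homot s t - a) * lam s).
Proof.
have h := hasdD (hasd_cst ofR a s) (hasdM (shrink_pd s) (hasd_cst ofR (circ t - a) s)).
by apply: hasd_eq h; rewrite /homot; ring.
Qed.

Lemma hom_pd2 s t : pd (homot s) t ((homot s t - a) * kap t).
Proof.
have h := hasdD (hasd_cst ofR a t) (hasdZ (shrink s)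
  (hasdB (circ_pd t) (hasd_cst ofR a t))).
apply: hasd_eq h; rewrite /homot /kap; field; exact: circ_neq.
Qed.

Lemma hom_cont1 t : pcont (homot ^~ t).
Proof. by move=> x; exact: hasd_contat (hom_pd1 x t). Qed.

Lemma hom_cont2 s : pcont (homot s).
Proof. by move=> x; exact: hasd_contat (hom_pd2 s x). Qed.

Lemma g_cont w : cmod (w - c) <= r -> contat id g w.
Proof. by move=> /hg [d h]; exact: hasd_contat h. Qed.

Lemma ghom_cont1 t : pcont (fun s => g (homot s t)).
Proof. by move=> x; apply: contat_comp (hom_cont1 t x) (g_cont (hom_in _ _)). Qed.

Lemma ghom_cont2 s : pcont (fun t => g (homot s t)).
Proof. by move=> x; apply: contat_comp (hom_cont2 s x) (g_cont (hom_in _ _)). Qed.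

Lemma hom_lip S s t s' t' : 0 <= s <= S -> 0 <= s' <= S ->
  cmod (homot s t - homot s' t') <= 8 * S * r * `|s - s'| + 2 * r * `|t - t'|.
Proof.
move=> hs hs'.
have -> : homot s t - homot s' t' = (shrink s - shrink s') * (circ t - a) +
   shrink s' * (circ t - circ t') by rewrite /homot; ring.
apply: le_trans (cmodD _ _) _; rewrite !cmodM; apply: lerD.
  have -> : 8 * S * r * `|s - s'| = (4 * S * `|s - s'|) * (2 * r) by ring.
  by apply: ler_pM; rewrite ?cmod_ge0 // ?shrink_lip // circ_near.
apply: le_trans (circ_lip _ _).
by rewrite ler_piMl ?cmod_ge0 // shrink_le1.
Qed.

(** The form g(w) dw / (w - a) pulled back by the homotopy is
g lam ds + g kap dt; these are primitives of its two components. *)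
Definition form1 t x := cprim (fun s => g (homot s t) * lam s) x.
Definition form2 s y := cprim (fun t => g (homot s t) * kap t) y.

Variable S : R.
Hypothesis S0 : 0 < S.
Let T : R := 2 * pi.
Let T0 : 0 < T. Proof. by rewrite mulr_gt0 // pi_gt0. Qed.

(** The integral of the pulled back form along the boundary of a square, in
coordinates that rescale [0, S] x [0, 2 pi] to the unit square. *)
Definition boundary x y l : R[i] :=
  (form1 (T * y) (S * (x + l)) - form1 (T * y) (S * x)) -
  (form1 (T * (y + l)) (S * (x + l)) - form1 (T * (y + l)) (S * x)) +
  (form2 (S * (x + l)) (T * (y + l)) - form2 (S * (x + l)) (T * y)) -
  (form2 (S * x) (T * (y + l)) - form2 (S * x) (T * y)).

Lemma boundary_split x y l : boundary x y (l + l) =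
  boundary x y l + boundary (x + l) y l + boundary x (y + l) l +
  boundary (x + l) (y + l) l.
Proof.
rewrite /boundary (addrA x) (addrA y); move: form1 form2 => f1 f2.
by ring.
Qed.

(** The forms C dw / (w - a) and d dw have primitives, so they do not contribute to
an integral along the boundary of a square. Hence g may be replaced by the
remainder of its first order expansion. *)
Lemma boundary_remainder (C d : R[i]) x y l : 0 <= x -> 0 <= y -> 0 <= l ->
  let rho s t := g (homot s t) - (C + d * (homot s t - a)) in
  boundary x y l =
    cint (fun s => rho s (T * y) * lam s) (S * x) (S * (x + l)) -
    cint (fun s => rho s (T * (y + l)) * lam s) (S * x) (S * (x + l)) +
    cint (fun t => rho (S * (x + l)) t * kap t) (T * y) (T * (y + l)) -
    cint (fun t => rho (S * x) t * kap t) (T * y) (T * (y + l)).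
Proof.
move=> x0 y0 l0 rho.
have gtN z : 0 <= z -> -1 < z :> R by move=> ?; rewrite (lt_le_trans _ (_ : 0 <= z)) // oppr_lt0.
have c1 t : pcont (fun s => rho s t * lam s).
  move=> u; apply: contatM; last exact: lam_cont.
  apply: contatB; first exact: ghom_cont1.
  apply: contatD; first exact: contat_cst.
  apply: contatM; first exact: contat_cst.
  by apply: contatB; [exact: hom_cont1|exact: contat_cst].
have c2 s : pcont (fun t => rho s t * kap t).
  move=> u; apply: contatM; last exact: kap_cont.
  apply: contatB; first exact: ghom_cont2.
  apply: contatD; first exact: contat_cst.
  apply: contatM; first exact: contat_cst.
  by apply: contatB; [exact: hom_cont2|exact: contat_cst].
have xl : S * x <= S * (x + l) by rewrite ler_pM2l // lerDl.
have yl : T * y <= T * (y + l) by rewrite ler_pM2l // lerDl.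
have Sx : 0 <= S * x by rewrite mulr_ge0 // ltW.
have Ty : 0 <= T * y by rewrite mulr_ge0 // ltW.
have F1 t : form1 t (S * (x + l)) - form1 t (S * x) =
    cint (fun s => rho s t * lam s) (S * x) (S * (x + l)) +
    C * (cprim lam (S * (x + l)) - cprim lam (S * x)) +
    d * (homot (S * (x + l)) t - homot (S * x) t).
  rewrite -[LHS]/(cint (fun s => g (homot s t) * lam s) (S * x) (S * (x + l))).
  rewrite (@cint_FTC _ (fun s => g (homot s t) * lam s) (fun s => cprim (fun s => rho s t * lam s) s + C * cprim lam s
     + d * homot s t)) //.
  - by rewrite /cint; ring.
  - by move=> u; apply: contatM; [exact: ghom_cont1|exact: lam_cont].
  move=> u /andP[hu _]; have u0 := gtN _ (le_trans Sx hu).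
  have h := hasdD (hasdD (cprim_pd (c1 t) u0) (hasdZ C (cprim_pd lam_cont u0)))
    (hasdZ d (hom_pd1 u t)).
  apply: hasd_eq h; rewrite /rho /=.
  by move: (homot _ _) (lam _) (g _) => h1 h2 h3; ring.
have F2 s : form2 s (T * (y + l)) - form2 s (T * y) =
    cint (fun t => rho s t * kap t) (T * y) (T * (y + l)) +
    C * (cprim kap (T * (y + l)) - cprim kap (T * y)) +
    d * (homot s (T * (y + l)) - homot s (T * y)).
  rewrite -[LHS]/(cint (fun t => g (homot s t) * kap t) (T * y) (T * (y + l))).
  rewrite (@cint_FTC _ (fun t => g (homot s t) * kap t) (fun t => cprim (fun t => rho s t * kap t) t + C * cprim kap t
     + d * homot s t)) //.
  - by rewrite /cint; ring.
  - by move=> u; apply: contatM; [exact: ghom_cont2|exact: kap_cont].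
  move=> u /andP[hu _]; have u0 := gtN _ (le_trans Ty hu).
  have h := hasdD (hasdD (cprim_pd (c2 s) u0) (hasdZ C (cprim_pd kap_cont u0)))
    (hasdZ d (hom_pd2 s u)).
  apply: hasd_eq h; rewrite /rho /=.
  by move: (homot _ _) (kap _) (g _) => h1 h2 h3; ring.
have alg (A1 A2 B1 B2 L K h11 h12 h21 h22 : R[i]) :
    (A1 + C * L + d * (h21 - h11)) - (A2 + C * L + d * (h22 - h12)) +
    (B1 + C * K + d * (h22 - h21)) - (B2 + C * K + d * (h12 - h11)) =
    A1 - A2 + B1 - B2 by ring.
rewrite /boundary (F1 (T * y)) (F1 (T * (y + l))) (F2 (S * (x + l))) (F2 (S * x)).
exact: alg.
Qed.

(** By differentiability the remainder of [boundary_remainder] is o(l) on a square of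
side l, and the four sides have length O(l). *)
Lemma boundary_local p q : 0 <= p <= 1 -> 0 <= q <= 1 ->
  forall e : R, 0 < e -> exists2 dl, 0 < dl & forall x y l,
    0 <= x -> x <= p <= x + l -> x + l <= 1 ->
    0 <= y -> y <= q <= y + l -> y + l <= 1 -> 0 < l < dl ->
    cmod (boundary x y l) <= e * l ^+ 2.
Proof.
move=> hp hq e e0.
have hr := r0; have hS := S0; have hT := T0; have hha := ha.
have [d cdd] := hg (hom_in (S * p) (T * q)).
set w0 := homot (S * p) (T * q) in cdd.
set m := r - cmod (a - c).
have m0 : 0 < m by rewrite /m; lra.
set L := 8 * S * r * S + 2 * r * T.
have L0 : 0 < L.
  by apply: addr_gt0; [rewrite !mulr_gt0|apply: mulr_gt0 => //; rewrite mulr_gt0].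
(* The sum of the four side bounds, divided by e' l^2. *)
set Kc := 2 * (2 * (L * (2 * S)) * S) + 2 * (2 * (L * (r / m)) * T).
have rm0 : 0 < r / m by rewrite divr_gt0.
have K0 : 0 < Kc.
  apply: addr_gt0; first by rewrite !mulr_gt0.
  by apply: mulr_gt0 => //; apply: mulr_gt0 => //; rewrite mulr_gt0 // mulr_gt0.
set e' := e / Kc; have e'0 : 0 < e' by rewrite divr_gt0.
have [dl dl0 hdl] := hasd_eps cdd e'0.
exists (dl / L); first by rewrite divr_gt0.
move=> x y l x0 /andP[hp1 hp2] x1 y0 /andP[hq1 hq2] y1 /andP[l0 ldl].
have Ll : L * l < dl by rewrite mulrC -ltr_pdivlMr.
have rect s t : S * x <= s <= S * (x + l) -> T * y <= t <= T * (y + l) ->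
    cmod (g (homot s t) - (g w0 - d * (w0 - a) + d * (homot s t - a))) <= e' * (L * l).
  move=> /andP[hs1 hs2] /andP[ht1 ht2].
  have -> : g (homot s t) - (g w0 - d * (w0 - a) + d * (homot s t - a)) =
     g (homot s t) - g w0 - d * (homot s t - w0).
    by ring.
  have hd : cmod (homot s t - w0) <= L * l.
    apply: le_trans (hom_lip (S := S) _ _ _ _) _.
    - rewrite (le_trans _ hs1) /=; last by rewrite mulr_ge0 // ltW.
      by apply: le_trans hs2 _; rewrite ler_piMr // ltW.
    - by case/andP: hp => h1 h2; rewrite mulr_ge0 ?(ltW hS) //= ler_piMr // ltW.
    have b1 : `|s - S * p| <= S * l.
      have : S * x <= S * p by rewrite ler_pM2l.
      have : S * p <= S * (x + l) by rewrite ler_pM2l.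
      rewrite ler_norml => ? ?; apply/andP; split; lra.
    have b2 : `|t - T * q| <= T * l.
      have : T * y <= T * q by rewrite ler_pM2l.
      have : T * q <= T * (y + l) by rewrite ler_pM2l.
      rewrite ler_norml => ? ?; apply/andP; split; lra.
    have -> : L * l = 8 * S * r * (S * l) + 2 * r * (T * l) by rewrite /L; ring.
    by apply: lerD; apply: ler_wpM2l => //; rewrite ?mulr_ge0 // ltW.
  apply: le_trans (hdl _ (le_lt_trans hd Ll)) _.
  by rewrite ler_wpM2l // ltW.
have eL0 : 0 <= e' * (L * l).
  by apply: ltW; apply: mulr_gt0 => //; apply: mulr_gt0.
have xl : S * x <= S * (x + l) by rewrite ler_pM2l // lerDl ltW.
have yl : T * y <= T * (y + l) by rewrite ler_pM2l // lerDl ltW.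
have Sx : 0 <= S * x by rewrite mulr_ge0 // ltW.
have Ty : 0 <= T * y by rewrite mulr_ge0 // ltW.
rewrite (boundary_remainder (g w0 - d * (w0 - a)) d) ?(ltW l0) //.
set rho := fun s t => g (homot s t) - (g w0 - d * (w0 - a) + d * (homot s t - a)).
have c1 t : pcont (fun s => rho s t * lam s).
  move=> u; apply: contatM; last exact: lam_cont.
  apply: contatB; first exact: ghom_cont1.
  apply: contatD; first exact: contat_cst.
  apply: contatM; first exact: contat_cst.
  by apply: contatB; [exact: hom_cont1|exact: contat_cst].
have c2 s : pcont (fun t => rho s t * kap t).
  move=> u; apply: contatM; last exact: kap_cont.
  apply: contatB; first exact: ghom_cont2.
  apply: contatD; first exact: contat_cst.
  apply: contatM; first exact: contat_cst.
  by apply: contatB; [exact: hom_cont2|exact: contat_cst].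
have I1 t : T * y <= t <= T * (y + l) ->
    cmod (cint (fun s => rho s t * lam s) (S * x) (S * (x + l))) <=
    2 * (e' * (L * l) * (2 * S)) * (S * l).
  move=> ht; have -> : S * l = S * (x + l) - S * x by ring.
  apply: cint_le => // s hs; rewrite cmodM; apply: ler_pM; rewrite ?cmod_ge0 //.
    exact: rect.
  case/andP: hs => h1 h2; apply: le_trans (lam_le (le_trans Sx h1)) _.
  by rewrite ler_pM2l // (le_trans h2) // ler_piMr // ltW.
have I2 s : S * x <= s <= S * (x + l) ->
    cmod (cint (fun t => rho s t * kap t) (T * y) (T * (y + l))) <=
    2 * (e' * (L * l) * (r / m)) * (T * l).
  move=> hs; have -> : T * l = T * (y + l) - T * y by ring.
  apply: cint_le => // t ht; rewrite cmodM; apply: ler_pM; rewrite ?cmod_ge0 //.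
    exact: rect.
  exact: kap_le.
have J1 := I1 (T * y); have J2 := I1 (T * (y + l)).
have J3 := I2 (S * (x + l)); have J4 := I2 (S * x).
rewrite !lexx yl in J1 J2; rewrite !lexx xl in J3 J4.
move: {J1}(J1 isT) {J2}(J2 isT) {J3}(J3 isT) {J4}(J4 isT).
have tri (u1 u2 u3 u4 : R[i]) :
    cmod (u1 - u2 + u3 - u4) <= cmod u1 + cmod u2 + cmod u3 + cmod u4.
  apply: le_trans (cmodD _ _) _; rewrite cmodN lerD2r.
  apply: le_trans (cmodD _ _) _; rewrite lerD2r.
  by apply: le_trans (cmodD _ _) _; rewrite cmodN.
move=> J1 J2 J3 J4; apply: le_trans (tri _ _ _ _) _.
have -> : e * l ^+ 2 = 2 * (e' * (L * l) * (2 * S)) * (S * l) +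
   2 * (e' * (L * l) * (2 * S)) * (S * l) + 2 * (e' * (L * l) * (r / m)) * (T * l)
   + 2 * (e' * (L * l) * (r / m)) * (T * l).
  have -> : e = e' * Kc by rewrite /e' divfK // gt_eqF.
  by rewrite /Kc; move: (r / m) => k; ring.
exact: lerD (lerD (lerD J1 J2) J3) J4.
Qed.

(** The two sides t = 0 and t = 2 pi of the rectangle have the same image, so they
cancel and the integrals along the outer and the contracted circle agree. *)
Lemma form2_shrink : form2 S T - form2 S 0 = form2 0 T - form2 0 0.
Proof.
have := subdivision boundary_split boundary_local.
rewrite /boundary !(mulr0, add0r, mulr1).
have -> : form1 T = form1 0.
  apply/funext => x; congr (cprim _ x); apply/funext => s.
  by rewrite /homot /T circ0.
by rewrite subrr add0r => /eqP; rewrite subr_eq0 => /eqP.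
Qed.

End Homotopy.
End Circle.

(** * The Cauchy formula *)

Section Bridge.
Variable R : realType.
Local Notation cd := (hasd (@id R[i])).

Lemma norm_cmod (z : R[i]) : `|z| = (cmod z)%:C.
Proof. by []. Qed.

Lemma cd_is_derive (f : R[i] -> R[i]) z d : cd f z d <->
  is_derive (z : R[i]^o) (1 : R[i]^o) (f : R[i]^o -> R[i]^o) d.
Proof.
split=> [h|/is_derive_eps H].
  apply/is_derive_eps => e e0.
  have eR : e = (Re e)%:C.
    by move: e0; rewrite ltcE => /andP[/eqP h0 _]; apply: eq_reim; rewrite //= h0.
  have e0' : 0 < Re e by move: e0; rewrite ltcE => /andP[_].
  have [dl dl0 hd] := hasd_eps h e0'; exists dl%:C; first by rewrite ltcR.
  by move=> y; rewrite !norm_cmod ltcR eR -rmorphM lecR => /hd.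
apply: hasdP => [y -> //|e e0].
have e0' : (0 : R[i]) < e%:C by rewrite ltcR.
have [dl dl0 hd] := H _ e0'.
have eR : dl = (Re dl)%:C.
  by move: dl0; rewrite ltcE => /andP[/eqP h0 _]; apply: eq_reim; rewrite //= h0.
exists (Re dl); first by move: dl0; rewrite ltcE => /andP[_].
by move=> y hy; have := hd y; rewrite !norm_cmod eR ltcR -rmorphM lecR => /(_ hy).
Qed.

Lemma cd_derivable (f : R[i] -> R[i]) z d : cd f z d ->
  derivable (f : R[i]^o -> R[i]^o) z 1 /\ derive1 (f : R[i]^o -> R[i]^o) z = d.
Proof.
move=> /cd_is_derive [h1 h2]; split; [exact: h1|rewrite derive1E; exact: h2].
Qed.

Lemma derivable_cd (f : R[i] -> R[i]) z :
  derivable (f : R[i]^o -> R[i]^o) z 1 -> cd f z (derive1 (f : R[i]^o -> R[i]^o) z).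
Proof. move=> h; apply/cd_is_derive; rewrite derive1E; exact: (derivableP h). Qed.

Lemma cd_near (f g : R[i] -> R[i]) z d (e : R) : 0 < e ->
  (forall w, cmod (w - z) < e -> f w = g w) -> cd f z d -> cd g z d.
Proof.
move=> e0 fg h; apply: hasdP => [y ->//|e1 e10].
have [dl dl0 hd] := hasd_eps h e10.
exists (Num.min dl e); first by rewrite lt_min dl0.
move=> y; rewrite lt_min => /andP[/hd h1 h2].
by rewrite -!fg // subrr Normc.normc0.
Qed.

End Bridge.

Section Cauchy.
Variable R : realType.
Local Notation ofR := (fun t : R => t%:C).
Local Notation pd := (hasd ofR).
Local Notation cd := (hasd (@id R[i])).
Local Notation pcont phi := (forall x : R, contat ofR phi x).
Local Notation T := (2 * pi : R).

Lemma T_gt0 : 0 < T. Proof. by rewrite mulr_gt0 // pi_gt0. Qed.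

Lemma pcont_bounded (phi : R -> R[i]) (a b : R) : a <= b -> pcont phi ->
  exists2 M : R, 0 < M & forall x, a <= x <= b -> cmod (phi x) <= M.
Proof.
move=> ab /contat_continuous[c1 c2].
have bnd (u : R -> R) : continuous u -> exists M : R, forall x, a <= x <= b -> `|u x| <= M.
  move=> cu; have [|c hc H] := @EVT_max R (fun x => `|u x|) a b ab.
    apply: continuous_subspaceT => x.
    by apply: continuous_comp; [exact: cu|exact: norm_continuous].
  by exists `|u c| => x hx; apply: H; rewrite in_itv.
have [M1 h1] := bnd _ c1; have [M2 h2] := bnd _ c2.
exists (`|M1| + `|M2| + 1); first by rewrite ltr_pwDr // addr_ge0.
move=> x hx; apply: le_trans (cmod_le_ReIm _) _.
have := h1 x hx; have := h2 x hx; have := ler_norm M1; have := ler_norm M2; lra.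
Qed.

Section Kernels.
Variables (c : R[i]) (r : R).
Hypothesis r0 : 0 < r.
Local Notation zeta := (circ c r).
Variable psi : R -> R[i].
Hypothesis cpsi : pcont psi.

Definition cauchy n a : R[i] := cint (fun t => psi t / (zeta t - a) ^+ n) 0 T.

Lemma kernel_cont a n : cmod (a - c) < r -> pcont (fun t => psi t / (zeta t - a) ^+ n).
Proof.
move=> ha x; apply: contatM => //.
apply: contatV; first by rewrite expf_neq0 // circ_neq.
elim: n => [|n IH].
  by under [X in contat _ X]eq_fun do rewrite expr0; exact: contat_cst.
have -> : (fun t => (zeta t - a) ^+ n.+1) = (fun t => (zeta t - a) * (zeta t - a) ^+ n).
  by apply/funext => t; rewrite exprS.
apply: contatM IH.
by apply: contatB; [exact: circ_cont|exact: contat_cst].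
Qed.

(** Differentiation under the integral sign: it suffices to write the second order
remainder as an integral of size O(|b - a|^2). *)
Lemma cauchy_near a (P : R[i] -> R -> R[i]) (d F : R[i] -> R[i]) (C : R) :
  cmod (a - c) < r -> 0 <= C ->
  (forall b, cmod (b - a) < (r - cmod (a - c)) / 2 ->
     pcont (P b) /\ F b - F a - d a * (b - a) = cint (P b) 0 T /\
     forall t, 0 <= t <= T -> cmod (P b t) <= C * cmod (b - a) ^+ 2) ->
  cd F a (d a).
Proof.
move=> ha C0 H; apply: hasdP => [y ->//|e e0].
set m := r - cmod (a - c); have m0 : 0 < m by rewrite subr_gt0.
set K := 2 * C * T + 1.
have K0 : 0 < K.
  by rewrite ltr_wpDl // mulr_ge0 ?(ltW T_gt0) // mulr_ge0.
exists (Num.min (m / 2) (e / K)).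
  by rewrite lt_min !divr_gt0.
move=> b; rewrite lt_min => /andP[/H [h1 [-> h2]] h3].
apply: le_trans (cint_le _ _ h1 h2) _ => //; first exact: ltW T_gt0.
rewrite subr0.
have -> : 2 * (C * cmod (b - a) ^+ 2) * T = (2 * C * T) * cmod (b - a) * cmod (b - a) by ring.
rewrite ler_wpM2r ?cmod_ge0 //.
move: h3; rewrite ltr_pdivlMr // => /ltW; rewrite mulrC; apply: le_trans.
by rewrite ler_wpM2r ?cmod_ge0 // /K lerDl.
Qed.

Lemma kernel_bounds a b t : cmod (a - c) < r ->
  cmod (b - a) < (r - cmod (a - c)) / 2 ->
  let m := r - cmod (a - c) in
  [/\ cmod (b - c) < r, cmod (zeta t - a)^-1 <= 2 / m,
      cmod (zeta t - b)^-1 <= 2 / m &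
      (zeta t - b)^-1 - (zeta t - a)^-1 = (b - a) * ((zeta t - a)^-1 * (zeta t - b)^-1)].
Proof.
move=> ha hb m.
have m0 : 0 < m by rewrite subr_gt0.
have hbc : cmod (b - c) < r.
  have -> : b - c = (b - a) + (a - c) by rewrite addrA subrK.
  by apply: le_lt_trans (cmodD _ _) _; move: hb m0; rewrite /m; lra.
have h1 : m / 2 <= cmod (zeta t - a).
  by have := circ_far c r0 a t; rewrite -/m; move: m0; lra.
have h2 : m / 2 <= cmod (zeta t - b).
  have := circ_far c r0 a t; rewrite -/m.
  have -> : zeta t - a = (zeta t - b) + (b - a) by rewrite addrA subrK.
  move=> h; have := le_trans h (cmodD _ _); move: hb; rewrite -/m; lra.
have m20 : 0 < m / 2 by rewrite divr_gt0.
split => //.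
- by rewrite cmodV -[leRHS]invrK lef_pV2 ?posrE ?invf_div // (lt_le_trans m20).
- by rewrite cmodV -[leRHS]invrK lef_pV2 ?posrE ?invf_div // (lt_le_trans m20).
have := circ_neq r0 ha t; have := circ_neq r0 hbc t => n1 n2; field.
by rewrite n1 n2.
Qed.

Lemma cauchy1_deriv a : cmod (a - c) < r -> cd (cauchy 1) a (cauchy 2 a).
Proof.
move=> ha; have [M M0 hM] := pcont_bounded (ltW T_gt0) cpsi.
set m := r - cmod (a - c); have m0 : 0 < m by rewrite subr_gt0.
pose k a' t := (zeta t - a')^-1.
apply: (cauchy_near (P := fun b t => (b - a) ^+ 2 * (psi t * (k a t ^+ 2 * k b t)))
  (C := M * (2 / m) ^+ 3) ha).
  by rewrite mulr_ge0 ?(ltW M0) // exprn_ge0 // divr_ge0 // ltW.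
move=> b hb; have hbc : cmod (b - c) < r by case: (kernel_bounds 0 ha hb).
have ck a' : cmod (a' - c) < r -> pcont (k a').
  move=> ha' x; apply: contatV; first exact: circ_neq.
  by apply: contatB; [exact: circ_cont|exact: contat_cst].
split; [|split].
- move=> x; apply: contatM; first exact: contat_cst.
  apply: contatM => //; apply: contatM; last exact: ck.
  by apply: contatM; exact: ck.
- rewrite /cauchy -cintB ?(ltW T_gt0) //; try exact: kernel_cont.
  rewrite [_ * (b - a)]mulrC -cintZ ?(ltW T_gt0) //; last exact: kernel_cont.
  rewrite -cintB ?(ltW T_gt0) //; first last.
  + by move=> x; apply: contatM; [exact: contat_cst|exact: kernel_cont].
  + by move=> x; apply: contatB; exact: kernel_cont.
  apply: cint_ext => t; have [_ _ _ e] := kernel_bounds t ha hb.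
  rewrite !expr1 -exprVn -!/(k _ t); rewrite -!/(k _ t) in e.
  have -> : psi t * k b t - psi t * k a t - (b - a) * (psi t * k a t ^+ 2) =
    psi t * ((k b t - k a t) - (b - a) * k a t ^+ 2) by ring.
  rewrite e.
  have -> : psi t * ((b - a) * (k a t * k b t) - (b - a) * k a t ^+ 2) =
    psi t * ((b - a) * k a t * (k b t - k a t)) by ring.
  by rewrite e; ring.
move=> t ht; have [_ h1 h2 _] := kernel_bounds t ha hb.
rewrite !(cmodX, cmodM) mulrC; apply: ler_wpM2r; first by rewrite exprn_ge0 ?cmod_ge0.
apply: ler_pM; rewrite ?cmod_ge0 ?hM //; first by rewrite mulr_ge0 ?exprn_ge0 ?cmod_ge0.
rewrite [_ ^+ 3]exprSr; apply: ler_pM; rewrite ?exprn_ge0 ?cmod_ge0 //.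
by apply: lerXn2r; rewrite ?nnegrE ?cmod_ge0 // divr_ge0 // ltW.
Qed.

Lemma cauchy2_deriv a : cmod (a - c) < r -> cd (cauchy 2) a (2 * cauchy 3 a).
Proof.
move=> ha; have [M M0 hM] := pcont_bounded (ltW T_gt0) cpsi.
set m := r - cmod (a - c); have m0 : 0 < m by rewrite subr_gt0.
pose k a' t := (zeta t - a')^-1.
apply: (cauchy_near (d := fun a => 2 * cauchy 3 a)
  (P := fun b t => (b - a) ^+ 2 * (psi t * (k a t ^+ 2 * k b t * (k a t + k a t + k b t))))
  (C := M * ((2 / m) ^+ 3 * (3 * (2 / m)))) ha).
  have h : 0 <= 2 / m by rewrite divr_ge0 // ltW.
  by rewrite mulr_ge0 ?(ltW M0) // mulr_ge0 ?exprn_ge0 // mulr_ge0.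
move=> b hb; have hbc : cmod (b - c) < r by case: (kernel_bounds 0 ha hb).
have ck a' : cmod (a' - c) < r -> pcont (k a').
  move=> ha' x; apply: contatV; first exact: circ_neq.
  by apply: contatB; [exact: circ_cont|exact: contat_cst].
split; [|split].
- move=> x; apply: contatM; first exact: contat_cst.
  apply: contatM => //; apply: contatM.
    by apply: contatM; [apply: contatM; exact: ck|exact: ck].
  by apply: contatD; [apply: contatD; exact: ck|exact: ck].
- rewrite /cauchy -cintB ?(ltW T_gt0) //; try exact: kernel_cont.
  rewrite [_ * (b - a)]mulrC mulrA -cintZ ?(ltW T_gt0) //; last exact: kernel_cont.
  rewrite -cintB ?(ltW T_gt0) //; first last.
  + by move=> x; apply: contatM; [exact: contat_cst|exact: kernel_cont].
  + by move=> x; apply: contatB; exact: kernel_cont.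
  apply: cint_ext => t; have [_ _ _ e] := kernel_bounds t ha hb.
  rewrite -!exprVn -!/(k _ t); rewrite -!/(k _ t) in e.
  have -> : psi t * k b t ^+ 2 - psi t * k a t ^+ 2 - (b - a) * 2 * (psi t * k a t ^+ 3) =
    psi t * ((k b t - k a t) * (k b t + k a t) - 2 * (b - a) * k a t ^+ 3) by ring.
  rewrite e.
  have -> : psi t * ((b - a) * (k a t * k b t) * (k b t + k a t) - 2 * (b - a) * k a t ^+ 3) =
    psi t * ((b - a) * k a t * ((k b t - k a t) * (k a t + k a t + k b t))) by ring.
  by rewrite e; ring.
move=> t ht; have [_ h1 h2 _] := kernel_bounds t ha hb.
rewrite !(cmodX, cmodM) mulrC; apply: ler_wpM2r; first by rewrite exprn_ge0 ?cmod_ge0.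
have c0 := cmod_ge0.
apply: ler_pM; rewrite ?c0 ?hM //; first by rewrite !mulr_ge0 ?exprn_ge0 ?c0.
apply: ler_pM; rewrite ?c0 //; first by rewrite !mulr_ge0 ?exprn_ge0 ?c0.
  rewrite [_ ^+ 3]exprSr; apply: ler_pM; rewrite ?exprn_ge0 ?c0 //.
  by apply: lerXn2r; rewrite ?nnegrE ?c0 // divr_ge0 // ltW.
apply: le_trans (cmodD _ _) _; have := cmodD (k a t) (k a t).
move: h1 h2; rewrite -!/(k _ t); lra.
Qed.

End Kernels.

Section Formula.
Variables (c : R[i]) (r : R).
Hypothesis r0 : 0 < r.
Local Notation zeta := (circ c r).

(** At the centre the integrand is constant. The derivative in a is the integral of
the derivative of -1 / (zeta - a) along a closed curve, hence zero, and the value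
is the same along the segment from the centre to a. *)
Lemma winding_number a : cmod (a - c) < r ->
  cauchy c r (fun t => 'i%C * (zeta t - c)) 1 a = 'i%C * T%:C.
Proof.
move=> ha; set psi := fun t => _.
have cpsi : pcont psi.
  move=> x; apply: contatM; first exact: contat_cst.
  by apply: contatB; [exact: circ_cont|exact: contat_cst].
have z2 b : cmod (b - c) < r -> cauchy c r psi 2 b = 0.
  move=> hb; rewrite /cauchy (@cint_FTC _ _ (fun t => - (zeta t - b)^-1)) ?(ltW T_gt0) //.
  - by rewrite circ0 subrr.
  - exact: kernel_cont.
  move=> t _.
  have h := hasdN (hasdV (f := fun y => zeta y - b) (circ_neq r0 hb t) (hasdB (circ_pd c r t) (hasd_cst ofR b t))).
  by apply: hasd_eq h; rewrite subr0 mulNr opprK.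
pose path t : R[i] := c + t%:C * (a - c).
have inp t : 0 <= t <= 1 -> cmod (path t - c) < r.
  move=> /andP[t0 t1]; rewrite /path addrAC subrr add0r cmodM cmod_real ger0_norm //.
  by apply: le_lt_trans ha; rewrite ler_piMl ?cmod_ge0.
have -> : a = path 1 by rewrite /path mul1r addrCA subrr addr0.
have -> : cauchy c r psi 1 (path 1) = cauchy c r psi 1 (path 0).
  apply: (pd_const (psi := fun t => cauchy c r psi 1 (path t))) => // t ht.
  have hp := hasdD (hasd_cst ofR c t) (hasdM (hasd_id ofR t) (hasd_cst ofR (a - c) t)).
  have := hasd_comp hp (cauchy1_deriv r0 cpsi (inp t ht)).
  by rewrite z2 ?mul0r //; exact: inp.
rewrite /cauchy (@cint_FTC _ _ (fun t => 'i%C * t%:C)) ?(ltW T_gt0) //.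
- by rewrite mulr0 subr0.
- by apply: kernel_cont => //; apply: inp; rewrite lexx ler01.
move=> t _; have h := hasdZ 'i%C (hasd_id ofR t); apply: hasd_eq h.
rewrite expr1 /path mul0r addr0 /psi mulr1 mulfK // -cmod_gt0 circ_dist //.
Qed.

Variable g : R[i] -> R[i].
Hypothesis hg : forall w, cmod (w - c) <= r -> exists d, cd g w d.
Let psi t := g (zeta t) * ('i%C * (zeta t - c)).

Lemma gzeta_cont : pcont (fun t => g (zeta t)).
Proof.
move=> x; apply: contat_comp; first exact: circ_cont.
by have [d h] : exists d, cd g (zeta x) d; [apply: hg; rewrite circ_dist|exact: hasd_contat h].
Qed.

Lemma psi_cont : pcont psi.
Proof.
move=> x; apply: contatM; first exact: gzeta_cont.
apply: contatM; first exact: contat_cst.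
by apply: contatB; [exact: circ_cont|exact: contat_cst].
Qed.

(** By [form2_shrink] the integral may be taken over the contracted circle, on which
g is as close to g(a) as desired; for constant g it is given by
[winding_number]. *)
Lemma cauchy_formula a : cmod (a - c) < r -> cauchy c r psi 1 a = g a * ('i%C * T%:C).
Proof.
move=> ha; rewrite -(winding_number ha).
have -> : cauchy c r (fun t => 'i%C * (zeta t - c)) 1 a = cint (kap c r a) 0 T.
  by apply: cint_ext => t; rewrite expr1.
have ckap := kap_cont r0 ha.
apply/eqP; rewrite -subr_eq0 -cmod_eq0; apply/eqP/le_anti; rewrite cmod_ge0 andbT.
apply/ler_addgt0Pl => e e0; rewrite addr0.
set m := r - cmod (a - c); have m0 : 0 < m by rewrite subr_gt0.
have T0 := T_gt0; have rm0 : 0 < r / m by rewrite divr_gt0.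
set e' := e / (2 * (r / m) * T).
have den0 : 0 < 2 * (r / m) * T by rewrite !mulr_gt0 ?invr_gt0 // pi_gt0.
have e'0 : 0 < e' by rewrite divr_gt0.
have [d hd] := hg (ltW ha).
have [dl dl0 hdl] := hasd_contat hd e'0.
(* For this S the contracted circle lies within dl of a. *)
pose S := 2 * r / dl + 1.
have S0 : 0 < S by rewrite ltr_wpDl // divr_ge0 ?ltW // mulr_gt0.
have close t : cmod (homot c r a S t - a) < dl.
  rewrite /homot addrAC subrr add0r cmodM cmod_shrink.
  have h : cmod (zeta t - a) <= 2 * r by exact: circ_near.
  rewrite mulrC ltr_pdivrMr ?shrink_den //.
  apply: le_lt_trans h _.
  have -> : 2 * r = (S - 1) * dl by rewrite /S addrK divfK // gt_eqF.
  rewrite mulrC ltr_pM2l //; have := sqr_ge0 (S - 1); nra.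
have -> : cauchy c r psi 1 a = cint (fun t => g (homot c r a S t) * kap c r a t) 0 T.
  have := form2_shrink r0 hg ha S0; rewrite /form2 -!/(cint _ _ _) => ->.
  apply: cint_ext => t; rewrite /psi expr1 /kap.
  have -> : homot c r a 0 t = zeta t.
    by rewrite /homot /shrink expr0n /= addr0 invr1 mul1r addrCA subrr addr0.
  by rewrite -[LHS]mulrA.
have c1 : pcont (fun t => g (homot c r a S t) * kap c r a t).
  by move=> x; apply: contatM; [exact: ghom_cont2|exact: ckap].
rewrite -cintZ ?(ltW T0) // -cintB ?(ltW T0) //; last first.
  by move=> x; apply: contatM; [exact: contat_cst|exact: ckap].
have -> : e = 2 * (e' * (r / m)) * (T - 0).
  rewrite subr0 /e'; move: (r / m) T rm0 T0 {den0 e'0 S S0 e' hdl dl dl0 close c1} => k t k0 t0.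
  by field; rewrite !gt_eqF.
apply: cint_le => //; first exact: ltW.
  by move=> x; apply: contatB => //; apply: contatM; [exact: contat_cst|exact: ckap].
move=> t _; rewrite -mulrBl cmodM; apply: ler_pM; rewrite ?cmod_ge0 //.
  by apply: ltW; apply: hdl; exact: close.
exact: kap_le.
Qed.

Lemma i2pi_neq0 : 'i%C * T%:C != 0 :> R[i].
Proof.
rewrite mulf_neq0 //; last by rewrite fmorph_eq0 gt_eqF // T_gt0.
by rewrite eq_complex /= oner_eq0 andbF.
Qed.

Lemma holomorphic_twice : exists g1 g2 : R[i] -> R[i],
  forall a, cmod (a - c) < r -> cd g a (g1 a) /\ cd g1 a (g2 a).
Proof.
pose w : R[i] := ('i%C * T%:C)^-1.
exists (fun a => w * cauchy c r psi 2 a), (fun a => w * (2 * cauchy c r psi 3 a)) => a ha.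
split; last by apply: hasdZ; apply: cauchy2_deriv => //; exact: psi_cont.
have e0 : 0 < r - cmod (a - c) by rewrite subr_gt0.
have h := hasdZ w (cauchy1_deriv r0 psi_cont ha).
apply: (cd_near e0 _ h) => b hb.
have hb' : cmod (b - c) < r.
  have -> : b - c = (b - a) + (a - c) by rewrite addrA subrK.
  by apply: le_lt_trans (cmodD _ _) _; move: hb; lra.
by rewrite cauchy_formula // mulrC -mulrA mulfV ?mulr1 // i2pi_neq0.
Qed.

(** The difference of the Cauchy integrals at a and c has the kernel
(a - c) / (zeta - a), up to a factor of modulus one. *)
Lemma holomorphic_lip M a : (forall w, cmod (w - c) <= r -> cmod (g w) <= M) ->
  cmod (a - c) <= r / 2 -> cmod (g a - g c) <= 4 * M * cmod (a - c) / r.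
Proof.
move=> hM hac.
have ha : cmod (a - c) < r by have h := r0; lra.
have hc : cmod (c - c) < r by rewrite subrr Normc.normc0.
have T0 := T_gt0.
have E : (g a - g c) * ('i%C * T%:C) =
    cint (fun t => psi t / (zeta t - a) ^+ 1 - psi t / (zeta t - c) ^+ 1) 0 T.
  rewrite cintB ?(ltW T0) //; try by apply: kernel_cont => //; exact: psi_cont.
  by rewrite mulrBl -!cauchy_formula.
have B : cmod ((g a - g c) * ('i%C * T%:C)) <= 2 * (2 * M * cmod (a - c) / r) * (T - 0).
  rewrite E; apply: cint_le => //; first exact: ltW.
    by move=> x; apply: contatB; apply: kernel_cont => //; exact: psi_cont.
  move=> t _; rewrite !expr1.
  have -> : psi t / (zeta t - a) - psi t / (zeta t - c) =
      g (zeta t) * ('i%C * ((a - c) / (zeta t - a))).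
    rewrite /psi; field; rewrite circ_neq //.
    by rewrite -cmod_gt0 circ_dist.
  rewrite !cmodM /= expr0n expr1n /= add0r sqrtr1 mul1r cmodV.
  have -> : 2 * M * cmod (a - c) / r = M * (cmod (a - c) * (2 / r)) by field; rewrite gt_eqF.
  apply: ler_pM; rewrite ?cmod_ge0 ?mulr_ge0 ?invr_ge0 ?cmod_ge0 //.
    by apply: hM; rewrite circ_dist.
  apply: ler_wpM2l; first exact: cmod_ge0.
  have := circ_far c r0 a t => h; rewrite -[leRHS]invrK invf_div.
  have hr := r0.
  by rewrite lef_pV2 ?posrE ?divr_gt0 //; lra.
move: B; have -> : cmod ((g a - g c) * ('i%C * T%:C)) = cmod (g a - g c) * T.
  by rewrite !cmodM cmod_real (gtr0_norm T0) /= expr0n expr1n /= add0r sqrtr1 mul1r.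
rewrite subr0.
have -> : 2 * (2 * M * cmod (a - c) / r) * T = (4 * M * cmod (a - c) / r) * T by ring.
by rewrite ler_pM2r.
Qed.

End Formula.
End Cauchy.

(** * Comparison for second order equations *)

Section Sturm.
Variable R : realType.
Local Notation ofR := (fun t : R => t%:C).
Local Notation pd := (hasd ofR).
Local Notation cd := (hasd (@id R[i])).
Implicit Types (F a : R -> R[i]) (k t x : R).

Lemma pd_conj F x d : pd F x d -> pd (fun t => (F t)^*) x d^*.
Proof.
move=> h; have [h1 h2] := pd_derive h; apply: pd_of_derive; rewrite ?cReJ ?cImJ.
  by under eq_fun do rewrite cReJ.
under eq_fun do rewrite cImJ; exact: is_deriveN.
Qed.

Lemma real_mono (u du : R -> R) (a b : R) : a <= b ->
  (forall x, a <= x <= b -> is_derive (x : R^o) (1 : R^o) (u : R^o -> R^o) (du x)) ->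
  (forall x, a <= x <= b -> 0 <= du x) -> u a <= u b.
Proof.
move=> ab H HM.
have [x hx e] : exists2 c, c \in `[a, b]%R & u b - u a = du c * (b - a).
  apply: MVT_segment => //.
    by move=> x; rewrite in_itv /= => /andP[h1 h2]; apply: H; rewrite !ltW.
  apply: derivable_within_continuous => x; rewrite in_itv /= => h.
  by have [] := H x h.
rewrite -subr_ge0 e mulr_ge0 ?subr_ge0 //.
by apply: HM; rewrite in_itv in hx.
Qed.

Lemma pd_mono F (F1 : R -> R[i]) (a b : R) : a <= b -> (forall x, a <= x <= b -> pd F x (F1 x)) ->
  (forall x, a <= x <= b -> 0 <= Re (F1 x)) -> Re (F a) <= Re (F b).
Proof.
move=> ab H HM.
apply: (real_mono (u := fun x => Re (F x)) (du := fun x => Re (F1 x)) ab) => // x hx.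
by have [h _] := pd_derive (H x hx); exact: h.
Qed.

(** The function u = sqrt (k^2 - x^2) solves u'' + k^2 / (k^2 - x^2)^2 u = 0 and is
positive. The quotient Q = |F|^2 / u^2 is nondecreasing: G = (k^2 - x^2) Q'
vanishes at 0 and
G' = 2 |F' + x F / (k^2 - x^2)|^2 + 2 |F|^2 (k^2 / (k^2 - x^2)^2 - Re a) >= 0.
As Q vanishes at both ends, it vanishes identically. Working with |F|^2 is what
allows F and a to be complex. *)
Lemma sturm F (F1 : R -> R[i]) a k t : 0 <= t -> t < k ->
  (forall x, 0 <= x <= t -> pd F x (F1 x)) ->
  (forall x, 0 <= x <= t -> pd F1 x (- (a x * F x))) ->
  (forall x, 0 <= x <= t -> Re (a x) <= k ^+ 2 / (k ^+ 2 - x ^+ 2) ^+ 2) ->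
  F 0 = 0 -> F t = 0 -> forall x, 0 <= x <= t -> F x = 0.
Proof.
move=> t0 tk hF hF1 ha F0 Ft.
have dpos x : 0 <= x <= t -> 0 < k ^+ 2 - x ^+ 2.
  move=> /andP[x0 xt]; have xk := le_lt_trans xt tk.
  have k0 : 0 <= k := ltW (le_lt_trans t0 tk).
  by rewrite subr_gt0 ltr_pXn2r ?nnegrE.
pose d x : R[i] := k%:C ^+ 2 - x%:C ^+ 2.
have dE x : d x = (k ^+ 2 - x ^+ 2)%:C by rewrite /d rmorphB !rmorphXn.
have dne x : 0 <= x <= t -> d x != 0.
  by move=> hx; rewrite dE fmorph_eq0 gt_eqF // dpos.
have hd x : pd d x (- (2 * x%:C)).
  have h := hasdB (hasd_cst ofR (k%:C ^+ 2) x) (hasdM (hasd_id ofR x) (hasd_id ofR x)).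
  have h2 : pd (fun x => k%:C ^+ 2 - x%:C ^+ 2) x (0 - (1 * x%:C + x%:C * 1)).
    by apply: hasd_ext h => y; rewrite expr2.
  by apply: hasd_eq h2; ring.
pose P x := F x * (F x)^*.
pose P1 x := F1 x * (F x)^* + F x * (F1 x)^*.
have hP x : 0 <= x <= t -> pd P x (P1 x).
  by move=> hx; apply: hasdM; [exact: hF|apply: pd_conj; exact: hF].
pose Q x := P x / d x.
pose G x := P1 x + 2 * x%:C * (P x / d x).
have hQ0 x : 0 <= x <= t -> pd Q x (P1 x / d x + P x * (- - (2 * x%:C) / d x ^+ 2)).
  move=> hx; apply: hasdM; first exact: hP.
  by apply: hasdV; [exact: dne|exact: hd].
have hQ x : 0 <= x <= t -> pd Q x (G x / d x).
  move=> hx; apply: hasd_eq (hQ0 x hx); rewrite opprK /G.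
  by field; exact: dne.
pose P2 x := - (a x * F x) * (F x)^* + F1 x * (F1 x)^* +
   (F1 x * (F1 x)^* + F x * (- (a x * F x))^*).
have hP1 x : 0 <= x <= t -> pd P1 x (P2 x).
  move=> hx; apply: hasdD; apply: hasdM; try (by apply: pd_conj; auto); auto.
have hG x : 0 <= x <= t -> pd G x (P2 x + (2 * (P x / d x) + 2 * x%:C * (G x / d x))).
  move=> hx; apply: hasdD; first exact: hP1.
  have h := hasdM (hasdZ 2 (hasd_id ofR x)) (hQ x hx).
  by apply: hasd_eq h; rewrite mulr1.
have G'ge0 x : 0 <= x <= t -> 0 <= Re (P2 x + (2 * (P x / d x) + 2 * x%:C * (G x / d x))).
  move=> hx; have dp := dpos x hx; have hax := ha x hx.
  rewrite /G /P2 /P1 /P dE; move: dp hax.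
  set D := k ^+ 2 - x ^+ 2 => dp hax.
  have kD : k ^+ 2 = D + x ^+ 2 by rewrite /D subrK.
  clearbody D; move: (F x) (F1 x) (a x) hax => [u v] [u1 v1] [al be] /= hax.
  have := sqr_ge0 (u1 + x * u / D); have := sqr_ge0 (v1 + x * v / D).
  have : 0 <= (u ^+ 2 + v ^+ 2) * (k ^+ 2 / D ^+ 2 - al).
    by rewrite mulr_ge0 ?subr_ge0 // addr_ge0 ?sqr_ge0.
  move=> h1 h2 h3.
  have h : 0 <= 2 * ((u1 + x * u / D) ^+ 2 + (v1 + x * v / D) ^+ 2 +
      (u ^+ 2 + v ^+ 2) * (k ^+ 2 / D ^+ 2 - al)).
    by rewrite mulr_ge0 // addr_ge0 // addr_ge0.
  apply: le_trans h _; rewrite le_eqVlt; apply/orP; left; apply/eqP.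
  rewrite kD expr0n /= (addr0 (D ^+ 2)) !mul0r; field; by rewrite gt_eqF.
have G0 : Re (G 0) = 0.
  by rewrite /G /P1 /P F0; case: (F1 0) => u v /=; ring.
have Gge0 x : 0 <= x <= t -> 0 <= Re (G x).
  move=> /andP[x0 xt]; rewrite -G0.
  apply: (pd_mono (F1 := fun x => P2 x + (2 * (P x / d x) + 2 * x%:C * (G x / d x))) x0) => y /andP[y0 yx].
    by apply: hG; rewrite y0 (le_trans yx).
  by apply: G'ge0; rewrite y0 (le_trans yx).
have Redv (z : R[i]) x : 0 <= x <= t -> Re (z / d x) = Re z / (k ^+ 2 - x ^+ 2).
  move=> hx; have hp := dpos x hx; rewrite dE -fmorphV.
  by case: z => z1 z2 /=; rewrite mulr0 subr0.
move=> x hx; have /andP[x0 xt] := hx.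
have mono : Re (Q x) <= Re (Q t).
  apply: (pd_mono (F1 := fun x => G x / d x) xt) => y /andP[xy yt].
    by apply: hQ; rewrite yt (le_trans x0).
  have hy : 0 <= y <= t by rewrite yt (le_trans x0).
  by rewrite Redv // divr_ge0 ?Gge0 // ltW // dpos.
move: mono; rewrite /Q !Redv ?lexx ?andbT //.
rewrite /P Ft mul0r /= mul0r => h.
have : Re (F x * (F x)^*) <= 0.
  by rewrite -(pmulr_lle0 _ (_ : 0 < (k ^+ 2 - x ^+ 2)^-1)) ?invr_gt0 ?dpos // mulrC.
rewrite cReM cReJ cImJ mulrN opprK -!expr2 -cmod_sqr => h1.
by apply/eqP; rewrite -cmod_eq0 -sqrf_eq0 eq_le h1 sqr_ge0.
Qed.

Lemma expR_pd (C x : R) : pd (fun x => (expR (- (C * x)))%:C) x (- (C * expR (- (C * x))))%:C.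
Proof.
apply: pd_real.
have h : is_derive (x : R^o) (1 : R^o) ((fun x => - (C * x)) : R^o -> R^o) (- C).
  have h1 : is_derive (x : R^o) (1 : R^o) ((fun x => - (C * x)) : R^o -> R^o) (- (C *: 1)).
    by apply: is_deriveN; apply: is_deriveZ.
  by apply: is_derive_eq h1 _; rewrite /GRing.scale /= mulr1.
have h2 := @is_derive1_comp R expR (fun x => - (C * x)) x _ _ (is_derive_expR (- (C * x))) h.
by apply: is_derive_eq h2 _; rewrite mulrN mulrC.
Qed.

(** The energy (|F|^2 + |F'|^2) exp (-(1 + K) x) is nonincreasing and starts at 0. *)
Lemma gronwall F (F1 : R -> R[i]) a (K : R) : 0 <= K ->
  (forall x, 0 <= x <= 1 -> pd F x (F1 x)) ->
  (forall x, 0 <= x <= 1 -> pd F1 x (- (a x * F x))) ->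
  (forall x, 0 <= x <= 1 -> cmod (a x) <= K) ->
  F 0 = 0 -> F1 0 = 0 -> F 1 = 0.
Proof.
move=> K0 hF hF1 ha F0 F10.
pose P x := F x * (F x)^* + F1 x * (F1 x)^*.
pose P1 x := (F1 x * (F x)^* + F x * (F1 x)^*) +
   (- (a x * F x) * (F1 x)^* + F1 x * (- (a x * F x))^*).
have hP x : 0 <= x <= 1 -> pd P x (P1 x).
  move=> hx; apply: hasdD; apply: hasdM; try (by apply: pd_conj; auto); auto.
pose C := 1 + K.
pose H x := - P x * (expR (- (C * x)))%:C.
have hH x : 0 <= x <= 1 -> pd H x (- P1 x * (expR (- (C * x)))%:C +
   - P x * (- (C * expR (- (C * x))))%:C).
  by move=> hx; apply: hasdM; [apply: hasdN; exact: hP|exact: expR_pd].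
have : Re (H 0) <= Re (H 1).
  apply: (pd_mono (F1 := fun x => - P1 x * (expR (- (C * x)))%:C +
   - P x * (- (C * expR (- (C * x))))%:C)) => // x hx.
  have hax := ha x hx; have e0 := expR_gt0 (- (C * x)).
  rewrite /P1 /P; move: (expR _) e0 => e e0.
  have : - Re (a x * (F x * (F1 x)^*)) <= K * cmod (F x) * cmod (F1 x).
    apply: le_trans (ler_norm _) _; rewrite normrN; apply: le_trans (Re_le_cmod _) _.
    rewrite !cmodM cmodJ mulrA ler_wpM2r ?cmod_ge0 // ler_wpM2r ?cmod_ge0 //.
  have : Re (F1 x * (F x)^*) <= cmod (F x) * cmod (F1 x).
    apply: le_trans (ler_norm _) _; apply: le_trans (Re_le_cmod _) _.
    by rewrite cmodM cmodJ mulrC.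
  have s1 := cmod_sqr (F x); have s2 := cmod_sqr (F1 x).
  have s3 := cmod_ge0 (F x); have s4 := cmod_ge0 (F1 x).
  move: (cmod (F x)) (cmod (F1 x)) s1 s2 s3 s4 => p q.
  move: (F x) (F1 x) (a x) => [u v] [u1 v1] [al be] /= s1 s2 p0 q0 h1 h2.
  have h4 : 0 <= (1 + K) * (p - q) ^+ 2 by rewrite mulr_ge0 ?sqr_ge0 // addr_ge0.
  have enough (r : R) : r = e * (2 * (al * (u * u1 + v * v1) - be * (v * u1 - u * v1)) - 2 * (u * u1 + v * v1) + (1 + K) * (p ^+ 2 + q ^+ 2)) -> 0 <= r.
    move=> ->; rewrite mulr_ge0 ?(ltW e0) //; lra.
  by apply: enough; rewrite s1 s2 /C; ring.
have H0 : Re (H 0) = 0 by rewrite /H /P F0 F10 /=; ring.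
rewrite H0 /H /P => h.
have hh : Re (F 1 * (F 1)^*) <= 0.
  move: h; have e0 := expR_gt0 (- (C * 1)).
  case: (F 1) (F1 1) => u v [u1 v1] /=.
  move: (expR _) e0 => e e0 h.
  have : 0 <= - ((u * u + v * v) + (u1 * u1 + v1 * v1)) * e by move: h; lra.
  rewrite pmulr_lge0 //; have := sqr_ge0 u1; have := sqr_ge0 v1; lra.
move: hh; rewrite cReM cReJ cImJ mulrN opprK -!expr2 -cmod_sqr => h1.
by apply/eqP; rewrite -cmod_eq0 -sqrf_eq0 eq_le h1 sqr_ge0.
Qed.

End Sturm.

(** * Zeros of a solution on a geodesic *)

Section Solutions.
Variable R : realType.
Local Notation ofR := (fun t : R => t%:C).
Local Notation pd := (hasd ofR).
Local Notation cd := (hasd (@id R[i])).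
Local Notation D := (@unit_disc R).
Variables (A f : R[i] -> R[i]).
Hypothesis hf : solution A f.
Local Notation f' := (derive1 (f : R[i]^o -> R[i]^o)).

Lemma analytic_cd (g : R[i] -> R[i]) : analytic_in_disc g ->
  forall z, D z -> exists d, cd g z d.
Proof. by move=> hg z /hg /derivable_cd h; exists (derive1 (g : R[i]^o -> R[i]^o) z). Qed.

(** That f' is differentiable comes from the Cauchy formula on a circle about 0 that
encloses z. *)
Lemma solution_deriv z : D z -> cd f z (f' z) /\ cd f' z (- (A z * f z)).
Proof.
move=> hz; have [af ode] := hf; split; first exact: derivable_cd (af _ hz).
set r := (cmod z + 1) / 2.
have zr : cmod z < r by move: hz; rewrite /unit_disc /= /r => h; lra.
have r1 : r < 1 by move: hz; rewrite /unit_disc /= /r => h; lra.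
have r0 : 0 < r by exact: le_lt_trans (cmod_ge0 z) zr.
have hg w : cmod (w - 0) <= r -> exists d, cd f w d.
  by rewrite subr0 => hw; apply: analytic_cd => //; exact: le_lt_trans r1.
have [g1 [g2 H]] := holomorphic_twice r0 hg.
have e (w : R[i]) : cmod w < r -> f' w = g1 w.
  move=> hw; have [|h _] := H w; first by rewrite subr0.
  by have [_] := cd_derivable h.
have [|_ h2] := H z; first by rewrite subr0.
have e0 : 0 < r - cmod z by rewrite subr_gt0.
have h : cd f' z (g2 z).
  apply: (cd_near e0 _ h2) => w hw; rewrite e //.
  have -> : w = (w - z) + z by rewrite subrK.
  by apply: le_lt_trans (cmodD _ _) _; move: hw; lra.
have := ode z hz; rewrite /cderiv /derive1n /=.
have [_ ->] := cd_derivable h => /eqP; rewrite addr_eq0 => /eqP <-.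
exact: h.
Qed.

Section Uniqueness.
Variable K : R.
Hypothesis hK : forall w, D w -> cmod (A w) * defect w ^+ 2 <= K.

(** The coefficient is bounded on the Euclidean segment from w to v, and Gronwall's
estimate applies to the restriction of f to it. *)
Lemma solution_unique w : D w -> f w = 0 -> f' w = 0 -> forall v, D v -> f v = 0.
Proof.
move=> hw fw f'w v hv.
pose r := Num.max (cmod w) (cmod v).
have r1 : r < 1 by rewrite gt_max; apply/andP.
have r0 : 0 <= r by rewrite le_max cmod_ge0.
pose y x : R[i] := w + x%:C * (v - w).
have yr x : 0 <= x <= 1 -> cmod (y x) <= r.
  move=> /andP[x0 x1].
  have -> : y x = (1 - x)%:C * w + x%:C * v.
    by rewrite /y rmorphB rmorph1; ring.
  apply: le_trans (cmodD _ _) _; rewrite !cmodM !cmod_real !ger0_norm ?subr_ge0 //.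
  have h1 : cmod w <= r by rewrite le_max lexx.
  have h2 : cmod v <= r by rewrite le_max lexx orbT.
  have k1 : (1 - x) * cmod w <= (1 - x) * r by rewrite ler_wpM2l // subr_ge0.
  have k2 : x * cmod v <= x * r by rewrite ler_wpM2l.
  lra.
have yD x : 0 <= x <= 1 -> D (y x) by move=> /yr h; exact: le_lt_trans r1.
have hy x : pd y x (v - w).
  have h := hasdD (hasd_cst ofR w x) (hasdM (hasd_id ofR x) (hasd_cst ofR (v - w) x)).
  by apply: hasd_eq h; ring.
pose m := 1 - r ^+ 2.
have m0 : 0 < m by rewrite subr_gt0 expr_lt1.
pose K' := (K / m ^+ 2) * cmod ((v - w) ^+ 2).
have yA x : 0 <= x <= 1 -> cmod (A (y x)) <= K / m ^+ 2.
  move=> hx; rewrite ler_pdivlMr ?exprn_gt0 //.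
  apply: le_trans (hK (yD x hx)); rewrite ler_wpM2l ?cmod_ge0 //.
  have h1 : m <= defect (y x).
    rewrite lerD2l lerN2 ler_pXn2r ?nnegrE ?cmod_ge0 //; exact: yr.
  by rewrite ler_pXn2r ?nnegrE ?(ltW m0) // (le_trans (ltW m0)).
have h01 : 0 <= (0 : R) <= 1 by rewrite lexx ler01.
have -> : v = y 1 by rewrite /y mul1r addrCA subrr addr0.
apply: (gronwall (F := fun x => f (y x)) (F1 := fun x => f' (y x) * (v - w))
  (a := fun x => A (y x) * (v - w) ^+ 2) (K := K')).
- by apply: mulr_ge0; [exact: le_trans (cmod_ge0 _) (yA 0 h01)|exact: cmod_ge0].
- move=> x hx; have [h _] := solution_deriv (yD x hx); exact: hasd_comp (hy x) h.
- move=> x hx; have [_ h] := solution_deriv (yD x hx).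
  have h2 := hasdM (hasd_comp (hy x) h) (hasd_cst ofR (v - w) x).
  by apply: hasd_eq h2; ring.
- move=> x hx; rewrite cmodM /K' ler_wpM2r ?cmod_ge0 //; exact: yA.
- by rewrite /y mul0r addr0.
- by rewrite /y mul0r addr0 f'w mul0r.
Qed.

End Uniqueness.

Section Moebius.
Variables z1 z2 : R[i].
Hypotheses (hz1 : D z1) (hz2 : D z2) (z12 : z1 != z2).

(** The Moebius map [mob] x = (z1 + u x) / (1 + z1^* u x) parametrises the geodesic
from z1, at x = 0, in the direction u, and reaches z2 at x = t. *)
Let t := cmod ((z2 - z1) / (1 - z1^* * z2)).
Let u := ((z2 - z1) / (1 - z1^* * z2)) / t%:C.
Let cc := z1^* * u.

Lemma mob_t_gt0 : 0 < t.
Proof.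
rewrite cmod_gt0 mulf_neq0 ?invr_eq0 ?one_sub_neq0 //.
by rewrite subr_eq0 eq_sym.
Qed.

Lemma mob_t_sqr : t ^+ 2 = cmod (z1 - z2) ^+ 2 / (cmod (z1 - z2) ^+ 2 + defect z1 * defect z2).
Proof. by rewrite /t cmodM cmodV exprMn exprVn cmod_one_sub_sqr cmodB. Qed.

Lemma mob_t_lt1 : t < 1.
Proof.
rewrite -(expr_lt1 (n := 2)) ?cmod_ge0 // mob_t_sqr.
have d : 0 < defect z1 * defect z2 by rewrite mulr_gt0 // defect_gt0.
by rewrite ltr_pdivrMr ?mul1r ?ltrDl // ltr_wpDl ?sqr_ge0.
Qed.

Lemma mob_t_hcosh : hcosh z1 z2 = (1 + t ^+ 2) / (1 - t ^+ 2).
Proof.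
have d : 0 < defect z1 * defect z2 by rewrite mulr_gt0 // defect_gt0.
have s : 0 < cmod (z1 - z2) ^+ 2 + defect z1 * defect z2 by rewrite ltr_wpDl ?sqr_ge0.
rewrite mob_t_sqr /hcosh; move: (cmod _ ^+ 2) (defect z1) (defect z2) d s => n d1 d2 d s.
have d10 : d1 != 0 by apply: contraTneq d => ->; rewrite mul0r ltxx.
have d20 : d2 != 0 by apply: contraTneq d => ->; rewrite mulr0 ltxx.
have e : n + d1 * d2 - n = d1 * d2 by ring.
by field; rewrite e mulf_neq0 // d10 d20 gt_eqF.
Qed.

Lemma mob_u : cmod u = 1.
Proof.
by rewrite /u cmodM cmodV cmod_real (gtr0_norm mob_t_gt0) mulfV // gt_eqF // mob_t_gt0.
Qed.

Lemma mob_cc : cmod cc < 1.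
Proof. by rewrite /cc cmodM mob_u mulr1 cmodJ. Qed.

Lemma cmod_add_sqr (p q : R[i]) : cmod (p + q) ^+ 2 =
  cmod p ^+ 2 + 2 * Re (p^* * q) + cmod q ^+ 2.
Proof. by rewrite !cmod_sqr; case: p q => a b [c d] /=; ring. Qed.

Lemma cmod_one_subJ (z w : R[i]) : cmod (1 - z^* * w) = cmod (1 - z * w^*).
Proof.
rewrite -cmodJ; congr cmod; apply: eq_reim; case: z w => a b [c d] /=; ring.
Qed.

Lemma cmod_add1_sqr (q : R[i]) : cmod (1 + q) ^+ 2 = 1 + 2 * Re q + cmod q ^+ 2.
Proof. by rewrite !cmod_sqr; case: q => a b /=; ring. Qed.

Definition mob_den (x : R) : R[i] := 1 + cc * x%:C.
Definition mob (x : R) : R[i] := (z1 + u * x%:C) / mob_den x.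

Lemma mob_den_sqr x : cmod (mob_den x) ^+ 2 - cmod (z1 + u * x%:C) ^+ 2 =
  defect z1 * (1 - x ^+ 2).
Proof.
have e (w : R[i]) : cmod w = 1 -> forall y : R, cmod (w * y%:C) ^+ 2 = y ^+ 2.
  by move=> h y; rewrite cmodM h mul1r cmod_real real_normK ?num_real.
rewrite /mob_den cmod_add1_sqr cmod_add_sqr (e u mob_u).
rewrite cmodM exprMn cmodM mob_u mulr1 cmodJ cmod_real real_normK ?num_real //.
by rewrite /cc -mulrA /defect; ring.
Qed.

Lemma mob_den_neq0 x : -1 <= x <= 1 -> mob_den x != 0.
Proof.
move=> hx; have h : `|x| <= 1 by rewrite ler_norml.
apply/eqP => e; have : cmod (cc * x%:C) = 1.
  have -> : cc * x%:C = mob_den x - 1 by rewrite /mob_den addrAC subrr add0r.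
  by rewrite e sub0r cmodN Normc.normc1.
rewrite cmodM cmod_real => e1.
have : cmod cc * `|x| <= cmod cc * 1 by rewrite ler_wpM2l ?cmod_ge0.
have := mob_cc; lra.
Qed.

Lemma mob_defect x : -1 <= x <= 1 ->
  defect (mob x) = defect z1 * (1 - x ^+ 2) / cmod (mob_den x) ^+ 2.
Proof.
move=> hx; have h : 0 < cmod (mob_den x) by rewrite cmod_gt0 mob_den_neq0.
rewrite -mob_den_sqr /defect /mob cmodM cmodV exprMn exprVn mulrBl divff //.
by rewrite expf_neq0 // gt_eqF.
Qed.

Lemma mob_disc x : 0 <= x -> x < 1 -> D (mob x).
Proof.
move=> x0 x1; have hx : -1 <= x <= 1 by apply/andP; split; lra.
rewrite /unit_disc /= -(expr_lt1 (n := 2)) ?cmod_ge0 // -subr_gt0 -/(defect _).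
rewrite mob_defect // divr_gt0 ?mulr_gt0 ?defect_gt0 ?exprn_gt0 ?cmod_gt0 ?mob_den_neq0 //.
by rewrite subr_gt0 expr_lt1.
Qed.

Lemma mob0 : mob 0 = z1.
Proof. by rewrite /mob /mob_den !mulr0 !addr0 invr1 mulr1. Qed.

Lemma mobt : mob t = z2.
Proof.
have t0 : t%:C != 0 :> R[i] by rewrite fmorph_eq0 gt_eqF // mob_t_gt0.
have e : u * t%:C = (z2 - z1) / (1 - z1^* * z2) by rewrite /u divfK.
have n1 := one_sub_neq0 hz1 hz2.
have tt : -1 <= t <= 1.
  by have := mob_t_lt1; have := mob_t_gt0; move: t => y ? ?; apply/andP; split; lra.
have := mob_den_neq0 tt; rewrite /mob /mob_den /cc -mulrA e => n2.
have d1 : 1 - z1^* * z1 != 0 by exact: one_sub_neq0.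
by field; rewrite n1 /=; move: d1; congr (_ != 0); ring.
Qed.

(** Along a unit speed geodesic the vectors of the hyperboloid model are
cosh (d) e0 + sinh (d) e1, with cosh (d) = (1 + x^2) / (1 - x^2) and
sinh (d) = 2 x / (1 - x^2). *)
Lemma mob_hcosh v : D v -> exists W : R, forall x, 0 <= x -> x < 1 ->
  hcosh (mob x) v = (1 + x ^+ 2) / (1 - x ^+ 2) * hcosh z1 v + x / (1 - x ^+ 2) * W.
Proof.
move=> hv; have [d1 dv] := (defect_gt0 hz1, defect_gt0 hv).
pose w : R := Re ((1 - z1 * v^*)^* * (u * (z1^* - v^*))).
exists (4 * w / (defect z1 * defect v)) => x x0 x1.
have hx : -1 <= x <= 1 by apply/andP; split; lra.
have hm := mob_disc x0 x1.
have n1 := mob_den_neq0 hx.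
have dx : 0 < 1 - x ^+ 2 by rewrite subr_gt0 expr_lt1.
have cden : 0 < cmod (mob_den x) by rewrite cmod_gt0.
have e0 : hcosh (mob x) v = hcosh (mob x) v + 1 - 1 by rewrite addrK.
have e1 : cmod (1 - (mob x)^* * v) ^+ 2 =
   (cmod (1 - z1 * v^*) ^+ 2 + 2 * x * w + x ^+ 2 * cmod (z1 - v) ^+ 2) / cmod (mob_den x) ^+ 2.
  rewrite cmod_one_subJ.
  have -> : 1 - mob x * v^* = ((1 - z1 * v^*) + (u * (z1^* - v^*)) * x%:C) / mob_den x.
    rewrite /mob; have -> : (1 - z1 * v^*) + (u * (z1^* - v^*)) * x%:C =
       mob_den x - (z1 + u * x%:C) * v^* by rewrite /mob_den /cc; ring.
    by field.
  rewrite cmodM cmodV exprMn exprVn (cmod_add_sqr (1 - z1 * v^*)); congr (_ / _).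
  rewrite (cmodM (u * _)) (cmodM u) mob_u mul1r cmod_real exprMn real_normK ?num_real //.
  have -> : cmod (z1^* - v^*) = cmod (z1 - v) by rewrite -rmorphB cmodJ.
  have -> : Re ((1 - z1 * v^*)^* * (u * (z1^* - v^*) * x%:C)) = x * w.
    rewrite mulrA /w; move: (_ * (u * _)) => z.
    by case: z => a b /=; ring.
  by ring.
have e2 : cmod (1 - z1 * v^*) ^+ 2 = cmod (z1 - v) ^+ 2 + defect z1 * defect v.
  by rewrite -cmod_one_sub_sqr cmod_one_subJ.
rewrite e0 hcosh_succ // e1 e2 mob_defect // /hcosh.
move: (cmod (mob_den x)) (cmod (z1 - v)) (defect z1) (defect v) cden d1 dv => n m a b n0 a0 b0.
field; rewrite !gt_eqF //.
Qed.

(** The coefficients of z1 and z2 solve a linear system in these two functions. *)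
Lemma mob_seg x : 0 <= x -> x <= t -> seg z1 z2 (mob x).
Proof.
move=> x0 xt; have t1 := mob_t_lt1; have t0 := mob_t_gt0.
have x1 : x < 1 by exact: le_lt_trans t1.
split; first exact: mob_disc.
have dx : 0 < 1 - x ^+ 2 by rewrite subr_gt0 expr_lt1.
have dt : 0 < 1 - t ^+ 2 by rewrite subr_gt0 expr_lt1 // ltW.
exists ((1 - x / t) * (1 - x * t) / (1 - x ^+ 2)), ((x / (1 - x ^+ 2)) / (t / (1 - t ^+ 2))); split.
- apply: divr_ge0; last exact: ltW.
  apply: mulr_ge0; rewrite subr_ge0; first by rewrite ler_pdivrMr // mul1r.
  by rewrite mulr_ile1 // ltW.
- by apply: divr_ge0; apply: divr_ge0 => //; exact: ltW.
move=> v hv; have [W hW] := mob_hcosh hv.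
rewrite -[in hcosh z2 v]mobt !hW // ?(ltW t0) //.
move: (hcosh z1 v) t t0 dt t1 xt {hW} => h s s0 ds s1 xs.
by field; rewrite !gt_eqF.
Qed.

(** The function F = f(mob) (1 + z1^* u x) solves F'' = - A(mob) mob'^2 F, and
|mob'| = (1 - |mob|^2) / (1 - x^2). If the coefficient were dominated on all
of [0, t], the comparison [sturm] would give F = 0 there; then f and f' would
vanish at an interior point and f would be zero. *)
Lemma mob_sturm (k : R) : (exists2 v, D v & f v != 0) ->
  (exists K, forall w, D w -> cmod (A w) * defect w ^+ 2 <= K) ->
  f z1 = 0 -> f z2 = 0 -> t < k ->
  exists x w, [/\ 0 <= x <= t, seg z1 z2 w &
    k ^+ 2 / (k ^+ 2 - x ^+ 2) ^+ 2 < cmod (A w) * defect w ^+ 2 / (1 - x ^+ 2) ^+ 2].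
Proof.
move=> [v hv fv] [K hK] f1 f2 tk; apply: contrapT => H; move/eqP: fv; apply.
have t1 := mob_t_lt1; have t0 := mob_t_gt0.
have lt1 x : 0 <= x <= t -> 0 <= x /\ x < 1.
  by move=> /andP[x0 xt]; split => //; exact: le_lt_trans t1.
have in1 x : 0 <= x <= t -> -1 <= x <= 1.
  by move=> /lt1[x0 x1]; apply/andP; split; lra.
pose s := u * (defect z1)%:C.
pose p' x := s / mob_den x ^+ 2.
have hden x : pd mob_den x cc.
  have h := hasdD (hasd_cst ofR 1 x) (hasdZ cc (hasd_id ofR x)).
  by apply: hasd_eq h; ring.
have d1E : (defect z1)%:C = 1 - z1^* * z1.
  rewrite /defect cmod_sqr; apply: eq_reim; case: (z1) => a b /=; ring.
have hmob x : 0 <= x <= t -> pd mob x (p' x).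
  move=> hx; have n := mob_den_neq0 (in1 x hx).
  have hn := hasdD (hasd_cst ofR z1 x) (hasdZ u (hasd_id ofR x)).
  have h := hasdM hn (hasdV (f := mob_den) n (hden x)).
  apply: hasd_eq h; rewrite /p' /s d1E.
  have -> : mob_den x = 1 + cc * x%:C by [].
  rewrite /mob_den in n; rewrite /cc; field; exact: n.
have mD x : 0 <= x <= t -> D (mob x) by move=> /lt1[]; exact: mob_disc.
pose F x := f (mob x) * mob_den x.
pose F1 x := f' (mob x) * s * (mob_den x)^-1 + f (mob x) * cc.
pose a x := A (mob x) * s ^+ 2 / mob_den x ^+ 4.
have hF x : 0 <= x <= t -> pd F x (F1 x).
  move=> hx; have n := mob_den_neq0 (in1 x hx).
  have [h1 _] := solution_deriv (mD x hx).
  have h := hasdM (hasd_comp (hmob x hx) h1) (hden x).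
  by apply: hasd_eq h; rewrite /F1 /p'; field.
have hF1 x : 0 <= x <= t -> pd F1 x (- (a x * F x)).
  move=> hx; have n := mob_den_neq0 (in1 x hx).
  have [h1 h2] := solution_deriv (mD x hx).
  have k1 := hasdM (hasdM (hasd_comp (hmob x hx) h2) (hasd_cst ofR s x))
    (hasdV (f := mob_den) n (hden x)).
  have k2 := hasdM (hasd_comp (hmob x hx) h1) (hasd_cst ofR cc x).
  by apply: hasd_eq (hasdD k1 k2); rewrite /a /F /p'; field.
have ha x : 0 <= x <= t -> Re (a x) <= k ^+ 2 / (k ^+ 2 - x ^+ 2) ^+ 2.
  move=> hx; have n := mob_den_neq0 (in1 x hx).
  (* The negated conclusion says that the maximum is its first argument. *)
  have -> : k ^+ 2 / (k ^+ 2 - x ^+ 2) ^+ 2 = Num.max (k ^+ 2 / (k ^+ 2 - x ^+ 2) ^+ 2)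
     (cmod (A (mob x)) * defect (mob x) ^+ 2 / (1 - x ^+ 2) ^+ 2).
    apply/esym/max_idPl; rewrite leNgt; apply/negP => hlt; apply: H.
    exists x, (mob x); split => //; case/andP: hx => x0 xt; exact: mob_seg.
  rewrite le_max; apply/orP; right.
  apply: le_trans (ler_norm _) _; apply: le_trans (Re_le_cmod _) _.
  have -> : cmod (a x) = cmod (A (mob x)) * (cmod u * cmod (defect z1)%:C) ^+ 2 / cmod (mob_den x) ^+ 4.
    by rewrite /a -(cmodM u) -/s cmodM cmodV !cmodX cmodM cmodX.
  rewrite mob_u mul1r cmod_real mob_defect ?in1 //.
  have [x0 x1] := lt1 x hx.
  have dx : 0 < 1 - x ^+ 2 by rewrite subr_gt0 expr_lt1.
  have cd0 : 0 < cmod (mob_den x) by rewrite cmod_gt0.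
  rewrite real_normK ?num_real // le_eqVlt; apply/orP; left; apply/eqP.
  move: (cmod (mob_den x)) cd0 => n1 n10; field.
  by rewrite !gt_eqF.
have t00 : 0 <= (0 : R) <= t by rewrite lexx ltW.
have F00 : F 0 = 0 by rewrite /F mob0 f1 mul0r.
have Ft0 : F t = 0 by rewrite /F mobt f2 mul0r.
have F0 := sturm (ltW t0) tk hF hF1 ha F00 Ft0.
pose x0 := t / 2.
have hx0 : 0 <= x0 <= t by rewrite /x0; apply/andP; split; lra.
have n := mob_den_neq0 (in1 x0 hx0).
have fx0 : f (mob x0) = 0.
  by have /eqP := F0 x0 hx0; rewrite /F mulf_eq0 (negbTE n) orbF => /eqP.
(* F vanishes on a neighbourhood of the midpoint, hence so does F'. *)
have F1x0 : F1 x0 = 0.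
  apply/eqP; rewrite -cmod_eq0; apply/eqP/le_anti; rewrite cmod_ge0 andbT.
  apply/ler_addgt0Pl => e e0; rewrite addr0.
  have [dl dl0 hdl] := hasd_eps (hF x0 hx0) e0.
  pose y := x0 + Num.min (dl / 2) x0.
  have x00 : 0 < x0 by rewrite divr_gt0.
  have m0 : 0 < Num.min (dl / 2) x0 by rewrite lt_min divr_gt0.
  have hy : 0 <= y <= t.
    rewrite /y addr_ge0 ?(ltW x00) ?(ltW m0) //=.
    have : Num.min (dl / 2) x0 <= x0 by rewrite ge_min lexx orbT.
    by rewrite /x0; lra.
  have := hdl y; rewrite ofRB cmod_real.
  have -> : y - x0 = Num.min (dl / 2) x0 by rewrite /y addrAC subrr add0r.
  rewrite (gtr0_norm m0) !F0 // subrr sub0r cmodN cmodM cmod_real (gtr0_norm m0).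
  rewrite ler_pM2r //; apply.
  have : Num.min (dl / 2) x0 <= dl / 2 by rewrite ge_min lexx.
  lra.
have f'x0 : f' (mob x0) = 0.
  move: F1x0; rewrite /F1 fx0 mul0r addr0 => /eqP.
  rewrite mulf_eq0 invr_eq0 (negbTE n) orbF mulf_eq0 => /orP[/eqP//|].
  rewrite -cmod_eq0 /s (cmodM u) mob_u mul1r cmod_real gtr0_norm ?defect_gt0 //.
  by rewrite gt_eqF // defect_gt0.
exact: solution_unique hK _ (mD x0 hx0) fx0 f'x0 _ hv.
Qed.

End Moebius.

Section ZeroGeometry.
Variable K : R.
Hypothesis hK : forall w, D w -> cmod (A w) * defect w ^+ 2 <= K.
Hypothesis nt : exists2 v, D v & f v != 0.

(** The case k = 1 of [mob_sturm]. *)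
Lemma bad_point_between z1 z2 : D z1 -> D z2 -> z1 != z2 -> f z1 = 0 -> f z2 = 0 ->
  exists2 w, 1 <= cmod (A w) * defect w ^+ 2 & seg z1 z2 w.
Proof.
move=> h1 h2 h12 f1 f2.
have [x [w [/andP[x0 xt] hs hx]]] :=
  mob_sturm h1 h2 h12 nt (ex_intro _ K hK) f1 f2 (mob_t_lt1 h1 h2).
exists w => //; move: hx; rewrite expr1n.
have x1 := le_lt_trans xt (mob_t_lt1 h1 h2).
have dx : 0 < 1 - x ^+ 2 by rewrite subr_gt0 expr_lt1.
by rewrite ltr_pM2r ?invr_gt0 ?exprn_gt0 // => /ltW.
Qed.

(** For k small, 1 / k^2 exceeds every value of the coefficient on [0, k], so the
parameter t of the second zero cannot be less than k. *)
Lemma zeros_separated : exists2 eta : R, 0 < eta & forall z1 z2, D z1 -> D z2 ->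
  z1 != z2 -> f z1 = 0 -> f z2 = 0 -> 1 + eta <= hcosh z1 z2.
Proof.
(* On [0, k] the coefficient is at most 2 |K|, and 2 |K| < 1 / k^2. *)
pose k : R := (2 * (1 + `|K|))^-1.
have kk : 0 < 1 + `|K| by rewrite ltr_pwDl.
have k0 : 0 < k by rewrite invr_gt0 mulr_gt0.
have k2 : k <= 1 / 2.
  by rewrite div1r lef_pV2 ?posrE ?mulr_gt0 // ler_peMr // lerDl.
exists (2 * k ^+ 2); first by rewrite mulr_gt0 // exprn_gt0.
move=> z1 z2 h1 h2 h12 f1 f2.
rewrite (mob_t_hcosh h1 h2); set t := cmod _.
have t0 : 0 < t := mob_t_gt0 h1 h2 h12.
have t1 : t < 1 := mob_t_lt1 h1 h2.
have dt : 0 < 1 - t ^+ 2 by rewrite subr_gt0 expr_lt1 // ltW.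
have [kt|tk] := leP k t.
  have : k ^+ 2 <= t ^+ 2 by rewrite ler_pXn2r // nnegrE ltW.
  rewrite ler_pdivlMr // => h; have : 0 <= k ^+ 2 * t ^+ 2 by rewrite mulr_ge0 ?sqr_ge0.
  lra.
have [x [w [/andP[x0 xt] hs hx]]] := mob_sturm h1 h2 h12 nt (ex_intro _ K hK) f1 f2 tk.
exfalso; have Dw : D w by case: hs.
have hKw := hK Dw.
have xk : x < k := le_lt_trans xt tk.
have x2 : x ^+ 2 <= 1 / 4.
  have -> : 1 / 4 = (1 / 2) ^+ 2 :> R by field.
  by rewrite ler_pXn2r ?nnegrE //; lra.
have dx : 0 < k ^+ 2 - x ^+ 2 by rewrite subr_gt0 ltr_pXn2r ?nnegrE // ltW.
have x20 := sqr_ge0 x.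
have l1 : 1 / k ^+ 2 <= k ^+ 2 / (k ^+ 2 - x ^+ 2) ^+ 2.
  rewrite ler_pdivlMr ?exprn_gt0 // mulrAC ler_pdivrMr ?exprn_gt0 // mul1r -expr2.
  have k20 : 0 < k ^+ 2 by rewrite exprn_gt0.
  rewrite ler_pXn2r ?nnegrE ?(ltW dx) ?(ltW k20) //; lra.
have l2 : cmod (A w) * defect w ^+ 2 / (1 - x ^+ 2) ^+ 2 <= 2 * `|K|.
  have hp : 9 / 16 <= (1 - x ^+ 2) ^+ 2.
    have -> : 9 / 16 = (3 / 4) ^+ 2 :> R by field.
    by rewrite ler_pXn2r ?nnegrE //; lra.
  rewrite ler_pdivrMr; last by apply: lt_le_trans hp.
  have := ler_norm K; have hn : 0 <= `|K| by [].
  have : `|K| * (9 / 16) <= `|K| * (1 - x ^+ 2) ^+ 2 by rewrite ler_wpM2l.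
  lra.
have l3 : 2 * `|K| < 1 / k ^+ 2.
  rewrite /k exprVn div1r invrK exprMn.
  have := ler_norm K; have hn : 0 <= `|K| by [].
  have : 0 <= `|K| ^+ 2 by rewrite sqr_ge0.
  lra.
lra.
Qed.

End ZeroGeometry.
End Solutions.

(** * Separated points and local maxima *)

Section Packing.
Variable R : realType.
Local Notation D := (@unit_disc R).

(** Comparing the distances of y and b to 0 by the triangle inequality, since
E(z, 0) = (2 - (1 - |z|^2)) / (1 - |z|^2). *)
Lemma hcosh_defect (y b : R[i]) (La : R) : D y -> D b -> hcosh y b <= La ->
  defect b <= 6 * La * defect y.
Proof.
move=> hy hb hE; have [dy db] := (defect_gt0 hy, defect_gt0 hb).
have h0 : D 0 by rewrite /unit_disc /= expr0n /= addr0 sqrtr0 ltr01.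
have d0 : defect (0 : R[i]) = 1 by rewrite /defect Normc.normc0 expr0n subr0.
have E0 (z : R[i]) : D z -> hcosh z 0 = (2 - defect z) / defect z.
  move=> hz; have dz := defect_gt0 hz; rewrite /hcosh subr0 d0 mulr1.
  have -> : cmod z ^+ 2 = 1 - defect z by rewrite /defect opprB addrCA subrr addr0.
  by field; rewrite gt_eqF.
have := hcosh_triangle hy hb h0; rewrite !E0 //.
have y1 : defect y <= 1 by rewrite /defect gerBl sqr_ge0.
have b0 : defect b <= 1 by rewrite /defect gerBl sqr_ge0.
have La1 : 1 <= La by apply: le_trans hE; exact: hcosh_ge1.
have e : 0 <= (2 - defect b) / defect b by rewrite divr_ge0 ?ltW //; lra.
have : 3 * hcosh y b * ((2 - defect b) / defect b) <= 3 * La * ((2 - defect b) / defect b).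
  by rewrite ler_wpM2r // ler_pM2l.
move=> h1 h2; have := le_trans h2 h1.
rewrite mulrA ler_pdivlMr // mulrAC ler_pdivrMr // => h.
have h3 : defect b * 1 <= (2 - defect y) * defect b.
  by rewrite mulrC ler_wpM2r ?(ltW db) //; lra.
have h4 : 0 <= La * defect b * defect y by rewrite !mulr_ge0 ?ltW // (lt_le_trans _ La1).
lra.
Qed.

(** After the affine map u that sends y to 0 and scales by 1 / (1 - |y|^2), the points
lie in a square of bounded size with mutual Euclidean distances bounded below, so
the cells of a fixed fine grid contain at most one of them each. *)
Lemma packing_count (eta La : R) : 0 < eta -> 1 <= La -> exists N : nat,
  forall (I : finType) (J : {set I}) (b : I -> R[i]) (y : R[i]), D y ->
    (forall i, i \in J -> D (b i) /\ hcosh y (b i) <= La) ->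
    (forall i j, i \in J -> j \in J -> i != j -> 1 + eta <= hcosh (b i) (b j)) ->
    (#|J| <= N)%N.
Proof.
move=> eta0 La1; have La0 : 0 < La by apply: lt_le_trans La1.
(* Lower bound for the squared distances of the rescaled points. *)
pose sg : R := eta / (72 * La ^+ 2).
have sg0 : 0 < sg by rewrite divr_gt0 // mulr_gt0 // exprn_gt0.
pose n := (Num.bound (2 / sg)).+1.
have nsg : 2 / n%:R ^+ 2 <= sg.
  have n1 : (1 : R) <= n%:R by rewrite ler1n.
  have hb : 2 / sg <= n%:R.
    have h : 0 <= 2 / sg by rewrite divr_ge0 // ltW.
    by apply: le_trans (ltW (archi_boundP h)) _; rewrite ler_nat.
  rewrite ler_pdivrMr ?exprn_gt0 ?ltr0n //.
  rewrite ler_pdivrMr // mulrC in hb; apply: le_trans hb _.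
  by rewrite ler_pM2l // expr2 ler_peMl // (le_trans _ n1).
pose B := (Num.bound (4 * La * n%:R)).+1.
have hB (x : R) : 0 <= x -> x <= 4 * La * n%:R -> (Num.truncn x < B)%N.
  move=> x0 hx.
  rewrite ltnS; have /andP[h _] := truncn_itv x0.
  rewrite -(ler_nat R); apply: le_trans h _; apply: le_trans hx _.
  by apply: ltW; apply: archi_boundP; rewrite !mulr_ge0 // ltW.
exists (B * B)%N => I J b y hy hJ sep; have dy := defect_gt0 hy.
pose u i : R[i] := (b i - y) / (defect y)%:C.
have u_le i : i \in J -> cmod (u i) <= 2 * La.
  move=> iJ; have [hb hE] := hJ i iJ; have db := defect_gt0 hb.
  rewrite /u cmodM cmodV cmod_real (gtr0_norm dy) ler_pdivrMr //.
  rewrite -(ler_pXn2r (n := 2)) // ?nnegrE ?cmod_ge0 //; last first.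
    by rewrite !mulr_ge0 // ltW.
  have hd := hcosh_defect hy hb hE.
  have -> : cmod (b i - y) ^+ 2 = (hcosh y (b i) - 1) / 2 * (defect y * defect (b i)).
    by rewrite /hcosh cmodB; field; rewrite !gt_eqF.
  have h1 : (hcosh y (b i) - 1) / 2 <= La / 2 by lra.
  have h0 : 0 <= (hcosh y (b i) - 1) / 2 by have := hcosh_ge1 hy hb; lra.
  have h2 : (hcosh y (b i) - 1) / 2 * (defect y * defect (b i)) <=
     La / 2 * (defect y * (6 * La * defect y)).
    apply: ler_pM => //; first by rewrite mulr_ge0 // ltW.
    by rewrite ler_pM2l.
  apply: le_trans h2 _.
  have : 0 <= (La * defect y) ^+ 2 by rewrite sqr_ge0.
  rewrite !exprMn; lra.
have u_sep i j : i \in J -> j \in J -> i != j -> sg <= cmod (u i - u j) ^+ 2.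
  move=> iJ jJ ij; have [hi hEi] := hJ i iJ; have [hj hEj] := hJ j jJ.
  have [di dj] := (defect_gt0 hi, defect_gt0 hj).
  have -> : u i - u j = (b i - b j) / (defect y)%:C by rewrite /u; ring.
  rewrite cmodM cmodV cmod_real (gtr0_norm dy) exprMn exprVn.
  have -> : cmod (b i - b j) ^+ 2 = (hcosh (b i) (b j) - 1) / 2 * (defect (b i) * defect (b j)).
    by rewrite /hcosh; field; rewrite !gt_eqF.
  have h := sep i j iJ jJ ij.
  rewrite hcoshC in hEi; rewrite hcoshC in hEj.
  have h1 := hcosh_defect hi hy hEi; have h2 := hcosh_defect hj hy hEj.
  rewrite ler_pdivlMr ?exprn_gt0 // /sg.
  have h3 : defect y * defect y <= 6 * La * defect (b i) * (6 * La * defect (b j)).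
    by apply: ler_pM; rewrite ?(ltW dy).
  have h4 : eta / 2 * (defect (b i) * defect (b j)) <=
     (hcosh (b i) (b j) - 1) / 2 * (defect (b i) * defect (b j)).
    by rewrite ler_pM2r ?mulr_gt0 //; lra.
  apply: le_trans h4.
  rewrite mulrAC ler_pdivrMr ?mulr_gt0 ?exprn_gt0 // expr2.
  have -> : eta / 2 * (defect (b i) * defect (b j)) * (72 * La ^+ 2) =
     eta * (6 * La * defect (b i) * (6 * La * defect (b j))) by field.
  by rewrite ler_pM2l.
pose cell (x : R) : 'I_B := inord (Num.truncn ((x + 2 * La) * n%:R)).
have n0 : (0 : R) < n%:R by rewrite ltr0n.
have cellP (x x' : R) : `|x| <= 2 * La -> `|x'| <= 2 * La -> cell x = cell x' ->
    (x - x') ^+ 2 < 1 / n%:R ^+ 2.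
  have rng (z : R) : `|z| <= 2 * La -> 0 <= (z + 2 * La) * n%:R /\
      (Num.truncn ((z + 2 * La) * n%:R) < B)%N.
    rewrite ler_norml => /andP[h1 h2].
    have h : 0 <= (z + 2 * La) * n%:R by rewrite mulr_ge0 ?ler0n //; lra.
    by split => //; apply: hB => //; rewrite ler_wpM2r ?ler0n //; lra.
  move=> /rng[p1 q1] /rng[p2 q2] /(congr1 val); rewrite /= !inordK // => e.
  have /andP[a1 a2] := truncn_itv p1; have /andP[b1 b2] := truncn_itv p2.
  rewrite -e in b1 b2.
  have : `|x - x'| * n%:R < 1.
    rewrite -{1}(gtr0_norm n0) -normrM.
    have -> : (x - x') * n%:R = (x + 2 * La) * n%:R - (x' + 2 * La) * n%:R by ring.
    move: a2 b2; rewrite -natr1 => a2 b2.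
    rewrite ltr_norml; apply/andP; split; lra.
  rewrite -ltr_pdivlMr // => h; rewrite -real_normK ?num_real //.
  have -> : 1 / n%:R ^+ 2 = (1 / n%:R) ^+ 2 :> R by rewrite exprMn exprVn expr1n.
  by rewrite ltr_pXn2r // nnegrE ?normr_ge0 // divr_ge0 // ltW.
pose g i := (cell (Re (u i)), cell (Im (u i))).
have inj : {in J &, injective g}.
  move=> i j iJ jJ [e1 e2]; apply/eqP; rewrite -[_ == _]negbK; apply/negP => ij.
  have := u_sep i j iJ jJ ij; rewrite cmod_sqr cReD cImD cReN cImN.
  have h1 := cellP _ _ (le_trans (Re_le_cmod _) (u_le i iJ)) (le_trans (Re_le_cmod _) (u_le j jJ)) e1.
  have h2 := cellP _ _ (le_trans (Im_le_cmod _) (u_le i iJ)) (le_trans (Im_le_cmod _) (u_le j jJ)) e2.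
  lra.
rewrite -(card_in_imset inj); apply: leq_trans (max_card _) _.
by rewrite card_prod !card_ord.
Qed.

End Packing.

Section LocalLower.
Variable R : realType.
Local Notation D := (@unit_disc R).
Local Notation cd := (hasd (@id R[i])).
Variable A : R[i] -> R[i].
Hypothesis hA : forall w, D w -> exists d, cd A w d.

Lemma cmod_lip (z w : R[i]) : `|cmod z - cmod w| <= cmod (z - w).
Proof.
have h1 : cmod z <= cmod (z - w) + cmod w by have := cmodD (z - w) w; rewrite subrK.
have h2 : cmod w <= cmod (w - z) + cmod z by have := cmodD (w - z) z; rewrite subrK.
by rewrite cmodB in h2; rewrite ler_norml; apply/andP; split; lra.
Qed.

(** Complex numbers through their coordinates, in order to use that rectangles are
compact. *)
Definition pt (x : R * R) : R[i] := x.1 +i* x.2.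

Lemma pt_cont (x y : R * R) (e : R) : ball x e y -> cmod (pt y - pt x) < 2 * e.
Proof.
case=> h1 h2; apply: le_lt_trans (cmod_le_ReIm _) _; rewrite /pt /=.
by rewrite (distrC y.1) (distrC y.2); move: h1 h2; rewrite /ball /=; lra.
Qed.

Lemma real_cont_disc (F : R[i] -> R) (S : set (R * R)) :
  (forall x, S x -> forall e : R, 0 < e -> exists2 dl : R, 0 < dl & forall z, cmod (z - pt x) < dl ->
     `|F z - F (pt x)| < e) ->
  {within S, continuous (F \o pt)}.
Proof.
move=> H; apply: continuous_in_subspaceT => x /set_mem Sx.
apply/cvgrPdist_lt => e e0; have [dl dl0 h] := H x Sx e e0.
have dl2 : 0 < dl / 2 by rewrite divr_gt0.
apply: filterS (nbhsx_ballx x (dl / 2) dl2) => y /pt_cont hy /=; rewrite distrC; apply: h.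
by apply: lt_le_trans hy _; rewrite mulrC divfK.
Qed.

(** Maximise |A(z)| (r - |z - w|)^(k + 1) over the disc of radius r about w. If the
maximum is attained at z0, at distance 2 s from the rim, then points within s of
z0 are at distance at least s from the rim, so |A| exceeds |A(z0)| there by a
factor 2^(k + 1) at most. *)
Lemma doubling_point (k : nat) (w : R[i]) : D w -> A w != 0 ->
  let r := (1 - cmod w) / 2 in
  exists z0 s, [/\ 0 < s, 2 * s <= r, cmod (z0 - w) + 2 * s = r,
    cmod (A w) * r ^+ k.+1 <= cmod (A z0) * (2 * s) ^+ k.+1 &
    forall z, cmod (z - z0) <= s -> cmod (A z) <= 2 ^+ k.+1 * cmod (A z0)].
Proof.
move=> hw Aw r; have w1 : cmod w < 1 by exact: hw.
have r0 : 0 < r by rewrite /r divr_gt0 // subr_gt0.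
(* Truncated at 0, the weight is continuous on the enclosing square. *)
pose wt z := Num.max 0 (r - cmod (z - w)).
pose F z := cmod (A z) * wt z ^+ k.+1.
pose S : set (R * R) := `[Re w - r, Re w + r] `*` `[Im w - r, Im w + r].
have cS : compact S by apply: compact_setX; exact: segment_compact.
have inS z : cmod (z - w) <= r -> S (Re z, Im z).
  move=> h; have h1 := le_trans (Re_le_cmod _) h; have h2 := le_trans (Im_le_cmod _) h.
  rewrite cReD cReN in h1; rewrite cImD cImN in h2.
  move: h1 h2; rewrite !ler_norml => /andP[? ?] /andP[? ?].
  by split; rewrite /= in_itv /=; apply/andP; split; lra.
have ptE z : pt (Re z, Im z) = z by case: z.
have SD x : S x -> D (pt x).
  case: x => x1 x2 [] /=; rewrite !in_itv /= => /andP[h1 h2] /andP[h3 h4].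
  have k1 : `|Re (pt (x1, x2) - w)| <= r.
    by rewrite cReD cReN /= ler_norml; apply/andP; split; lra.
  have k2 : `|Im (pt (x1, x2) - w)| <= r.
    by rewrite cImD cImN /= ler_norml; apply/andP; split; lra.
  have : cmod (pt (x1, x2) - w) < 2 * r.
    rewrite -(ltr_pXn2r (n := 2)) // ?nnegrE ?cmod_ge0 //; last by rewrite mulr_ge0 // ltW.
    rewrite cmod_sqr -(real_normK (num_real (Re _))) -(real_normK (num_real (Im _))).
    have := lerXn2r 2 (normr_ge0 _) (ltW r0) k1.
    have := lerXn2r 2 (normr_ge0 _) (ltW r0) k2.
    have : 0 < r ^+ 2 by rewrite exprn_gt0.
    have -> : (2 * r) ^+ 2 = 4 * r ^+ 2 by ring.
    lra.
  have := cmodD (pt (x1, x2) - w) w; rewrite subrK /unit_disc /= /r; lra.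
have wt_lip z z' : `|wt z - wt z'| <= cmod (z - z').
  have h1 : cmod (z - w) <= cmod (z - z') + cmod (z' - w).
    by have := cmodD (z - z') (z' - w); rewrite addrA subrK.
  have h2 : cmod (z' - w) <= cmod (z - z') + cmod (z - w).
    by have := cmodD (z' - z) (z - w); rewrite addrA subrK (cmodB z' z).
  have h3 := cmod_ge0 (z - z').
  rewrite /wt; case: (leP 0 (r - cmod (z - w))) => a1; case: (leP 0 (r - cmod (z' - w))) => a2;
    rewrite ler_norml; apply/andP; split; lra.
have wt_cont z : contat id (fun z => (wt z)%:C) z.
  move=> e e0; exists e => // y hy; rewrite -rmorphB cmod_real.
  exact: le_lt_trans (wt_lip _ _) hy.
have wtX_cont n z : contat id (fun z => (wt z)%:C ^+ n) z.
  elim: n => [|n IH]; first by under [X in contat _ X]eq_fun do rewrite expr0; exact: contat_cst.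
  have -> : (fun z => (wt z)%:C ^+ n.+1) = (fun z => (wt z)%:C * (wt z)%:C ^+ n).
    by apply/funext => z'; rewrite exprS.
  exact: contatM.
have wt0 z : 0 <= wt z by rewrite le_max lexx.
have FE z : F z = cmod (A z * (wt z)%:C ^+ k.+1).
  by rewrite cmodM cmodX cmod_real ger0_norm.
have Fc : {within S, continuous (F \o pt)}.
  apply: real_cont_disc => x /SD Dx e e0.
  have [d hd] := hA Dx.
  have [dl dl0 h] := contatM (hasd_contat hd) (wtX_cont k.+1 (pt x)) e0.
  exists dl => // z /h; rewrite !FE; apply: le_lt_trans.
  exact: cmod_lip.
have Sw : S (Re w, Im w) by apply: inS; rewrite subrr Normc.normc0 ltW.
have [c cS' hmax] := @compact_EVT_max _ _ (F \o pt) S (ex_intro _ _ Sw) cS Fc.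
pose z0 := pt c.
have hz0 z : cmod (z - w) <= r -> F z <= F z0.
  by move=> /inS/mem_set/hmax; rewrite /= ptE.
have Fw : F w = cmod (A w) * r ^+ k.+1.
  by rewrite /F /wt subrr Normc.normc0 subr0; congr (_ * _ ^+ _); apply/max_idPr; exact: ltW.
have Fz0 : 0 < F z0.
  apply: lt_le_trans (hz0 w _); last by rewrite subrr Normc.normc0 ltW.
  by rewrite Fw mulr_gt0 ?cmod_gt0 // exprn_gt0.
have wz0 : 0 < wt z0.
  rewrite lt_def wt0 andbT; apply: contraTneq Fz0 => e.
  by rewrite /F e expr0n /= mulr0 ltxx.
have wtE z : 0 < wt z -> wt z = r - cmod (z - w).
  by rewrite {1}/wt lt_max ltxx /= => h; apply/max_idPr; exact: ltW.
have Az0 : 0 < cmod (A z0).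
  rewrite lt_def cmod_ge0 andbT; apply: contraTneq Fz0 => e.
  by rewrite /F e mul0r ltxx.
have e2 : wt z0 = 2 * (wt z0 / 2) by rewrite mulrC divfK.
exists z0, (wt z0 / 2); split.
- by rewrite divr_gt0.
- by rewrite -e2 wtE //; have := cmod_ge0 (z0 - w); lra.
- by rewrite -e2 wtE // addrCA subrr addr0.
- by rewrite -e2 -Fw; apply: hz0; rewrite subrr Normc.normc0 ltW.
move=> z hz; set s := wt z0 / 2 in hz *.
have s0 : 0 < s by rewrite divr_gt0.
have hzw : cmod (z - w) <= cmod (z0 - w) + s.
  by have := cmodD (z - z0) (z0 - w); rewrite addrA subrK; lra.
have wtz0 := wtE _ wz0; have e3 : wt z0 = 2 * s by [].
have wtz : s <= wt z by rewrite /wt le_max; apply/orP; right; lra.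
have h : cmod (A z) * wt z ^+ k.+1 <= cmod (A z0) * (2 * s) ^+ k.+1.
  by rewrite -e3; apply: hz0; lra.
have h2 : cmod (A z) * s ^+ k.+1 <= cmod (A z) * wt z ^+ k.+1.
  by rewrite ler_wpM2l ?cmod_ge0 // lerXn2r ?nnegrE // ltW.
have e4 : (2 * s) ^+ k.+1 = 2 ^+ k.+1 * s ^+ k.+1 by exact: exprMn.
have := le_trans h2 h; rewrite e4 mulrA ler_pM2r ?exprn_gt0 //.
by rewrite mulrC.
Qed.

End LocalLower.

(** * Squares on which the coefficient is large *)

Section LowerSquare.
Variable R : realType.
Local Notation D := (@unit_disc R).
Local Notation cd := (hasd (@id R[i])).
Variable A : R[i] -> R[i].
Hypothesis hA : forall w, D w -> exists d, cd A w d.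

(** This replaces the mean value inequality for |A|^p, for all p > 0. Near the point
z0 of [doubling_point] the Lipschitz estimate keeps |A| above |A(z0)| / 2 on a
square of side comparable to s. Its area loses a factor (s / r)^2, but
|A(z0)| >= |A(w)| (r / (2 s))^(k + 1), and (k + 1) p >= 2 makes up for the loss. *)
Lemma lower_square (p : R) : 0 < p -> exists2 c0 : R, 0 < c0 & forall w, D w ->
  exists z0 h v, [/\ 0 < h, 0 <= v,
    c0 * powR (cmod (A w)) p * (1 - cmod w) ^+ 2 <= powR v p * (2 * h) ^+ 2 &
    forall z, `|Re z - Re z0| <= h -> `|Im z - Im z0| <= h ->
      cmod (z - w) <= (1 - cmod w) / 2 /\ v <= cmod (A z)].
Proof.
move=> p0; pose k := Num.bound (2 / p).
have kp : 2 <= k.+1%:R * p.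
  have h : 0 <= 2 / p by rewrite divr_ge0 // ltW.
  rewrite -ler_pdivrMr // (le_trans (ltW (archi_boundP h))) // ler_nat //.
(* The Lipschitz estimate over distance c s is then |A(z0)| / 2. *)
pose c : R := (8 * 2 ^+ k.+1)^-1.
have k20 : (0 : R) < 2 ^+ k.+1 by rewrite exprn_gt0.
have k21 : (1 : R) <= 2 ^+ k.+1 by rewrite exprn_ege1 // ler1n.
have c0 : 0 < c by rewrite invr_gt0 mulr_gt0.
have c1 : c <= 1 / 8.
  have gen (e : R) : 1 <= e -> (8 * e)^-1 <= 1 / 8.
    move=> e1; have e0 : 0 < 8 * e by lra.
    by rewrite div1r lef_pV2 ?posrE //; lra.
  exact: gen.
exists (powR (1 / 2) p * c ^+ 2 / 16).
  by rewrite divr_gt0 // mulr_gt0 ?powR_gt0 ?exprn_gt0.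
move=> w hw; have w1 : cmod w < 1 by exact: hw.
have d0 : 0 < 1 - cmod w by rewrite subr_gt0.
have [Aw|Aw] := eqVneq (A w) 0.
  exists w, ((1 - cmod w) / 4), 0; split => //.
  - by rewrite divr_gt0.
  - have -> : cmod (A w) = 0 by rewrite Aw /= expr0n /= addr0 sqrtr0.
    by rewrite powR0 ?gt_eqF // mulr0 mul0r mul0r.
  move=> z h1 h2; split; last exact: cmod_ge0.
  apply: le_trans (cmod_le_ReIm _) _; rewrite cReD cImD cReN cImN; lra.
have [z0 [s [s0 sr zr hmax hdb]]] := doubling_point hA k hw Aw.
set r := (1 - cmod w) / 2 in sr zr hmax.
have r0 : 0 < r by rewrite divr_gt0.
have Az0 := cmod_ge0 (A z0).
exists z0, (c * s / 2), (cmod (A z0) / 2); split.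
- by rewrite divr_gt0 // mulr_gt0.
- by rewrite divr_ge0.
- have -> : (2 * (c * s / 2)) ^+ 2 = c ^+ 2 * s ^+ 2 by field.
  have -> : 1 - cmod w = 2 * r by rewrite /r mulrC divfK.
  set q := r / (2 * s); have s20 : 0 < 2 * s by rewrite mulr_gt0.
  have q1 : 1 <= q by rewrite ler_pdivlMr // mul1r.
  have q0 : 0 <= q by rewrite (le_trans _ q1).
  have h1 : cmod (A w) * q ^+ k.+1 <= cmod (A z0).
    rewrite /q exprMn exprVn mulrA ler_pdivrMr ?exprn_gt0 //.
  have h2 : powR (cmod (A w)) p * q ^+ 2 <= powR (cmod (A z0)) p.
    have qk0 : 0 <= q ^+ k.+1 by exact: exprn_ge0.
    have l0 : 0 <= cmod (A w) * q ^+ k.+1 by apply: mulr_ge0 => //; exact: cmod_ge0.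
    apply: le_trans (ge0_ler_powR (ltW p0) l0 Az0 h1).
    rewrite powRM ?cmod_ge0 // ler_wpM2l ?powR_ge0 //.
    rewrite -!powR_mulrn // -powRrM; exact: ler_powR.
  have -> : powR (cmod (A z0) / 2) p = powR (1 / 2) p * powR (cmod (A z0)) p.
    by rewrite mulrC powRM ?invr_ge0 // div1r.
  have e : s ^+ 2 * q ^+ 2 = r ^+ 2 / 4 by rewrite /q; field; rewrite gt_eqF.
  have -> : powR (1 / 2) p * c ^+ 2 / 16 * powR (cmod (A w)) p * (2 * r) ^+ 2 =
     (powR (1 / 2) p * (c ^+ 2 * s ^+ 2)) * (powR (cmod (A w)) p * q ^+ 2).
    have -> : (powR (1 / 2) p * (c ^+ 2 * s ^+ 2)) * (powR (cmod (A w)) p * q ^+ 2) =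
       powR (1 / 2) p * c ^+ 2 * powR (cmod (A w)) p * (s ^+ 2 * q ^+ 2) by ring.
    by rewrite e; field.
  rewrite -[leRHS]mulrA [X in _ <= _ * X]mulrC [leRHS]mulrA ler_wpM2l //.
  by rewrite mulr_ge0 ?powR_ge0 // mulr_ge0 ?exprn_ge0 // ltW.
move=> z h1 h2.
have hz : cmod (z - z0) <= c * s.
  apply: le_trans (cmod_le_ReIm _) _; rewrite cReD cImD cReN cImN; lra.
have cs : c * s <= s / 8 by have := ler_wpM2r (ltW s0) c1; lra.
split.
  have -> : z - w = (z - z0) + (z0 - w) by rewrite addrA subrK.
  by rewrite -/r; apply: le_trans (cmodD _ _) _; lra.
have zD y : cmod (y - z0) <= s -> D y.
  move=> hy; have := cmodD (y - z0) (z0 - w); rewrite addrA subrK => h.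
  have := cmodD (y - w) w; rewrite subrK /unit_disc /=.
  have hr2 : r + r = 1 - cmod w by rewrite /r; lra.
  lra.
have lip := @holomorphic_lip R z0 s s0 A (fun y hy => hA (zD y hy)) _ z hdb.
have {}lip : cmod (A z - A z0) <= 4 * (2 ^+ k.+1 * cmod (A z0)) * cmod (z - z0) / s.
  by apply: lip; lra.
have b : 4 * (2 ^+ k.+1 * cmod (A z0)) * cmod (z - z0) / s <= cmod (A z0) / 2.
  rewrite ler_pdivrMr //.
  have -> : cmod (A z0) / 2 * s = 4 * (2 ^+ k.+1 * cmod (A z0)) * (c * s).
    by rewrite /c; field; rewrite gt_eqF.
  by rewrite ler_wpM2l // mulr_ge0 // mulr_ge0 // ltW.
have := cmodD (A z0 - A z) (A z); rewrite subrK (cmodB (A z0) (A z)); lra.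
Qed.

End LowerSquare.

Section Mass.
Variable R : realType.
Local Notation D := (@unit_disc R).
Local Open Scope ereal_scope.

(** The integral of a nonnegative function is a supremum over the simple functions
below it, hence it is monotone for arbitrary functions. *)
Lemma ge0_le_integral_restrict d (T : measurableType d) (mu : {measure set T -> \bar R})
    (D1 D2 : set T) (f1 f2 : T -> \bar R) :
  (forall x, D1 x -> 0 <= f1 x) -> (forall x, D2 x -> 0 <= f2 x) ->
  (forall x, (f1 \_ D1) x <= (f2 \_ D2) x) ->
  \int[mu]_(x in D1) f1 x <= \int[mu]_(x in D2) f2 x.
Proof.
move=> f10 f20 f12; rewrite !ge0_integralE //.
apply: ereal_sup_le => _ [h /= hh <-]; exists h => //= x.
exact: le_trans (hh x) _.
Qed.

Lemma ge0_le_integral_sub d (T : measurableType d) (mu : {measure set T -> \bar R})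
    (D1 D2 : set T) (f1 f2 : T -> \bar R) : D1 `<=` D2 ->
  (forall x, D1 x -> 0 <= f1 x) -> (forall x, D2 x -> 0 <= f2 x) ->
  (forall x, D1 x -> f1 x <= f2 x) ->
  \int[mu]_(x in D1) f1 x <= \int[mu]_(x in D2) f2 x.
Proof.
move=> D12 f10 f20 f12; apply: ge0_le_integral_restrict => // x; rewrite !patchE.
case: ifPn => [/set_mem D1x|_]; first by rewrite mem_set ?f12 //; exact: D12.
by case: ifPn => // /set_mem /f20.
Qed.

End Mass.

(** * Mass near a point and the test functions *)

Section MassLower.
Variable R : realType.
Local Notation D := (@unit_disc R).
Variables (A : R[i] -> R[i]) (p : R) (mu : {finite_measure set (plane R) -> \bar R}).
Hypotheses (aA : analytic_in_disc A) (p0 : 0 < p).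
Hypothesis hmu : has_density_in_disc mu
    (fun z => powR (cmod (A z)) p * powR (1 - cmod z ^+ 2) (2 * p - 1)).

(** The weight has the exponent 2 p - 1, of either sign. *)
Lemma powR_comparable (q : R) : exists2 c : R, 0 < c & forall d x : R,
  0 < d -> d / 2 <= x -> x <= 3 * d -> c * powR d q <= powR x q.
Proof.
have [q0|q0] := leP 0 q.
  exists (powR (1 / 2) q); first by rewrite powR_gt0.
  move=> d x d0 h1 h2; have d20 : 0 <= d / 2 by rewrite divr_ge0 // ltW.
  rewrite -powRM ?(ltW d0) //.
  have -> : 1 / 2 * d = d / 2 by rewrite mulrC mulrA mulr1.
  by apply: ge0_ler_powR; rewrite ?nnegrE // (le_trans d20).
exists (powR 3 q); first by rewrite powR_gt0.
move=> d x d0 h1 h2; rewrite -powRM ?(ltW d0) //.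
have x0 : 0 < x by apply: lt_le_trans h1; rewrite divr_gt0.
have d30 : 0 < 3 * d by rewrite mulr_gt0.
have inv (y : R) : powR y q = (powR y (- q))^-1 by rewrite -powRN opprK.
rewrite !inv lef_pV2 ?posrE ?powR_gt0 //.
by apply: ge0_ler_powR; rewrite ?nnegrE ?oppr_ge0 ?(ltW q0) ?(ltW x0) ?(ltW d30).
Qed.

Lemma near_boundary (w z : R[i]) : D w -> cmod (z - w) <= (1 - cmod w) / 2 ->
  [/\ D z, (1 - cmod w) / 2 <= defect z & defect z <= 3 * (1 - cmod w)].
Proof.
rewrite /unit_disc /= => hw h.
have h1 : cmod z <= cmod (z - w) + cmod w by have := cmodD (z - w) w; rewrite subrK.
have h2 : cmod w <= cmod (w - z) + cmod z by have := cmodD (w - z) z; rewrite subrK.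
rewrite cmodB in h2; have w0 := cmod_ge0 w; have z0 := cmod_ge0 z.
rewrite /defect; split; [lra|nra|nra].
Qed.

(** On the square of [lower_square] the density of the measure is at least a multiple
of v^p (1 - |w|)^(2 p - 1). *)
Lemma mass_lower : exists2 c1 : R, 0 < c1 & forall w, D w ->
  exists S : set (plane R), [/\ measurable S,
    forall x, S x -> cmod (toC x - w) <= (1 - cmod w) / 2 &
    ((c1 * powR (cmod (A w) * (1 - cmod w) ^+ 2) p * (1 - cmod w))%:E <= mu S)%E].
Proof.
have [c0 c00 hsq] := lower_square (analytic_cd aA) p0.
have [cq cq0 hcq] := powR_comparable (2 * p - 1).
exists (c0 * cq); first by rewrite mulr_gt0.
move=> w hw; have [z0 [h [v [h0 v0 hlow hS]]]] := hsq w hw.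
have d0 : 0 < 1 - cmod w by rewrite subr_gt0.
pose S1 := `[Re z0 - h, Re z0 + h]%classic : set (measurableTypeR R).
pose S2 := `[Im z0 - h, Im z0 + h]%classic : set (measurableTypeR R).
have mS1 : measurable S1 by exact: measurable_itv.
have mS2 : measurable S2 by exact: measurable_itv.
pose S : set (plane R) := S1 `*` S2.
have mS : measurable S by exact: measurableX.
have SP x : S x -> cmod (toC x - w) <= (1 - cmod w) / 2 /\ v <= cmod (A (toC x)).
  move=> [k1 k2].
  have /andP[? ?] : Re z0 - h <= x.1 <= Re z0 + h by move: k1; rewrite /S1 /= in_itv.
  have /andP[? ?] : Im z0 - h <= x.2 <= Im z0 + h by move: k2; rewrite /S2 /= in_itv.
  by apply: hS; rewrite /= ler_norml; apply/andP; split; lra.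
exists S; split => //; first by move=> x /SP[].
rewrite (hmu mS).
have SD : S `&` plane_disc (R := R) = S.
  apply/seteqP; split => [x []//|x Sx]; split => //.
  by have [h1 _] := SP x Sx; have [] := near_boundary hw h1.
rewrite SD; set m := powR v p * (cq * powR (1 - cmod w) (2 * p - 1)).
have m0 : 0 <= m by rewrite !mulr_ge0 ?powR_ge0 // ltW.
have aS : area (R := R) S = ((2 * h) ^+ 2)%:E.
  have -> : area (R := R) S = (lebesgue_measure S1 * lebesgue_measure S2)%E by exact: product_measure1E.
  have leb (y : R) : lebesgue_measure (`[y - h, y + h]%classic : set R) = (2 * h)%:E.
    rewrite lebesgue_measure_itv /= lte_fin.
    have -> : y - h < y + h by lra.
    by rewrite -EFinB; congr EFin; ring.
  have l1 : lebesgue_measure S1 = (2 * h)%:E := leb (Re z0).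
  have l2 : lebesgue_measure S2 = (2 * h)%:E := leb (Im z0).
  by rewrite l1 l2 -EFinM expr2.
apply: (@le_trans _ _ (\int[area (R := R)]_(x in S) (cst m%:E) x)%E).
  have -> : (\int[area (R := R)]_(x in S) (cst m%:E) x = m%:E * area (R := R) S)%E.
    by rewrite integral_cst.
  rewrite aS -EFinM lee_fin /m -[leLHS]mulrA.
  have -> : powR (cmod (A w) * (1 - cmod w) ^+ 2) p * (1 - cmod w) =
     powR (cmod (A w)) p * (1 - cmod w) ^+ 2 * powR (1 - cmod w) (2 * p - 1).
    rewrite powRM ?cmod_ge0 ?sqr_ge0 // -mulrA -[in RHS]mulrA; congr (_ * _).
    have n0 : 1 - cmod w != 0 by rewrite gt_eqF.
    rewrite -!powR_mulrn ?(ltW d0) // -powRrM -powRD; last by rewrite n0 implybT.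
    rewrite -[X in _ * X = _](powRr1 (ltW d0)) -powRD; last by rewrite n0 implybT.
    by congr powR; rewrite mulrC; ring.
  rewrite -[leLHS]mulrA.
  have -> : c0 * (cq * (powR (cmod (A w)) p * (1 - cmod w) ^+ 2 * powR (1 - cmod w) (2 * p - 1))) =
     (c0 * powR (cmod (A w)) p * (1 - cmod w) ^+ 2) * (cq * powR (1 - cmod w) (2 * p - 1)) by ring.
  have -> : powR v p * (cq * powR (1 - cmod w) (2 * p - 1)) * (2 * h) ^+ 2 =
     (powR v p * (2 * h) ^+ 2) * (cq * powR (1 - cmod w) (2 * p - 1)) by ring.
  by rewrite ler_wpM2r // mulr_ge0 ?powR_ge0 // ltW.
apply: ge0_le_integral_sub => // x Sx.
  by rewrite lee_fin mulr_ge0 ?powR_ge0.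
have [h1 h2] := SP x Sx; have [hz b1 b2] := near_boundary hw h1.
rewrite lee_fin /m; apply: ler_pM; rewrite ?powR_ge0 ?mulr_ge0 ?powR_ge0 ?(ltW cq0) //.
  by apply: ge0_ler_powR; rewrite ?nnegrE ?cmod_ge0 // ltW.
exact: hcq.
Qed.

End MassLower.

Section TestFunction.
Variable R : realType.
Local Notation D := (@unit_disc R).
Local Notation cd := (hasd (@id R[i])).
Local Notation ofR := (fun t : R => t%:C).
Local Notation pcont phi := (forall x : R, contat ofR phi x).

Lemma Re_cint_lebesgue (phi : R -> R[i]) (b : R) : 0 < b -> pcont phi ->
  (\int[@lebesgue_measure R]_(t in `[0%R, b]) (Re (phi t))%:E = (Re (cint phi 0 b))%:E)%E.
Proof.
move=> b0 cphi; have [c1 _] := contat_continuous cphi.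
have dF x : -1 < x -> is_derive (x : R^o) (1 : R^o) (prim (fun t => Re (phi t)) : R^o -> R^o) (Re (phi x)).
  by move=> hx; exact: prim_derive.
have cF x : -1 < x -> {for x, continuous (prim (fun t => Re (phi t)))}.
  by move=> /dF[h _]; apply: differentiable_continuous; exact/derivable1_diffP.
rewrite (@continuous_FTC2 R (fun t => Re (phi t)) (prim (fun t => Re (phi t))) 0 b b0).
- by rewrite Re_cint EFinB.
- exact: continuous_subspaceT.
- split.
  + by move=> x; rewrite in_itv /= => /andP[x0 _]; have [] := dF x (lt_trans _ x0); rewrite ?oppr_lt0.
  + by apply: cvg_at_right_filter; apply: cF; rewrite oppr_lt0.
  + by apply: cvg_at_left_filter; apply: cF; rewrite (lt_trans _ b0) // oppr_lt0.
move=> x; rewrite in_itv /= => /andP[x0 _].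
have h := dF x (lt_trans _ x0); rewrite derive1E; apply: derive_val.
by apply: h; rewrite oppr_lt0.
Qed.

(** On the unit circle the modulus of this function is the Poisson kernel of a. *)
Definition test (a w : R[i]) : R[i] := (defect a)%:C / (1 - a^* * w) ^+ 2.

Lemma test_analytic a : D a -> analytic_in_disc (test a).
Proof.
move=> ha w hw; have n := one_sub_neq0 ha hw.
have h1 : cd (fun w => 1 - a^* * w) w (0 - a^* * 1).
  by apply: hasdB; [exact: hasd_cst|apply: hasdZ; exact: hasd_id].
have h2 : cd (fun w => (1 - a^* * w) ^+ 2) w
   ((0 - a^* * 1) * (1 - a^* * w) + (1 - a^* * w) * (0 - a^* * 1)).
  by have h := hasdM h1 h1; apply: hasd_ext h => y; rewrite expr2.
have h3 := hasdZ (defect a)%:C (hasdV (f := fun w => (1 - a^* * w) ^+ 2) (expf_neq0 2 n) h2).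
by have [] := cd_derivable h3.
Qed.

Lemma cmod_test a w : D a -> cmod (test a w) = defect a / cmod (1 - a^* * w) ^+ 2.
Proof.
by move=> ha; rewrite cmodM cmodV cmodX cmod_real gtr0_norm // defect_gt0.
Qed.

(** The Poisson kernel is the real part of 2 zeta / (zeta - b) - 1, whose integral
is known from [winding_number]. *)
Lemma poisson_integral (b : R[i]) : D b ->
  (\int[@lebesgue_measure R]_(t in `[0%R, (2 * pi)%R])
     (defect b / cmod (cis t - b) ^+ 2)%:E = (2 * pi)%:E)%E.
Proof.
move=> hb; have T0 := T_gt0 R.
have hb' : cmod (b - 0) < 1 :> R by rewrite subr0.
have zE t : circ 0 1 t = cis t :> R[i] by rewrite /circ add0r mul1r.
pose kp t : R[i] := 'i%C * (circ 0 1 t - 0) / (circ 0 1 t - b) ^+ 1.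
have ckp : pcont kp.
  apply: (kernel_cont ltr01) => // x; apply: contatM; first exact: contat_cst.
  by apply: contatB; [exact: circ_cont|exact: contat_cst].
pose phi t := - (2 * 'i%C) * kp t - 1.
have cphi : pcont phi.
  move=> x; apply: contatB; last exact: contat_cst.
  by apply: contatM => //; exact: contat_cst.
have e t : defect b / cmod (cis t - b) ^+ 2 = Re (phi t).
  have n : cis t - b != 0 by rewrite -zE; exact: circ_neq.
  have c1 : cmod (cis t) ^+ 2 = 1 by rewrite cmod_cis expr1n.
  rewrite /phi /kp expr1 zE subr0.
  have -> : - (2 * 'i%C) * ('i%C * cis t / (cis t - b)) - 1 =
     (cis t + b) * (cis t - b)^* / (cmod (cis t - b) ^+ 2)%:C.
    have -> : (cmod (cis t - b) ^+ 2)%:C = (cis t - b) * (cis t - b)^*.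
      rewrite cmod_sqr; apply: eq_reim; case: (cis t) (b) => u1 u2 [v1 v2] /=; ring.
    have i2 : - (2 * 'i%C) * ('i%C * cis t / (cis t - b)) = 2 * cis t / (cis t - b).
      have -> : - (2 * 'i%C) * ('i%C * cis t / (cis t - b)) = - ('i%C ^+ 2) * (2 * cis t / (cis t - b)) by ring.
      by rewrite sqr_i opprK mul1r.
    have nj : (cis t - b)^* != 0 by rewrite -cmod_eq0 cmodJ cmod_eq0.
    rewrite i2 -mulf_div divff // mulr1; field; exact: n.
  rewrite -fmorphV; have -> (z : R[i]) (x : R) : Re (z * x%:C) = Re z * x.
    by case: z => z1 z2 /=; rewrite mulr0 subr0.
  congr (_ * _); rewrite /defect -c1 !cmod_sqr; case: (cis t) (b) => u1 u2 [v1 v2] /=; ring.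
under eq_integral do rewrite e.
rewrite Re_cint_lebesgue //; congr EFin.
rewrite /phi cintB ?(ltW T0) //; first last.
- by move=> x; exact: contat_cst.
- by move=> x; apply: contatM => //; exact: contat_cst.
rewrite cintZ ?(ltW T0) //.
have -> : cint kp 0 (2 * pi) = 'i%C * (2 * pi)%:C by exact: winding_number.
have -> : cint (fun=> 1) 0 (2 * pi) = (2 * pi)%:C :> R[i].
  rewrite (@cint_FTC _ _ ofR) ?(ltW T0) ?subr0 //; first by move=> x; exact: contat_cst.
  by move=> x _; exact: hasd_id.
by move: (2 * pi) => T /=; ring.
Qed.

(** As |1 - a^* r e^(i t)| = |e^(i t) - r a|, the mean over the circle of radius r is
dominated by that of the Poisson kernel of r a. *)
Lemma test_hardy a : D a -> (hardy1_norm (test a) <= 1)%E.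
Proof.
move=> ha; apply: ge_ereal_sup => _ [r /= hr <-].
move: hr; rewrite in_itv /= => /andP[r0 r1].
have T0 := T_gt0 R.
pose b := r%:C * a.
have cb : cmod b = r * cmod a by rewrite cmodM cmod_real gtr0_norm.
have hb : D b.
  rewrite /unit_disc /= -/(cmod b) cb.
  by rewrite (le_lt_trans _ ha) // ler_piMl ?cmod_ge0 // ltW.
have le1 : (\int[@lebesgue_measure R]_(t in `[0%R, (2 * pi)%R])
     (cmod (test a ((r * cos t) +i* (r * sin t))))%:E <= (2 * pi)%:E)%E.
  rewrite -(poisson_integral hb); apply: ge0_le_integral_sub => // t _.
  - by rewrite lee_fin cmod_ge0.
  - by rewrite lee_fin divr_ge0 ?exprn_ge0 ?cmod_ge0 // ltW // defect_gt0.
  rewrite lee_fin cmod_test //.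
  have -> : cmod (1 - a^* * ((r * cos t) +i* (r * sin t))) = cmod (cis t - b).
    have -> : (r * cos t) +i* (r * sin t) = r%:C * cis t.
      by apply: eq_reim; rewrite /= ?mul0r ?subr0 ?addr0.
    have h : cmod (1 - b^* * cis t) ^+ 2 = cmod (b - cis t) ^+ 2.
      by rewrite cmod_one_sub_sqr /defect cmod_cis expr1n subrr mulr0 addr0.
    have -> : a^* * (r%:C * cis t) = b^* * cis t.
      by rewrite /b; apply: eq_reim; case: (a) (cis t) => u1 u2 [v1 v2] /=; ring.
    rewrite (cmodB (cis t)); apply/eqP.
    by rewrite -(eqrXn2 (n := 2)) ?cmod_ge0 // h.
  rewrite ler_wpM2r ?invr_ge0 ?exprn_ge0 ?cmod_ge0 //.
  rewrite /defect cb lerD2l lerN2 ler_pXn2r ?nnegrE ?cmod_ge0 ?mulr_ge0 ?(ltW r0) ?cmod_ge0 //.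
  by rewrite ler_piMl ?cmod_ge0 // ltW.
rewrite /circle_mean.
apply: (@le_trans _ _ (((2 * pi)^-1)%:E * (2 * pi)%:E)%E).
  by apply: lee_wpmul2l => //; rewrite lee_fin invr_ge0 ltW.
by rewrite -EFinM mulVf // gt_eqF.
Qed.

End TestFunction.

(** * Consequences of the Carleson condition *)

Section CarlesonPacking.
Variable R : realType.
Local Notation D := (@unit_disc R).
Variables (A : R[i] -> R[i]) (p : R) (mu : {finite_measure set (plane R) -> \bar R}).
Hypotheses (aA : analytic_in_disc A) (p0 : 0 < p).
Hypothesis hmu : has_density_in_disc mu
    (fun z => powR (cmod (A z)) p * powR (1 - cmod z ^+ 2) (2 * p - 1)).
Hypothesis hC : carleson_measure mu.

Lemma test_integral : exists2 M : R, 0 < M & forall a, D a ->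
  (\int[mu]_(x in plane_disc (R := R)) (cmod (test a (toC x)))%:E <= M%:E)%E.
Proof.
have [M M0 hM] := hC; exists M => // a ha.
apply: le_trans (hM _ (test_analytic ha)) _.
rewrite -[leRHS]mule1; apply: lee_wpmul2l; first by rewrite lee_fin ltW.
exact: test_hardy.
Qed.

Local Notation size w := (cmod (A w) * (1 - cmod w) ^+ 2).

(** With m = |1 - a^* w|, |test a| is at least (1 - |a|^2) / (4 m^2) near w, and
(1 - |a|^2) (1 - |w|^2) / m^2 = 2 / (E(a, w) + 1). *)
Lemma test_mass : exists2 c : R, 0 < c & forall w, D w ->
  exists S : set (plane R), [/\ measurable S,
    forall x, S x -> cmod (toC x - w) <= (1 - cmod w) / 2 &
    forall a, D a -> exists2 v : R, 0 <= v &
      (forall x, S x -> v <= cmod (test a (toC x))) /\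
      ((c * powR (size w) p / hcosh a w)%:E <= v%:E * mu S)%E].
Proof.
have [c1 c10 H] := mass_lower aA p0 hmu.
exists (c1 / 8); first by rewrite divr_gt0.
move=> w hw; have [S [mS SP hS]] := H w hw; exists S; split => // a ha.
have w1 : cmod w < 1 by exact: hw.
have d0 : 0 < 1 - cmod w by rewrite subr_gt0.
have [da dw] := (defect_gt0 ha, defect_gt0 hw).
set m := cmod (1 - a^* * w).
have m0 : 0 < m by rewrite cmod_gt0 one_sub_neq0.
have a1 : cmod a < 1 by exact: ha.
have md : 1 - cmod w <= m.
  have := cmodD (1 - a^* * w) (a^* * w); rewrite subrK.
  have -> : cmod (1 : R[i]) = 1 by exact: Normc.normc1.
  have : cmod (a^* * w) <= cmod w by rewrite cmodM cmodJ ler_piMl ?cmod_ge0 // ltW.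
  rewrite -/m; lra.
exists (defect a / (4 * m ^+ 2)).
  by apply: divr_ge0; [exact: ltW|rewrite mulr_ge0 // exprn_ge0 // ltW].
split.
  move=> x /SP hx; have [Dx _ _] := near_boundary hw hx.
  have n0 : 0 < cmod (1 - a^* * toC x) by rewrite cmod_gt0 one_sub_neq0.
  rewrite cmod_test // ler_pM2l // lef_pV2 ?posrE ?mulr_gt0 ?exprn_gt0 //.
  have -> : 4 * m ^+ 2 = (2 * m) ^+ 2 by ring.
  rewrite ler_pXn2r ?nnegrE ?(ltW n0) ?mulr_ge0 ?(ltW m0) //.
  have -> : 1 - a^* * toC x = (1 - a^* * w) + a^* * (w - toC x) by ring.
  apply: le_trans (cmodD _ _) _; rewrite -/m.
  have : cmod (a^* * (w - toC x)) <= cmod (w - toC x).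
    by rewrite cmodM cmodJ ler_piMl ?cmod_ge0 // ltW.
  rewrite (cmodB w); lra.
set X := powR _ p in hS *.
have X0 : 0 <= X by exact: powR_ge0.
have v0 : 0 <= defect a / (4 * m ^+ 2).
  by apply: divr_ge0; [exact: ltW|rewrite mulr_ge0 // exprn_ge0 // ltW].
have fin := fin_num_measure mu S mS.
rewrite -(fineK fin) in hS *; rewrite -EFinM lee_fin; rewrite lee_fin in hS.
apply: le_trans (ler_wpM2l v0 hS).
have E1 := hcosh_ge1 ha hw.
have hE := hcosh_succ ha hw; rewrite -/m in hE.
have dle : defect w <= 2 * (1 - cmod w).
  rewrite /defect; have := cmod_ge0 w; nra.
have m20 : 0 < m ^+ 2 by rewrite exprn_gt0.
have k1 : (hcosh a w)^-1 <= 2 / (hcosh a w + 1).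
  by rewrite ler_pdivlMr ?ler_pdivrMl; lra.
have k2 : 2 / (hcosh a w + 1) = defect a * defect w / m ^+ 2.
  by rewrite hE; field; rewrite !gt_eqF.
have k3 : defect a * defect w / m ^+ 2 <= defect a * (2 * (1 - cmod w)) / m ^+ 2.
  by rewrite ler_pM2r ?invr_gt0 // ler_pM2l.
rewrite k2 in k1; have k4 := le_trans k1 k3.
have cX : 0 <= c1 / 8 * X by rewrite mulr_ge0 // divr_ge0 // ltW.
apply: le_trans (ler_wpM2l cX k4) _; rewrite le_eqVlt; apply/orP; left; apply/eqP.
by field; rewrite gt_eqF.
Qed.

(** Test with a = w, for which E(a, w) = 1. *)
Lemma coefficient_bound : exists K : R, forall w, D w ->
  cmod (A w) * defect w ^+ 2 <= K.
Proof.
have [c c0 H] := test_mass; have [M M0 hM] := test_integral.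
exists (4 * powR (M / c) p^-1) => w hw.
have [S [mS SP hS]] := H w hw; have [v v0 [hv hlow]] := hS w hw.
have w1 : cmod w < 1 by exact: hw.
have d0 : 0 < 1 - cmod w by rewrite subr_gt0.
have le1 : (v%:E * mu S <= M%:E)%E.
  apply: le_trans (hM w hw).
  rewrite -(integral_cst mu mS); apply: ge0_le_integral_sub => x.
  - by move=> /SP h; have [] := near_boundary hw h.
  - by rewrite lee_fin.
  - by rewrite lee_fin cmod_ge0.
  - by move=> Sx; rewrite lee_fin; exact: hv.
have := le_trans hlow le1; rewrite hcoshxx divr1 lee_fin => h.
have s0 : 0 <= size w by rewrite mulr_ge0 ?cmod_ge0 ?sqr_ge0.
have h2 : powR (size w) p <= M / c by rewrite ler_pdivlMr // mulrC.
have h3 : size w <= powR (M / c) p^-1.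
  have -> : size w = powR (powR (size w) p) p^-1.
    by rewrite -powRrM mulfV ?gt_eqF // powRr1.
  have Mc : 0 <= M / c by apply: divr_ge0; exact: ltW.
  have pV : 0 <= p^-1 by rewrite invr_ge0 ltW.
  by apply: ge0_ler_powR; rewrite ?nnegrE ?powR_ge0.
have dle : defect w ^+ 2 <= 4 * (1 - cmod w) ^+ 2.
  have -> : 4 * (1 - cmod w) ^+ 2 = (2 * (1 - cmod w)) ^+ 2 by ring.
  have dw := defect_gt0 hw.
  rewrite ler_pXn2r ?nnegrE ?(ltW dw) ?mulr_ge0 ?(ltW d0) //.
  by rewrite /defect; have := cmod_ge0 w; nra.
apply: le_trans (ler_wpM2l (cmod_ge0 (A w)) dle) _.
by rewrite mulrCA ler_pM2l.
Qed.

(** Each b_i is close to a bad point w_i, and the set S_i of [test_mass] near w_i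
contributes at least a multiple of 1 / E(a, b_i) to the integral of |test a|.
By [packing_count] no point belongs to more than N of the sets S_i, so the
contributions add up to at most N times the whole integral. *)
Lemma packing_sum (eta La : R) : 0 < eta -> 1 <= La -> exists2 C : R, 0 < C &
  forall (a : R[i]) (I : finType) (b w : I -> R[i]), D a ->
    (forall i, [/\ D (b i), D (w i), hcosh (b i) (w i) <= La &
       1 <= cmod (A (w i)) * defect (w i) ^+ 2]) ->
    (forall i j, i != j -> 1 + eta <= hcosh (b i) (b j)) ->
    \sum_i (hcosh a (b i))^-1 <= C.
Proof.
move=> eta0 La1; have [c c0 H] := test_mass; have [M M0 hM] := test_integral.
have La2 : 1 <= 6 * La by lra.
have [N0 hN0] := packing_count eta0 La2.
pose N : R := N0.+1%:R; have N_gt0 : 0 < N by rewrite ltr0n.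
(* At a bad point |A(w)| (1 - |w|)^2 is at least 1 / 4. *)
pose q : R := powR (1 / 4) p; have q0 : 0 < q by rewrite powR_gt0.
exists (M * N * (3 * La) / (c * q)).
  by rewrite divr_gt0 ?mulr_gt0 // (lt_le_trans _ La1).
move=> a I b w ha hI sep.
have /choice [S HS] : forall i, exists S : set (plane R), [/\ measurable S,
    forall x, S x -> cmod (toC x - w i) <= (1 - cmod (w i)) / 2 &
    exists2 v : R, 0 <= v &
      (forall x, S x -> v <= cmod (test a (toC x))) /\
      ((c * powR (size (w i)) p / hcosh a (w i))%:E <= v%:E * mu S)%E].
  move=> i; have [_ hw _ _] := hI i; have [S [h1 h2 h3]] := H _ hw.
  by exists S; split => //; exact: h3.
have /choice [v Hv] : forall i, exists v : R, [/\ 0 <= v,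
   (forall x, S i x -> v <= cmod (test a (toC x))) &
   ((c * powR (size (w i)) p / hcosh a (w i))%:E <= v%:E * mu (S i))%E].
  by move=> i; have [_ _ [v h1 [h2 h3]]] := HS i; exists v.
have mS i : measurable (S i) by case: (HS i).
have SD i x : S i x -> plane_disc x.
  have [_ hw _ _] := hI i; have [_ h _] := HS i.
  by move=> /h /(near_boundary hw)[].
have vN i : 0 <= v i / N by apply: divr_ge0; [case: (Hv i)|exact: ltW].
have vF i x : 0 <= v i / N * \1_(S i) x by rewrite mulr_ge0 ?vN.
pose F (x : plane R) : \bar R := (\sum_i (v i / N * \1_(S i) x)%:E)%E.
have F0 x : (0 <= F x)%E.
  by apply: sume_ge0 => i _; rewrite lee_fin.
have intF : (\int[mu]_(x in setT) F x = \sum_i (v i / N)%:E * mu (S i))%E.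
  rewrite ge0_integral_sum //.
  - apply: eq_bigr => i _; under eq_integral do rewrite EFinM.
    rewrite ge0_integralZl //; first last.
    + by rewrite lee_fin.
    + by apply/measurable_EFinP; exact: measurable_indic.
    by rewrite integral_indic // setIT.
  - move=> i; apply/measurable_EFinP; apply: measurable_funM; first exact: measurable_cst.
    exact: measurable_indic.
  - by move=> i x _; rewrite lee_fin.
have leF : (\int[mu]_(x in setT) F x <= M%:E)%E.
  apply: le_trans (hM a ha); apply: ge0_le_integral_restrict => [x _|x _|x].
  - exact: F0.
  - by rewrite lee_fin cmod_ge0.
  rewrite patch_setT patchE; case: ifPn => [/set_mem Dx|/negP nDx]; last first.
    rewrite /F big1 // => i _; rewrite indicE memNset ?mulr0 // => Sx.
    by apply: nDx; apply: mem_set; exact: SD Sx.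
  rewrite /F sumEFin lee_fin.
  pose J := [set i | x \in S i]%SET.
  have cJ : (#|J| <= N0)%N.
    apply: (hN0 I J b (toC x)) => //.
      move=> i; rewrite inE => /set_mem Sx; have [hb hw hE _] := hI i.
      have [_ h _] := HS i; have [Dx' h1 h2] := near_boundary hw (h x Sx).
      split => //; have w1 : cmod (w i) < 1 by exact: hw.
      have dw := defect_gt0 hw; have dx := defect_gt0 Dx'.
      have E2 : hcosh (toC x) (w i) <= 2.
        rewrite /hcosh -lerBrDl ler_pdivrMr ?mulr_gt0 //.
        have hx := h x Sx; have n0 := cmod_ge0 (toC x - w i).
        have h3 : cmod (toC x - w i) ^+ 2 <= ((1 - cmod (w i)) / 2) ^+ 2.
          by rewrite ler_pXn2r ?nnegrE //; lra.
        have h4 : 1 - cmod (w i) <= defect (w i).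
          by rewrite /defect; have := cmod_ge0 (w i); nra.
        have h5 : (1 - cmod (w i)) / 2 * (1 - cmod (w i)) <= defect (toC x) * defect (w i).
          by apply: ler_pM => //; lra.
        move: h3; rewrite expr2; lra.
      have E1 := hcosh_ge1 Dx' hw; have E3 := hcosh_ge1 hw hb.
      have := hcosh_triangle Dx' hw hb; rewrite (hcoshC (w i)).
      rewrite hcoshC in E3.
      have : hcosh (toC x) (w i) * hcosh (b i) (w i) <= 2 * La.
        by apply: ler_pM; lra.
      lra.
    by move=> i j _ _; exact: sep.
  rewrite (bigID (fun i => i \in J)) /= [X in _ + X]big1 ?addr0; last first.
    by move=> i; rewrite inE => h; rewrite indicE (negbTE h) mulr0.
  set t := cmod _.
  have t0 : 0 <= t by exact: cmod_ge0.
  apply: (@le_trans _ _ (\sum_(i in J) t / N)).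
    apply: ler_sum => i; rewrite inE => Sx; rewrite indicE Sx mulr1.
    rewrite ler_pM2r ?invr_gt0 //; have [_ h _] := Hv i.
    by apply: h; exact: set_mem Sx.
  rewrite sumr_const -mulr_natr mulrAC ler_pdivrMr // ler_wpM2l //.
  by rewrite /N ler_nat (leq_trans cJ).
rewrite intF in leF.
have low i : ((c * q / (3 * La) / N * (hcosh a (b i))^-1)%:E <= (v i / N)%:E * mu (S i))%E.
  have [v0 _ h] := Hv i; have [hb hw hE hbad] := hI i.
  have -> : (v i / N)%:E = (N^-1%:E * (v i)%:E)%E by rewrite -EFinM mulrC.
  rewrite -muleA; apply: le_trans (lee_wpmul2l _ h); last by rewrite lee_fin invr_ge0 ltW.
  rewrite -EFinM lee_fin.
  have w1 : cmod (w i) < 1 by exact: hw.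
  have sz : 1 / 4 <= size (w i).
    have dw := defect_gt0 hw.
    have d4 : defect (w i) ^+ 2 <= 4 * (1 - cmod (w i)) ^+ 2.
      have -> : 4 * (1 - cmod (w i)) ^+ 2 = (2 * (1 - cmod (w i))) ^+ 2 by ring.
      rewrite ler_pXn2r ?nnegrE ?(ltW dw) ?mulr_ge0 ?subr_ge0 ?(ltW w1) //.
      by rewrite /defect; have := cmod_ge0 (w i); nra.
    have := ler_wpM2l (cmod_ge0 (A (w i))) d4; lra.
  have qs : q <= powR (size (w i)) p.
    by apply: ge0_ler_powR; rewrite ?nnegrE ?(ltW p0) //; lra.
  have [E0 E0'] := (hcosh_gt0 ha hw, hcosh_gt0 ha hb).
  have hh : (3 * La)^-1 * (hcosh a (b i))^-1 <= (hcosh a (w i))^-1.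
    rewrite -invfM lef_pV2 ?posrE ?mulr_gt0 //; last by lra.
    have := hcosh_triangle ha hb hw => ht; apply: le_trans ht _.
    by rewrite mulrAC ler_pM2r // ler_pM2l.
  have -> : c * q / (3 * La) / N * (hcosh a (b i))^-1 =
     N^-1 * (c * q * ((3 * La)^-1 * (hcosh a (b i))^-1)) by field; rewrite !gt_eqF //; lra.
  rewrite ler_pM2l ?invr_gt0 //; apply: ler_pM => //.
  - by rewrite mulr_ge0 // ltW.
  - by rewrite mulr_ge0 ?invr_ge0 ?(ltW E0') //; lra.
  by rewrite ler_pM2l.
have fin : ((\sum_i c * q / (3 * La) / N * (hcosh a (b i))^-1)%:E <= M%:E)%E.
  by apply: le_trans leF; rewrite -sumEFin; apply: lee_sum => i _; exact: low.
move: fin; rewrite lee_fin -mulr_sumr => h.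
have k0 : 0 < c * q / (3 * La) / N by rewrite !divr_gt0 ?mulr_gt0 //; lra.
rewrite -(ler_pM2l k0); apply: le_trans h _.
rewrite le_eqVlt; apply/orP; left; apply/eqP; field; rewrite !gt_eqF //; lra.
Qed.

End CarlesonPacking.

(** * Zero sequences and their products *)

Section Zeros.
Variable R : realType.
Local Notation D := (@unit_disc R).

Lemma card_le1_eq (T : pointedType) (A : set T) (m : nat) : (A #= `I_m)%card -> (m <= 1)%N ->
  forall x y, A x -> A y -> x = y.
Proof.
move=> + m1; rewrite card_eq_le => /andP[/pcard_leP[g] _] x y Ax Ay.
have lt0 z : A z -> g z = 0%N.
  by move=> Az; have := @funS _ _ _ _ g z Az => /= h; case: (g z) (leq_trans h m1).
apply: (@inj _ _ _ g); rewrite ?inE //.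
exact: etrans (lt0 _ Ax) (esym (lt0 _ Ay)).
Qed.

Variables (A f : R[i] -> R[i]) (K : R).
Hypothesis hf : solution A f.
Hypothesis nt : nontrivial_in_disc f.
Hypothesis hK : forall w, D w -> cmod (A w) * defect w ^+ 2 <= K.
Variables (N : set nat) (z : nat -> R[i]).
Hypothesis hz : zero_sequence f N z.

Lemma zero_sequence_zero n : N n -> f (z n) = 0.
Proof.
move=> Nn; have [_ zD H] := hz.
have [[|m] [hm _] hc] := H _ (zD n Nn); last by apply: (hm 0%N).
have : [set k | N k /\ z k = z n] = set0.
  by apply/eqP; rewrite -(@card_eq0 _ nat); move: hc; congr (_ #= _)%card; apply/seteqP; split.
by move=> e; have : [set k | N k /\ z k = z n] n by []; rewrite e.
Qed.

(** A repeated entry is a zero of order at least two, at which f and f' vanish. *)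
Lemma zero_sequence_inj n n' : N n -> N n' -> z n = z n' -> n = n'.
Proof.
move=> Nn Nn' e; have [_ zD H] := hz.
have [m [hm hne] hc] := H _ (zD n Nn).
have [m1|m2] := leqP m 1; first exact: (card_le1_eq hc m1).
exfalso; have [v hv] := nt; apply/negP; rewrite negbK; apply/eqP.
apply: (solution_unique hf hK (zD n Nn)) hv; first by apply: (hm 0%N); exact: leq_trans m2.
exact: (hm 1%N).
Qed.

End Zeros.

Section Products.
Variable R : realType.
Local Notation D := (@unit_disc R).

Lemma pseudohyp_le1 (a b : R[i]) : D a -> D b -> 0 <= pseudohyp a b <= 1.
Proof.
move=> ha hb; have n := one_sub_neq0 ha hb.
have c0 : 0 < cmod (1 - a^* * b) by rewrite cmod_gt0.
rewrite divr_ge0 ?cmod_ge0 //= ler_pdivrMr // mul1r.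
rewrite -(ler_pXn2r (n := 2)) ?nnegrE ?cmod_ge0 //.
by rewrite cmod_one_sub_sqr lerDl mulr_ge0 // ltW // defect_gt0.
Qed.

(** rho >= rho^2 = (E - 1) / (E + 1) = 1 / (1 + 2 / (E - 1)) >= exp (-2 / (E - 1)),
and E - 1 >= eta E / (1 + eta). *)
Lemma pseudohyp_ge (a b : R[i]) (eta : R) : D a -> D b -> 0 < eta ->
  1 + eta <= hcosh b a ->
  expR (- (2 * (1 + eta) / eta * (hcosh b a)^-1)) <= pseudohyp a b.
Proof.
move=> ha hb eta0; rewrite hcoshC => hE.
have [dda db] := (defect_gt0 ha, defect_gt0 hb).
have /andP[p0 p1] := pseudohyp_le1 ha hb.
set E := hcosh a b in hE *.
have E1 : 0 < E - 1 by lra.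
have E0 : 0 < E by lra.
have sq : pseudohyp a b ^+ 2 = (E - 1) / (E + 1).
  rewrite /pseudohyp exprMn exprVn cmod_one_sub_sqr.
  have -> : E = 1 + 2 * cmod (a - b) ^+ 2 / (defect a * defect b) by [].
  have : 0 <= cmod (a - b) ^+ 2 by rewrite sqr_ge0.
  move: (cmod (a - b) ^+ 2) (defect a) (defect b) dda db => n d1 d2 d10 d20 n0.
  have d12 : 0 < d1 * d2 by rewrite mulr_gt0.
  by field; rewrite !gt_eqF //; lra.
have le2 : pseudohyp a b ^+ 2 <= pseudohyp a b by rewrite expr2 ler_piMl.
apply: le_trans le2; rewrite sq.
have -> : (E - 1) / (E + 1) = (1 + 2 / (E - 1))^-1 by field; rewrite !gt_eqF //; lra.
rewrite expRN lef_pV2 ?posrE ?expR_gt0 //; last by rewrite addr_gt0 // divr_gt0.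
apply: le_trans (expR_ge1Dx _); rewrite lerD2l.
have -> : 2 * (1 + eta) / eta / E = 2 * ((1 + eta) / (eta * E)) by field; rewrite !gt_eqF.
rewrite ler_pM2l // -[leLHS]mul1r ler_pdivrMr // mulrAC ler_pdivlMr ?mulr_gt0 //.
by rewrite mul1r; nra.
Qed.

End Products.

Theorem corollary5 (R : realType) (A : R[i] -> R[i]) (p : R)
  (mu : {finite_measure set (plane R) -> \bar R}) :
  analytic_in_disc A ->
  0 < p ->
  has_density_in_disc mu
    (fun z => powR (cmod (A z)) p * powR (1 - cmod z ^+ 2) (2 * p - 1)) ->
  carleson_measure mu ->
  forall f : R[i] -> R[i], solution A f -> nontrivial_in_disc f ->
  forall (N : set nat) (z : nat -> R[i]), zero_sequence f N z ->
  uniformly_separated N z.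
Proof.
move=> aA p0 hmu hC f hf nt N z hz.
have [K hK] := coefficient_bound aA p0 hmu hC.
have [eta eta0 sepz] := zeros_separated hf hK nt.
have [_ zD _] := hz.
have fz n : N n -> f (z n) = 0 by exact: zero_sequence_zero hz n.
have zinj : forall n n', N n -> N n' -> n != n' -> z n != z n'.
  move=> n n' Nn Nn'; apply: contraNneq => /(zero_sequence_inj hf nt hK hz Nn Nn') ->.
  exact: eqxx.
pose B : set R[i] := [set w | unit_disc w /\ 1 <= cmod (A w) * defect w ^+ 2].
have BD u : B u -> unit_disc u by case.
pose eta' := Num.min eta 1.
have eta'0 : 0 < eta' by rewrite lt_min eta0 ltr01.
have La1 : 1 <= 972%:R :> R by rewrite ler1n.
have [C C0 hsum] := packing_sum aA p0 hmu hC eta'0 La1.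
pose kappa := 2 * (1 + eta) / eta.
have k0 : 0 < kappa by rewrite divr_gt0 // mulr_gt0 // addr_gt0.
pose delta := expR (- (kappa * C)).
suff lower k m : N k -> delta <= \prod_(n < m | ((n : nat) \in N) && (n != k :> nat))
     pseudohyp (z n) (z k).
  apply: (@lt_le_trans _ _ delta%:E); first by rewrite lte_fin expR_gt0.
  apply: le_ereal_inf_tmp => _ [k Nk <-]; rewrite lee_fin.
  apply: limr_ge; last by apply: nearW => m; exact: lower.
  apply: nonincreasing_is_cvgn; last by exists delta => _ [m _ <-]; exact: lower.
  apply/nonincreasing_seqP => m.
  rewrite [leLHS]big_mkcond [leRHS]big_mkcond big_ord_recr /=.
  have F01 (n : nat) : 0 <= (if (n \in N) && (n != k) then pseudohyp (z n) (z k) else 1) <= 1.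
    case: ifP => [/andP[/set_mem Nn _]|_]; last by rewrite ler01 lexx.
    exact: pseudohyp_le1 (zD _ Nn) (zD _ Nk).
  apply: ler_piMr; last by case/andP: (F01 m).
  by apply: prodr_ge0 => i _; case/andP: (F01 i).
move=> Nk; pose a := z k; have ha : unit_disc a := zD k Nk.
pose J : {set 'I_m} := [set i : 'I_m | ((i : nat) \in N) && (i != k :> nat)]%SET.
have JP (i : 'I_#|J|) : N (enum_val i) /\ (enum_val i : nat) != k.
  by have := enum_valP i; rewrite inE => /andP[/set_mem].
pose x (i : 'I_#|J|) := z (enum_val i).
have xD i : unit_disc (x i) by apply: zD; case: (JP i).
have fx i : f (x i) = 0 by apply: fz; case: (JP i).
have xa i : x i != a by case: (JP i) => h1 h2; exact: zinj.
have xx i j : i != j -> x i != x j.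
  move=> ij; case: (JP i) => hi _; case: (JP j) => hj _; apply: zinj => //.
  by apply: contraNneq ij => /val_inj/enum_val_inj ->.
(* Stops on the segments from a to the other zeros, with a nearby bad point. *)
have stop i : exists bw : R[i] * R[i], [/\ seg a (x i) bw.1, B bw.2, hcosh bw.1 bw.2 <= 972 &
    bw.1 = x i \/ far_from B bw.1 (x i)].
  have [w hw sw] := bad_point_between hf hK nt ha (xD i) (negbT (introF eqP (fun e => elimN eqP (xa i) (esym e)))) (fz k Nk) (fx i).
  have Bw : B w by split=> //; case: sw.
  have [b [sb [w' Bw' hw'] hb]] := stop_exists ha (xD i) BD (ex_intro2 _ _ w Bw sw).
  by exists (b, w').
have [bw hbw] := choice stop.
have bD i : unit_disc (bw i).1 by case: (hbw i) => -[].
(* Two stops with E < 1 + eta' would be the zeros themselves, which are separated. *)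
have sum_le : \sum_i (hcosh a (bw i).1)^-1 <= C.
  apply: (hsum a _ (fun i => (bw i).1) (fun i => (bw i).2) ha) => [i|i j ij].
    by have [_ [h1 h2] h3 _] := hbw i; split.
  rewrite leNgt; apply/negP => hlt.
  have e2 : hcosh (bw i).1 (bw j).1 <= 2.
    have : eta' <= 1 by rewrite ge_min lexx orbT.
    lra.
  have [w hw sw] := bad_point_between hf hK nt (xD i) (xD j) (xx i j ij) (fx i) (fx j).
  have Bw : B w by split=> //; case: sw.
  have [_ _ _ hi] := hbw i; have [_ _ _ hj] := hbw j.
  have [ei ej] := stops_separated BD (xD i) (xD j) (bD i) (bD j) hi hj Bw sw e2.
  have := sepz _ _ (xD i) (xD j) (xx i j ij) (fx i) (fx j).
  rewrite -ei -ej; have : eta' <= eta by rewrite ge_min lexx.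
  lra.
have -> : \prod_(n < m | ((n : nat) \in N) && (n != k :> nat)) pseudohyp (z n) (z k) =
    \prod_(i < #|J|) pseudohyp (x i) a.
  by rewrite -(big_enum_val (fun n : 'I_m => pseudohyp (z n) a)); apply: eq_bigl => n; rewrite inE.
have le1 : \prod_(i < #|J|) expR (- (kappa * (hcosh a (x i))^-1)) <= \prod_(i < #|J|) pseudohyp (x i) a.
  apply: ler_prod => i _; rewrite expR_ge0 /=; apply: pseudohyp_ge => //.
  by apply: sepz => //; [rewrite eq_sym|exact: fz].
apply: le_trans le1; rewrite -expR_sum /delta ler_expR sumrN lerN2 -mulr_sumr ler_pM2l //.
apply: le_trans sum_le; apply: ler_sum => i _.
have [sb _ _ _] := hbw i.
by rewrite lef_pV2 ?posrE ?hcosh_gt0 //; exact: seg_le.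
Qed.
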